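(* Let $(X_i,Y_i)_{i=1}^N$ be i.i.d. copies of a centered random vector $(X,Y)\in\mathbb R^{d_X+d_Y}$ (with $X\in\mathbb R^{d_X}$, $Y\in\mathbb R^{d_Y}$). Assume that $X$ and $Y$ are sub-Gaussian random vectors with nonzero covariance matrices $\Sigma_X$ and $\Sigma_Y$ and sub-Gaussian constants $K_X,K_Y$; no assumption is made on the dependence between $X$ and $Y$. Set \[ r_X:=\frac{\operatorname{tr}(\Sigma_X)}{\|\Sigma_X\|},\qquad r_Y:=\frac{\operatorname{tr}(\Sigma_Y)}{\|\Sigma_Y\|}. \] Then there are universal constants $C,c>0$ such that the following hold. (i) For every $u\ge 1$, with probability at least $1-\exp(-u)$, \[ \bigg\|\frac{1}{N}\sum_{i=1}^{N} X_i Y_i^{\top}-\mathbb{E}\, X Y^{\top}\bigg\| \le C\, K_{X}K_{Y}(\|\Sigma_{X}\|\|\Sigma_Y\|)^{1/2} \bigg(\sqrt{\frac{r_{X}+r_{Y}+u}{N}}+ \frac{\sqrt{(r_{X}+u)(r_{Y}+u)}}{N}\bigg). \] (ii) Consequently, \[ \mathbb{E} \bigg\|\frac{1}{N}\sum_{i=1}^{N} X_i Y^{\top}_i-\mathbb{E}\, X Y^{\top}\bigg\| \le C\, K_{X}K_{Y} (\|\Sigma_{X}\|\|\Sigma_Y\|)^{1/2} \bigg(\sqrt{\frac{r_{X}+r_{Y}}{N}}+ \frac{\sqrt{r_{X}r_{Y}}}{N}\bigg). \] (iii) If moreover $(X,Y)$ is jointly Gaussian, then \[ c\,(\|\Sigma_{X}\|\|\Sigma_Y\|)^{1/2}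 \bigg(\sqrt{\frac{r_{X}+r_{Y}}{N}}+ \frac{\sqrt{r_{X}r_{Y}}}{N}\bigg)\le \mathbb{E} \bigg\|\frac{1}{N}\sum_{i=1}^{N} X_i Y^{\top}_i-\mathbb{E}\, XY^{\top}\bigg\| \le C\,(\|\Sigma_{X}\|\|\Sigma_Y\|)^{1/2} \bigg(\sqrt{\frac{r_{X}+r_{Y}}{N}}+ \frac{\sqrt{r_{X}r_{Y}}}{N}\bigg). \]
   Context: $\|\cdot\|$ applied to a matrix denotes the operator norm, $\operatorname{tr}$ the trace. For a real random variable $Z$, $\|Z\|_{\psi_2}:=\inf\{t>0:\mathbb E\exp(Z^2/t^2)\le 2\}$ and $\|Z\|_{L_p}:=(\mathbb E|Z|^p)^{1/p}$. A random vector $X\in\mathbb R^d$ is sub-Gaussian if there is $K>0$ with $\|\langle X,v\rangle\|_{\psi_2}\le K\|\langle X,v\rangle\|_{L_2}$ for all $v$ in the unit sphere $\mathbb S^{d-1}$; the smallest such $K$ is the sub-Gaussian constant of $X$. Covariance matrices may be singular but are assumed nonzero. ''Universal constant'' means a constant independent of $N,d_X,d_Y,u$, the covariances, the sub-Gaussian constants and the distribution. *)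

(* Defs.v *)
From HB Require Import structures.
From mathcomp Require Import all_boot all_order all_algebra.
From mathcomp Require Import all_classical all_reals all_analysis.
From mathcomp Require Import Rstruct Rstruct_topology.
Set Implicit Arguments. Unset Strict Implicit. Unset Printing Implicit Defensive.
Import Order.TTheory GRing.Theory Num.Theory.
Local Open Scope classical_set_scope.
Local Open Scope ring_scope.

Section defs.
Context {R : realType} {d : measure_display} {T : measurableType d}.
Variable P : probability T R.

Definition vnorm n (v : 'cV[R]_n) : R := Num.sqrt (\sum_(k < n) v k 0 ^+ 2).
Definition opnorm m n (A : 'M[R]_(m, n)) : R :=
  sup [set vnorm (A *m v) | v in [set v : 'cV[R]_n | vnorm v <= 1]].

Definition Ex (f : T -> R) : R := fine (\int[P]_w (f w)%:E)%E.

(** psi_2 norm: inf {t > 0 : E exp(Z^2/t^2) <= 2}  (in \bar R, +oo if empty) *)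
Definition psi2norm (Z : T -> R) : \bar R :=
  ereal_inf [set t%:E | t in [set t : R | 0 < t /\
     (\int[P]_w (expR (Z w ^+ 2 / t ^+ 2))%:E <= 2%:E)%E]].

Definition L2norm (Z : T -> R) : R := Num.sqrt (Ex (fun w => Z w ^+ 2)).

Definition ip n (X : T -> 'cV[R]_n) (v : 'cV[R]_n) : T -> R :=
  fun w => \sum_(k < n) X w k 0 * v k 0.

Definition unit_sphere n := [set v : 'cV[R]_n | vnorm v = 1].

Definition measurable_coords n (X : T -> 'cV[R]_n) : Prop :=
  forall k : 'I_n, measurable_fun setT (fun w => X w k 0).

Definition L2_random_vector n (X : T -> 'cV[R]_n) : Prop :=
  forall k : 'I_n, measurable_fun setT (fun w => X w k 0) /\
    P.-integrable setT (fun w => (X w k 0 ^+ 2)%:E).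

Definition subg_condition n (X : T -> 'cV[R]_n) (K : R) : Prop :=
  0 < K /\ forall v, unit_sphere v ->
    (psi2norm (ip X v) <= (K * L2norm (ip X v))%:E)%E.

Definition subgaussian n (X : T -> 'cV[R]_n) : Prop :=
  L2_random_vector X /\ exists K, subg_condition X K.

Definition subg_const n (X : T -> 'cV[R]_n) : R := inf [set K | subg_condition X K].

Definition centered n (X : T -> 'cV[R]_n) : Prop :=
  forall k : 'I_n, Ex (fun w => X w k 0) = 0.

Definition cross_cov m n (X : T -> 'cV[R]_m) (Y : T -> 'cV[R]_n) : 'M[R]_(m, n) :=
  \matrix_(k, l) Ex (fun w => X w k 0 * Y w l 0).

(** box events for a pair of random vectors; boxes of Borel sets generate the
    product sigma-algebra and form a pi-system, so they determine joint laws *)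
Definition box_event m n (X : T -> 'cV[R]_m) (Y : T -> 'cV[R]_n)
  (A : 'I_m -> set R) (B : 'I_n -> set R) : set T :=
  [set w | (forall k, A k (X w k 0)) /\ (forall l, B l (Y w l 0))].

Definition measurable_box m n (A : 'I_m -> set R) (B : 'I_n -> set R) : Prop :=
  (forall k, measurable (A k)) /\ (forall l, measurable (B l)).

Definition same_law m n (X' X : T -> 'cV[R]_m) (Y' Y : T -> 'cV[R]_n) : Prop :=
  forall A B, measurable_box A B -> P (box_event X' Y' A B) = P (box_event X Y A B).

Definition indep_pairs N m n (Xs : 'I_N -> T -> 'cV[R]_m) (Ys : 'I_N -> T -> 'cV[R]_n) : Prop :=
  forall (A : 'I_N -> 'I_m -> set R) (B : 'I_N -> 'I_n -> set R),
    (forall i, measurable_box (A i) (B i)) ->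
    P (\bigcap_(i in [set: 'I_N]) box_event (Xs i) (Ys i) (A i) (B i)) =
    (\prod_(i < N) P (box_event (Xs i) (Ys i) (A i) (B i)))%E.

Definition gaussian_rv (Z : T -> R) : Prop :=
  measurable_fun setT Z /\
  exists mu s : R, 0 <= s /\ forall B : set R, measurable B ->
    P (Z @^-1` B) = (if s == 0 then \d_mu B else normal_prob mu s B).

Definition jointly_gaussian m n (X : T -> 'cV[R]_m) (Y : T -> 'cV[R]_n) : Prop :=
  forall (a : 'cV[R]_m) (b : 'cV[R]_n), gaussian_rv (fun w => ip X a w + ip Y b w).

Definition emp_dev N m n (Xs : 'I_N -> T -> 'cV[R]_m) (Ys : 'I_N -> T -> 'cV[R]_n)
  (X : T -> 'cV[R]_m) (Y : T -> 'cV[R]_n) (w : T) : 'M[R]_(m, n) :=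
  N%:R^-1 *: (\sum_(i < N) (Xs i w *m (Ys i w)^T)) - cross_cov X Y.

End defs.

Definition eff_rank {R : realType} n (S : 'M[R]_n) : R := \tr S / opnorm S.

(* Main.v *)
(** Upper bounds.  The deviation is a supremum of bilinear statistics over two
    unit balls.  Both balls are smoothed by laws of normalised sums of tilted
    random signs, whose relative entropy with respect to the uniform law is at
    most [beta]: a finite substitute for Gaussian smoothing of covariance
    [1 / beta].  Restricted to parameters at which the quadratic forms of the
    covariances are of the order of their means, the product of the two linear
    forms is subexponential, so the Gibbs variational inequality applied to a
    single exponential moment bounds all directions simultaneously.  The choice
    [beta = min(r_X, r_Y) + u] balances entropy against the subexponential
    norm.

    Lower bound.  Testing the deviation on the directions of [X_1] and [Y_1]
    gives [(E |X| |Y| - sigma) / N], because the other samples are independent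
    of them; the mean of [|X| |Y|] reduces coordinatewise to a small ball
    estimate.  Freezing instead a top direction of one covariance leaves sums
    of independent products of two Gaussian variables, whose first moment is
    bounded below through their second and exponential moments. *)
Require Import Defs.
From HB Require Import structures.
From mathcomp Require Import all_boot all_order all_algebra.
From mathcomp Require Import all_classical all_reals all_analysis.
From mathcomp Require Import Rstruct Rstruct_topology.
From mathcomp Require Import measurable_realfun exp.
From mathcomp Require Import ring lra.
Set Implicit Arguments. Unset Strict Implicit. Unset Printing Implicit Defensive.
Import Order.TTheory GRing.Theory Num.Theory.
Import numFieldTopology.Exports.
Local Open Scope classical_set_scope.
Local Open Scope ring_scope.

(** * Linear algebra *)

Section linear_algebra.
Context {R : realType}.

(** Two obstructions shape the upper bound. Restricting a smoothing law moves its barycentre, so the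
    statistic is controlled not at the given unit vectors but within [4^-1] of them; the error is
    itself bounded by the operator norm and is absorbed at the cost of a factor 16/7. Moreover the
    exponential moment exists only for normalised exponents [s <= 2^-1], and this constraint
    produces the second term of the rate. The smoothing laws are finite so that averages over
    parameters are finite sums, which commute with expectations. All randomness is condensed into
    one variable [W >= 1] of mean at most 2 that enters through its logarithm: Markov's inequality
    for [W] gives the tail, a linear bound on [ln] gives the mean, and no tail is integrated. In the
    lower bound the coordinates of a vector are weighted by their standard deviations, whose squares
    sum to the trace, so no covariance is diagonalised. *)

Lemma discriminant_le (A B C : R) : 0 <= B ->
  (forall t, 0 <= A - t * C *+ 2 + t ^+ 2 * B) -> C ^+ 2 <= A * B.
Proof.
rewrite le_eqVlt => /predU1P[<- h|B0 h].
  suff -> : C = 0 by rewrite expr0n/= mulr0.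
  apply/eqP/negPn/negP => C0.
  (* For [B = 0] the polynomial is affine in [t], and its value at this point is [-1]. *)
  have := h ((A + 1) / (C *+ 2)).
  suff -> : A - (A + 1) / (C *+ 2) * C *+ 2 + ((A + 1) / (C *+ 2)) ^+ 2 * 0 = -1.
    by rewrite oppr_ge0 ler10.
  by field.
(* The minimiser of the quadratic. *)
have := h (C / B).
have -> : A - C / B * C *+ 2 + (C / B) ^+ 2 * B = (A * B - C ^+ 2) / B.
  by field; rewrite gt_eqF.
by rewrite pmulr_lge0 ?invr_gt0// subr_ge0.
Qed.

Lemma weighted_CauchySchwarz (I : finType) (p a b : I -> R) :
  (forall i, 0 <= p i) ->
  (\sum_i p i * (a i * b i)) ^+ 2 <=
  (\sum_i p i * a i ^+ 2) * (\sum_i p i * b i ^+ 2).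
Proof.
move=> p0; apply: discriminant_le => [|t].
  by apply: sumr_ge0 => i _; rewrite mulr_ge0// sqr_ge0.
rewrite -mulrnAr -sumrMnl !mulr_sumr -sumrN -!big_split/=.
apply: sumr_ge0 => i _.
have -> : p i * a i ^+ 2 - t * (p i * (a i * b i) *+ 2) + t ^+ 2 * (p i * b i ^+ 2)
  = p i * (a i - t * b i) ^+ 2 by ring.
by rewrite mulr_ge0// sqr_ge0.
Qed.

Definition dot n (u v : 'cV[R]_n) : R := \sum_k u k 0 * v k 0.

Lemma dotC n (u v : 'cV[R]_n) : dot u v = dot v u.
Proof. by apply: eq_bigr => k _; rewrite mulrC. Qed.

Lemma dotDl n (u v w : 'cV[R]_n) : dot (u + v) w = dot u w + dot v w.
Proof. by rewrite -big_split; apply: eq_bigr => k _; rewrite mxE mulrDl. Qed.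

Lemma dotZl n (u w : 'cV[R]_n) (a : R) : dot (a *: u) w = a * dot u w.
Proof. by rewrite mulr_sumr; apply: eq_bigr => k _; rewrite mxE mulrA. Qed.

Lemma dotNl n (u w : 'cV[R]_n) : dot (- u) w = - dot u w.
Proof. by rewrite -scaleN1r dotZl mulN1r. Qed.

Lemma dotBl n (u v w : 'cV[R]_n) : dot (u - v) w = dot u w - dot v w.
Proof. by rewrite dotDl dotNl. Qed.

Lemma dotDr n (u v w : 'cV[R]_n) : dot w (u + v) = dot w u + dot w v.
Proof. by rewrite dotC dotDl !(dotC w). Qed.

Lemma dotZr n (u w : 'cV[R]_n) (a : R) : dot w (a *: u) = a * dot w u.
Proof. by rewrite dotC dotZl (dotC w). Qed.

Lemma dotNr n (u w : 'cV[R]_n) : dot w (- u) = - dot w u.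
Proof. by rewrite dotC dotNl (dotC w). Qed.

Lemma dotBr n (u v w : 'cV[R]_n) : dot w (u - v) = dot w u - dot w v.
Proof. by rewrite dotDr dotNr. Qed.

Lemma dot0l n (w : 'cV[R]_n) : dot 0 w = 0.
Proof. by rewrite -(scale0r 0) dotZl mul0r. Qed.

Lemma dot_suml n (I : Type) (r : seq I) (F : I -> 'cV[R]_n) (w : 'cV[R]_n) :
  dot (\sum_(i <- r) F i) w = \sum_(i <- r) dot (F i) w.
Proof.
elim: r => [|i r IH]; first by rewrite !big_nil dot0l.
by rewrite !big_cons dotDl IH.
Qed.

Lemma dot_sumr n (I : Type) (r : seq I) (F : I -> 'cV[R]_n) (w : 'cV[R]_n) :
  dot w (\sum_(i <- r) F i) = \sum_(i <- r) dot w (F i).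
Proof. by rewrite dotC dot_suml; apply: eq_bigr => i _; rewrite dotC. Qed.

Lemma dot_deltar n (u : 'cV[R]_n) k : dot u (delta_mx k 0) = u k 0.
Proof.
rewrite /dot (bigD1 k)//= mxE !eqxx mulr1 big1 ?addr0// => i ik.
by rewrite mxE (negbTE ik) mulr0.
Qed.

Lemma dot_mulmx m n (A : 'M[R]_(m, n)) u v : dot u (A *m v) = dot (A^T *m u) v.
Proof.
rewrite /dot; under eq_bigr do rewrite mxE mulr_sumr.
rewrite exchange_big/=; apply: eq_bigr => k _.
by rewrite mxE mulr_suml; apply: eq_bigr => l _; rewrite mxE mulrCA mulrA.
Qed.

Lemma vnorm_ge0 n (v : 'cV[R]_n) : 0 <= vnorm v.
Proof. exact: sqrtr_ge0. Qed.

Lemma vnorm_sqr n (v : 'cV[R]_n) : vnorm v ^+ 2 = dot v v.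
Proof.
rewrite /vnorm sqr_sqrtr; first by apply: eq_bigr => k _; rewrite expr2.
by apply: sumr_ge0 => k _; rewrite sqr_ge0.
Qed.

Lemma dot_le n (u v : 'cV[R]_n) : dot u v <= vnorm u * vnorm v.
Proof.
rewrite (le_trans (ler_norm _))// -ler_sqr ?nnegrE ?mulr_ge0 ?vnorm_ge0//.
rewrite real_normK ?num_real// exprMn !vnorm_sqr /dot.
have := @weighted_CauchySchwarz _ (fun=> 1) (fun k => u k 0) (fun k => v k 0) (fun=> ler01).
by congr (_ ^+ 2 <= _ * _); apply: eq_bigr => k _; rewrite mul1r// expr2.
Qed.

Lemma normr_dot_le n (u v : 'cV[R]_n) : `|dot u v| <= vnorm u * vnorm v.
Proof.
rewrite ler_norml dot_le andbT lerNl -dotNl (le_trans (dot_le _ _))//.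
rewrite ler_wpM2r ?vnorm_ge0// -ler_sqr ?nnegrE ?vnorm_ge0//.
by rewrite !vnorm_sqr dotNl dotNr opprK.
Qed.

Lemma vnormZ n (a : R) (v : 'cV[R]_n) : vnorm (a *: v) = `|a| * vnorm v.
Proof.
apply/eqP; rewrite -(@eqrXn2 _ 2) ?mulr_ge0 ?vnorm_ge0//.
by rewrite exprMn !vnorm_sqr dotZl dotZr real_normK ?num_real// mulrA expr2.
Qed.

Lemma vnorm0 n : vnorm (0 : 'cV[R]_n) = 0.
Proof. by rewrite -(scale0r 0) vnormZ normr0 mul0r. Qed.

Lemma vnorm_eq0 n (v : 'cV[R]_n) : vnorm v = 0 -> v = 0.
Proof.
move=> v0; apply/matrixP => k j; rewrite ord1 mxE; apply/eqP.
have : dot v v == 0 by rewrite -vnorm_sqr v0 expr0n.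
rewrite psumr_eq0; last by move=> i _; rewrite -expr2 sqr_ge0.
by move=> /allP/(_ k (mem_index_enum _)); rewrite -expr2 sqrf_eq0.
Qed.

Lemma vnormD n (u v : 'cV[R]_n) : vnorm (u + v) <= vnorm u + vnorm v.
Proof.
rewrite -ler_sqr ?nnegrE ?addr_ge0 ?vnorm_ge0// vnorm_sqr dotDl !dotDr sqrrD.
rewrite !vnorm_sqr (dotC v u).
by have := dot_le u v; lra.
Qed.

Lemma vnorm_le n (v : 'cV[R]_n) (c : R) :
  0 <= c -> (forall x, dot v x <= c * vnorm x) -> vnorm v <= c.
Proof.
move=> c0 /(_ v); rewrite -vnorm_sqr expr2.
have := vnorm_ge0 v; rewrite le_eqVlt => /predU1P[<-//|v0].
by rewrite ler_pM2r.
Qed.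

Lemma coord_le_vnorm n (v : 'cV[R]_n) k : `|v k 0| <= vnorm v.
Proof.
rewrite -ler_sqr ?nnegrE ?vnorm_ge0// real_normK ?num_real// vnorm_sqr.
rewrite /dot (bigD1 k)//= -expr2 lerDl; apply: sumr_ge0 => i _.
by rewrite -expr2 sqr_ge0.
Qed.

Definition frob m n (A : 'M[R]_(m, n)) : R :=
  Num.sqrt (\sum_k \sum_l A k l ^+ 2).

Lemma vnorm_mulmx_frob m n (A : 'M[R]_(m, n)) v :
  vnorm (A *m v) <= frob A * vnorm v.
Proof.
have F0 : 0 <= \sum_k \sum_l A k l ^+ 2.
  by apply: sumr_ge0 => k _; apply: sumr_ge0 => l _; rewrite sqr_ge0.
rewrite -ler_sqr ?nnegrE ?mulr_ge0 ?vnorm_ge0 ?sqrtr_ge0//.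
rewrite exprMn [frob A ^+ 2]sqr_sqrtr// !vnorm_sqr mulr_suml; apply: ler_sum => k _.
rewrite -expr2 mxE.
have := @weighted_CauchySchwarz _ (fun=> 1) (fun l => A k l) (fun l => v l 0) (fun=> ler01).
by congr (_ ^+ 2 <= _ * _); apply: eq_bigr => l _; rewrite mul1r// expr2.
Qed.

(** [sup] has its usual meaning only on a nonempty bounded set; the crude Frobenius bound supplies
    boundedness. *)
Lemma opnorm_has_sup m n (A : 'M[R]_(m, n)) :
  has_sup [set vnorm (A *m v) | v in [set v : 'cV[R]_n | vnorm v <= 1]].
Proof.
split; first by exists (vnorm (A *m 0)), 0 => //=; rewrite vnorm0 ler01.
exists (frob A) => _ [v /= v1 <-]; rewrite (le_trans (vnorm_mulmx_frob _ _))//.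
by rewrite ler_piMr// sqrtr_ge0.
Qed.

Lemma opnorm_ge0 m n (A : 'M[R]_(m, n)) : 0 <= opnorm A.
Proof.
apply: (@le_trans _ _ (vnorm (A *m 0))); first exact: vnorm_ge0.
apply: ub_le_sup; first by have [] := opnorm_has_sup A.
by exists 0 => //=; rewrite vnorm0 ler01.
Qed.

Lemma vnorm_mulmx m n (A : 'M[R]_(m, n)) v :
  vnorm (A *m v) <= opnorm A * vnorm v.
Proof.
have := vnorm_ge0 v; rewrite le_eqVlt => /predU1P[v0|v0].
  by rewrite -v0 mulr0 (vnorm_eq0 (esym v0)) mulmx0 vnorm0.
rewrite -ler_pdivrMr// -[X in _ / X]gtr0_norm// mulrC -normfV -vnormZ scalemxAr.
apply: ub_le_sup; first by have [] := opnorm_has_sup A.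
by exists ((vnorm v)^-1 *: v) => //=; rewrite vnormZ normfV gtr0_norm// mulVf ?gt_eqF.
Qed.

Lemma opnorm_le m n (A : 'M[R]_(m, n)) c : 0 <= c ->
  (forall v, vnorm (A *m v) <= c * vnorm v) -> opnorm A <= c.
Proof.
move=> c0 h; apply: ge_sup; first by have [] := opnorm_has_sup A.
by move=> _ [v /= v1 <-]; rewrite (le_trans (h v))// ler_piMr.
Qed.

Lemma opnorm_leP m n (A : 'M[R]_(m, n)) c : 0 <= c ->
  (opnorm A <= c) <-> (forall v, vnorm (A *m v) <= c * vnorm v).
Proof.
move=> c0; split=> [Ac v|]; last exact: opnorm_le.
by rewrite (le_trans (vnorm_mulmx A v))// ler_wpM2r ?vnorm_ge0.
Qed.

Lemma dot_mulmx_le m n (A : 'M[R]_(m, n)) u v :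
  dot u (A *m v) <= opnorm A * (vnorm u * vnorm v).
Proof.
rewrite (le_trans (dot_le _ _))// mulrCA ler_wpM2l ?vnorm_ge0//.
exact: vnorm_mulmx.
Qed.

Lemma opnorm_le_bilinear m n (A : 'M[R]_(m, n)) c : 0 <= c ->
  (forall u v, dot u (A *m v) <= c * (vnorm u * vnorm v)) -> opnorm A <= c.
Proof.
move=> c0 h; apply: opnorm_le => // v; apply: vnorm_le => [|x].
  by rewrite mulr_ge0// vnorm_ge0.
by rewrite dotC (le_trans (h _ _))// mulrAC mulrA.
Qed.

Lemma opnorm_le_unit m n (A : 'M[R]_(m, n)) c : 0 <= c ->
  (forall u v, vnorm u <= 1 -> vnorm v <= 1 -> dot u (A *m v) <= c) ->
  opnorm A <= c.
Proof.
move=> c0 h; apply: opnorm_le_bilinear => // u v.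
have [u0|u0] := eqVneq (vnorm u) 0.
  by rewrite u0 mul0r mulr0 (vnorm_eq0 u0) dot0l.
have [v0|v0] := eqVneq (vnorm v) 0.
  by rewrite v0 !mulr0 (vnorm_eq0 v0) mulmx0 dotC dot0l.
have u0' : 0 < vnorm u by rewrite lt_def u0 vnorm_ge0.
have v0' : 0 < vnorm v by rewrite lt_def v0 vnorm_ge0.
have /= := h ((vnorm u)^-1 *: u) ((vnorm v)^-1 *: v).
rewrite !vnormZ !normfV !gtr0_norm// !mulVf// lexx => /(_ isT isT).
by rewrite -scalemxAr dotZl dotZr mulrA -invfM mulrC ler_pdivrMr ?mulr_gt0.
Qed.

Lemma opnorm_trmx m n (A : 'M[R]_(m, n)) : opnorm A^T = opnorm A.
Proof.
have tr_le p q (B : 'M[R]_(p, q)) : opnorm B^T <= opnorm B.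
  apply: opnorm_le_bilinear => [|u v]; first exact: opnorm_ge0.
  by rewrite dotC -dot_mulmx (le_trans (dot_mulmx_le _ _ _))// (mulrC (vnorm v)).
by apply/eqP; rewrite eq_le tr_le -{1}[A]trmxK tr_le.
Qed.

Lemma opnorm_eq0 m n (A : 'M[R]_(m, n)) : opnorm A = 0 -> A = 0.
Proof.
move=> A0; apply/matrixP => i j; rewrite mxE.
have : `|dot (delta_mx i 0) (A *m delta_mx j 0)| <= 0.
  rewrite (le_trans (normr_dot_le _ _))// -(mulr0 (vnorm (delta_mx i 0 : 'cV[R]_m))).
  by rewrite ler_wpM2l ?vnorm_ge0// (le_trans (vnorm_mulmx _ _))// A0 mul0r.
rewrite normr_le0 dotC dot_deltar => /eqP; rewrite mxE (bigD1 j)//= mxE !eqxx mulr1.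
by rewrite big1 ?addr0// => k kj; rewrite mxE (negbTE kj) mulr0.
Qed.

(** Replacing [u] costs [1 / 4 * opnorm A]; replacing [v] then costs [5 / 4 * 4^-1] times it, since
    [u'] may be as long as [5 / 4]. The total [9 / 16 * opnorm A] is absorbed on the left. This is
    how barycentres displaced by truncation still control the norm. *)
Lemma opnorm_le_approx m n (A : 'M[R]_(m, n)) c : 0 <= c ->
  (forall u v, vnorm u <= 1 -> vnorm v <= 1 ->
    exists u' v', [/\ vnorm (u - u') <= 4^-1, vnorm (v - v') <= 4^-1 &
      dot u' (A *m v') <= c]) ->
  opnorm A <= 16 / 7 * c.
Proof.
move=> c0 h.
suff : opnorm A <= c + 9 / 16 * opnorm A by lra.
have A0 := opnorm_ge0 A.
apply: opnorm_le_unit => [|u v u1 v1]; first by rewrite addr_ge0// mulr_ge0.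
have [u' [v' [uu' vv' cc]]] := h _ _ u1 v1.
have -> : dot u (A *m v) = dot u' (A *m v') + dot (u - u') (A *m v)
    + dot u' (A *m (v - v')).
  by rewrite dotBl mulmxBr dotBr; ring.
have u'1 : vnorm u' <= 5 / 4.
  have -> : u' = u + - (u - u') by rewrite opprB addrC subrK.
  rewrite (le_trans (vnormD _ _))// -scaleN1r vnormZ normrN1 mul1r; lra.
have h1 : dot (u - u') (A *m v) <= 1 / 4 * opnorm A.
  rewrite (le_trans (dot_mulmx_le _ _ _))// mulrC ler_wpM2r//.
  rewrite -[1 / 4]mulr1; apply: ler_pM; rewrite ?vnorm_ge0//; lra.
have h2 : dot u' (A *m (v - v')) <= 5 / 16 * opnorm A.
  rewrite (le_trans (dot_mulmx_le _ _ _))// mulrC ler_wpM2r//.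
  have -> : 5 / 16 = 5 / 4 * (4^-1) :> R by field.
  by apply: ler_pM; rewrite ?vnorm_ge0.
lra.
Qed.

End linear_algebra.

(** * Finite smoothing laws *)

Section product_tilt.
Context {R : realType} (A : finType) (m : A -> R).
Hypothesis m1 : forall a, `|m a| <= 1.

Definition sgn (b : bool) : R := if b then 1 else -1.

(** Probability of the pattern [s] when the signs are independent and the sign at [a] has mean
    [m a]. *)
Definition tilt (s : {ffun A -> bool}) : R := \prod_a ((1 + sgn (s a) * m a) / 2).

Lemma tilt_ge0 s : 0 <= tilt s.
Proof.
apply: prodr_ge0 => a _; have := m1 a; rewrite ler_norml /sgn => /andP[? ?].
by case: (s a); rewrite divr_ge0//; lra.
Qed.

(** Independence of the signs: a product of functions of single signs has factorised mean. Total
    mass and the first two moments follow by taking [g] equal to 1 off at most two indices. *)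
Lemma sum_tilt_prod (g : A -> bool -> R) :
  \sum_s tilt s * \prod_a g a (s a) =
  \prod_a (((1 + m a) * g a true + (1 - m a) * g a false) / 2).
Proof.
transitivity (\sum_(s : {ffun A -> bool}) \prod_a ((1 + sgn (s a) * m a) / 2 * g a (s a))).
  by apply: eq_bigr => s _; rewrite /tilt -big_split.
rewrite -(bigA_distr_bigA (fun a b => (1 + sgn b * m a) / 2 * g a b)).
apply: eq_bigr => a _; rewrite big_bool/= /sgn; ring.
Qed.

Lemma sum_tilt : \sum_s tilt s = 1.
Proof.
have := sum_tilt_prod (fun _ _ => 1).
rewrite [RHS]big1 => [<-|a _]; last by field.
by apply: eq_bigr => s _; rewrite big1 ?mulr1.
Qed.

Lemma sum_tilt_sgn a : \sum_s tilt s * sgn (s a) = m a.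
Proof.
have := sum_tilt_prod (fun c b => if c == a then sgn b else 1).
rewrite [RHS](bigD1 a)//= eqxx [X in _ = _ * X]big1 => [|c /negbTE ->]; last by field.
have -> : ((1 + m a) * sgn true + (1 - m a) * sgn false) / 2 * 1 = m a.
  by rewrite /sgn; field.
move=> <-; apply: eq_bigr => s _; rewrite (bigD1 a)//= eqxx big1 ?mulr1//.
by move=> c /negbTE ->.
Qed.

Lemma sum_tilt_sgn2 a b : \sum_s tilt s * (sgn (s a) * sgn (s b)) =
  m a * m b + (a == b)%:R * (1 - m a ^+ 2).
Proof.
have [<-|ab] := eqVneq a b.
  rewrite mul1r -expr2 addrC subrK -[RHS]sum_tilt; apply: eq_bigr => s _.
  by rewrite /sgn; case: (s a); rewrite ?mulrNN !mulr1.
have := sum_tilt_prod (fun c d => if (c == a) || (c == b) then sgn d else 1).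
rewrite [RHS](bigD1 a)//= eqxx/= (bigD1 b)/=; last by rewrite eq_sym.
rewrite eqxx orbT [X in _ = _ * (_ * X)]big1 => [|c /andP[/negbTE -> /negbTE ->]/=]; last by field.
have E x : ((1 + x) * sgn true + (1 - x) * sgn false) / 2 = x :> R.
  by rewrite /sgn; field.
rewrite !E mulr1 mul0r addr0 => <-; apply: eq_bigr => s _.
rewrite (bigD1 a)//= eqxx/= (bigD1 b)/=; last by rewrite eq_sym.
rewrite eqxx orbT big1 ?mulr1// => c /andP[/negbTE -> /negbTE ->]//.
Qed.

(* From [1 + x <= exp x]: the logarithm of the likelihood ratio against the
   uniform law is at most linear in the signs. *)
Lemma tilt_expR_le s :
  tilt s * expR (- \sum_a sgn (s a) * m a) <= 2^-1 ^+ #|A|.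
Proof.
rewrite /tilt -sumrN expR_sum -big_split/= -prodr_const; apply: ler_prod => a _.
have h : 0 <= 1 + sgn (s a) * m a.
  have := m1 a; rewrite ler_norml /sgn => /andP[? ?]; case: (s a); lra.
rewrite !mulr_ge0 ?expR_ge0//= mulrAC ler_piMl//.
by rewrite expRN ler_pdivrMr ?expR_gt0// mul1r expR_ge1Dx.
Qed.

(** The linear exponent dominates the log-likelihood ratio against the uniform law, so its mean
    bounds the relative entropy. *)
Lemma sum_tilt_linear : \sum_s tilt s * (\sum_a sgn (s a) * m a) = \sum_a m a ^+ 2.
Proof.
under eq_bigr do rewrite mulr_sumr.
rewrite exchange_big/=; apply: eq_bigr => a _.
by under eq_bigr do rewrite mulrA; rewrite -mulr_suml sum_tilt_sgn.
Qed.

Section vector_sum.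
Context (n : nat) (y : A -> 'cV[R]_n).

Definition sign_sum (s : {ffun A -> bool}) : 'cV[R]_n := \sum_a sgn (s a) *: y a.

Lemma sum_tilt_dot x :
  \sum_s tilt s * dot (sign_sum s) x = dot (\sum_a m a *: y a) x.
Proof.
rewrite dot_suml; under eq_bigr do rewrite dot_suml mulr_sumr.
rewrite exchange_big/=; apply: eq_bigr => a _.
under eq_bigr do rewrite dotZl mulrA.
by rewrite -mulr_suml sum_tilt_sgn dotZl.
Qed.

(** The signs are uncorrelated with variances [1 - m a ^+ 2 <= 1], so beyond the value at the
    barycentre only the diagonal terms contribute. *)
Lemma sum_tilt_quadratic (Q : 'M[R]_n) :
  (forall a, 0 <= dot (y a) (Q *m y a)) ->
  \sum_s tilt s * dot (sign_sum s) (Q *m sign_sum s) <=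
  dot (\sum_a m a *: y a) (Q *m (\sum_a m a *: y a)) +
  \sum_a dot (y a) (Q *m y a).
Proof.
move=> Q0.
have -> : \sum_s tilt s * dot (sign_sum s) (Q *m sign_sum s) =
   \sum_a \sum_b (m a * m b + (a == b)%:R * (1 - m a ^+ 2)) * dot (y a) (Q *m y b).
  transitivity (\sum_s \sum_a \sum_b
     (tilt s * (sgn (s a) * sgn (s b))) * dot (y a) (Q *m y b)).
    apply: eq_bigr => s _; rewrite dot_suml mulr_sumr; apply: eq_bigr => a _.
    rewrite mulmx_sumr dot_sumr mulr_sumr; apply: eq_bigr => b _.
    by rewrite -scalemxAr dotZl dotZr; ring.
  rewrite exchange_big/=; apply: eq_bigr => a _.
  rewrite exchange_big/=; apply: eq_bigr => b _.
  by rewrite -mulr_suml sum_tilt_sgn2.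
rewrite dot_suml -big_split/=; apply: ler_sum => a _.
rewrite mulmx_sumr dot_sumr.
under eq_bigr do rewrite mulrDl.
rewrite big_split/=; apply: lerD.
  by apply: ler_sum => b _; rewrite -scalemxAr dotZl dotZr mulrA.
rewrite (bigD1 a)//= eqxx big1 ?addr0.
  by rewrite mul1r ler_piMl// gerBl sqr_ge0.
by move=> b /negbTE; rewrite eq_sym => ->; rewrite !mul0r.
Qed.

End vector_sum.
End product_tilt.

Section smoothing.
Context {R : realType}.

(* A discrete substitute for smoothing by a Gaussian of covariance [1/beta]:
   shifting the centre from [0] to [v] costs relative entropy at most [beta]. *)
Lemma smoothing d (beta : R) : 1 <= beta ->
  exists (I : finType) (theta : I -> 'cV[R]_d) (mu : I -> R),
  [/\ forall i, 0 <= mu i, \sum_i mu i = 1 &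
   forall v, vnorm v <= 1 -> exists rho L : I -> R,
    [/\ (forall i, 0 <= rho i) /\ \sum_i rho i = 1,
      forall x, \sum_i rho i * dot (theta i) x = dot v x,
      forall Q : 'M[R]_d, (forall k, 0 <= Q k k) ->
        \sum_i rho i * dot (theta i) (Q *m theta i) <= dot v (Q *m v) + \tr Q / beta,
      forall i, rho i * expR (- L i) <= mu i &
      \sum_i rho i * L i <= beta]].
Proof.
move=> beta1; have beta0 : 0 < beta by rewrite (lt_le_trans ltr01).
(* Each coordinate is shared among [M] signs; [beta <= M%:R] keeps the required means
   [beta * c * v k 0] in [[-1, 1]]. *)
have [M bM] : exists M : nat, beta <= M%:R.
  by exists (Num.bound beta); rewrite ltW// archi_boundP// ltW.
have M0 : 0 < M%:R :> R by rewrite (lt_le_trans beta0).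
(* The scale is fixed by [beta * c ^+ 2 * M%:R = 1]. This one relation gives the barycentre [v], the
   variance bound [1 / beta] in each coordinate and the entropy bound [beta * vnorm v ^+ 2]. *)
pose c : R := (Num.sqrt (M%:R * beta))^-1.
have c2 : c ^+ 2 = (M%:R * beta)^-1 by rewrite exprVn sqr_sqrtr// mulr_ge0// ltW.
pose A : finType := ('I_d * 'I_M)%type.
pose y (a : A) : 'cV[R]_d := c *: delta_mx a.1 0.
have y_quad (Q : 'M[R]_d) a : dot (y a) (Q *m y a) = c ^+ 2 * Q a.1 a.1.
  rewrite -scalemxAr dotZl dotZr mulrA -expr2 dotC dot_deltar mxE (bigD1 a.1)//=.
  rewrite mxE !eqxx mulr1 big1 ?addr0// => k kj.
  by rewrite mxE (negbTE kj) mulr0.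
exists {ffun A -> bool}, (sign_sum y), (fun=> 2^-1 ^+ #|A|); split.
- by move=> i; rewrite exprn_ge0// invr_ge0.
- rewrite sumr_const card_ffun card_bool -[X in X *+ _]mulr1 -mulrnAr.
  by rewrite natrX exprVn mulVf// expf_neq0.
move=> v v1; pose m (a : A) := beta * c * v a.1 0.
have v2 k : v k 0 ^+ 2 <= 1.
  by rewrite -(real_normK (num_real _)) expr_le1// (le_trans (coord_le_vnorm v k)).
have m1 a : `|m a| <= 1.
  rewrite -(@expr_le1 _ 2)// real_normK ?num_real// /m !exprMn c2.
  have -> : beta ^+ 2 * (M%:R * beta)^-1 = beta / M%:R.
    by field; rewrite !gt_eqF.
  have bM1 : beta / M%:R <= 1 by rewrite ler_pdivrMr// mul1r.
  by rewrite mulr_ile1// ?sqr_ge0// divr_ge0// ltW.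
have my : \sum_a m a *: y a = v.
  rewrite -(pair_big xpredT xpredT (fun k l => m (k, l) *: y (k, l)))/=.
  apply/matrixP => k j; rewrite ord1 summxE (bigD1 k)//= [X in _ + X]big1 => [|i ik].
    rewrite addr0 summxE; under eq_bigr do rewrite /m /y !mxE !eqxx/= mulr1.
    rewrite sumr_const card_ord -mulr_natr.
    have -> : beta * c * v k 0 * c * M%:R = beta * M%:R * c ^+ 2 * v k 0 by ring.
    by rewrite c2 mulrC; field; rewrite !gt_eqF.
  rewrite summxE big1// => l _.
  by rewrite !mxE eq_sym (negbTE ik) !mulr0.
exists (tilt m), (fun s : {ffun A -> bool} => \sum_a sgn (s a) * m a); split.
- by split; [exact: tilt_ge0|exact: sum_tilt].
- by move=> x; rewrite sum_tilt_dot my.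
- move=> Q Q0.
  have := @sum_tilt_quadratic _ _ m _ y Q; rewrite my.
  have -> : \sum_a dot (y a) (Q *m y a) = \tr Q / beta.
    under eq_bigr do rewrite y_quad.
    rewrite -mulr_sumr -(pair_big xpredT xpredT (fun k (l : 'I_M) => Q k k))/=.
    under eq_bigr do rewrite sumr_const card_ord -mulr_natr.
    by rewrite -mulr_suml c2 /mxtrace; field; rewrite !gt_eqF.
  by apply => // a; rewrite y_quad mulr_ge0// sqr_ge0.
- by move=> s; exact: tilt_expR_le.
rewrite sum_tilt_linear -(pair_big xpredT xpredT (fun k l => m (k, l) ^+ 2))/=.
under eq_bigr do rewrite /m/= sumr_const card_ord -mulr_natr exprMn.
rewrite -mulr_suml -mulr_sumr exprMn c2.
have -> : beta ^+ 2 * (M%:R * beta)^-1 * (\sum_i v i 0 ^+ 2) * M%:R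
    = beta * \sum_i v i 0 ^+ 2 by field; rewrite !gt_eqF.
rewrite ler_piMr ?(ltW beta0)//.
have -> : \sum_i v i 0 ^+ 2 = vnorm v ^+ 2.
  by rewrite vnorm_sqr; apply: eq_bigr => k _; rewrite expr2.
by rewrite expr_le1 ?vnorm_ge0.
Qed.

(** The exponential lies above its tangent at the mean [e]; averaging the tangent returns
    [expR e]. *)
Lemma finite_Jensen_expR (I : finType) (rho x : I -> R) :
  (forall i, 0 <= rho i) -> \sum_i rho i = 1 ->
  expR (\sum_i rho i * x i) <= \sum_i rho i * expR (x i).
Proof.
move=> r0 r1; set e := \sum_i rho i * x i.
have -> : expR e = \sum_i rho i * (expR e * (1 + (x i - e))).
  under eq_bigr do rewrite mulrCA.
  rewrite -mulr_sumr; under eq_bigr do rewrite mulrDr mulr1 mulrBr.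
  by rewrite big_split/= sumrB r1 -mulr_suml r1 mul1r subrr addr0 mulr1.
apply: ler_sum => i _; rewrite ler_wpM2l//.
have -> : expR (x i) = expR e * expR (x i - e) by rewrite -expRD addrCA subrr addr0.
by rewrite ler_wpM2l ?expR_ge0// expR_ge1Dx.
Qed.

(** Jensen under the product of [rho] and [rho'], after which [rho i * expR (- L i) <= mu i] trades
    the chosen law for the prior. The right side does not depend on [rho] and [rho'], so one
    evaluation of it serves every direction. Having [L] as an upper bound for the log-likelihood
    ratio avoids logarithms of vanishing weights. *)
Lemma Gibbs_product (I J : finType) (mu rho L : I -> R) (mu' rho' L' : J -> R)
    (F : I -> J -> R) :
  (forall i, 0 <= rho i) -> \sum_i rho i = 1 ->
  (forall j, 0 <= rho' j) -> \sum_j rho' j = 1 ->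
  (forall i, rho i * expR (- L i) <= mu i) ->
  (forall j, rho' j * expR (- L' j) <= mu' j) ->
  expR (\sum_i \sum_j rho i * rho' j * F i j
        - \sum_i rho i * L i - \sum_j rho' j * L' j) <=
  \sum_i \sum_j mu i * mu' j * expR (F i j).
Proof.
move=> r0 r1 r0' r1' rm rm'.
have -> : \sum_i \sum_j rho i * rho' j * F i j - \sum_i rho i * L i -
    \sum_j rho' j * L' j =
  \sum_(p : I * J) (rho p.1 * rho' p.2) * (F p.1 p.2 - L p.1 - L' p.2).
  rewrite -(pair_big xpredT xpredT (fun i j => (rho i * rho' j) * (F i j - L i - L' j)))/=.
  under [RHS]eq_bigr => i _.
    under eq_bigr do rewrite !mulrBr.
    rewrite !sumrB.
    have -> : \sum_j rho i * rho' j * L i = rho i * L i.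
      under eq_bigr do rewrite mulrAC.
      by rewrite -mulr_sumr r1' mulr1.
    have -> : \sum_j rho i * rho' j * L' j = rho i * \sum_j rho' j * L' j.
      by rewrite mulr_sumr; apply: eq_bigr => j _; rewrite mulrA.
    over.
  by rewrite !sumrB -[X in _ = _ - X]mulr_suml r1 mul1r.
apply: (le_trans (finite_Jensen_expR _ _ _)) => [p||].
- by rewrite mulr_ge0.
- rewrite -(pair_big xpredT xpredT (fun i j => rho i * rho' j))/=.
  by under eq_bigr do rewrite -mulr_sumr r1' mulr1.
rewrite -(pair_big xpredT xpredT (fun i j => (rho i * rho' j) * expR (F i j - L i - L' j)))/=.
apply: ler_sum => i _; apply: ler_sum => j _.
have -> : rho i * rho' j * expR (F i j - L i - L' j) =
   (rho i * expR (- L i)) * (rho' j * expR (- L' j)) * expR (F i j).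
  by rewrite !expRD; ring.
by rewrite ler_wpM2r ?expR_ge0// ler_pM// mulr_ge0// expR_ge0.
Qed.

End smoothing.

(** * Expectation and independence *)

Section expectation.
Context {R : realType} {d : measure_display} {T : measurableType d}.
Variable P : probability T R.
Implicit Types f g h : T -> R.

Definition L1 f : Prop := P.-integrable setT (fun w => (f w)%:E).

Lemma L1_measurable f : L1 f -> measurable_fun setT f.
Proof. by move=> /measurable_int/measurable_EFinP. Qed.

Lemma integral_Ex f : L1 f -> (\int[P]_w (f w)%:E = (Ex P f)%:E)%E.
Proof. by move=> lf; rewrite /Ex fineK// integrable_fin_num. Qed.

Lemma L1_cst (c : R) : L1 (fun=> c).
Proof. exact: finite_measure_integrable_cst. Qed.

Lemma L1D f g : L1 f -> L1 g -> L1 (fun w => f w + g w).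
Proof. exact: integrableD. Qed.

Lemma L1Z (c : R) f : L1 f -> L1 (fun w => c * f w).
Proof. exact: integrableZl. Qed.

Lemma L1N f : L1 f -> L1 (fun w => - f w).
Proof. exact: integrableN. Qed.

Lemma L1B f g : L1 f -> L1 g -> L1 (fun w => f w - g w).
Proof. by move=> lf lg; apply: L1D => //; exact: L1N. Qed.

Lemma eq_L1 f g : f =1 g -> L1 f -> L1 g.
Proof. by move=> /funext ->. Qed.

Lemma L1_sum (I : Type) (s : seq I) (Q : pred I) (F : I -> T -> R) :
  (forall i, Q i -> L1 (F i)) -> L1 (fun w => \sum_(i <- s | Q i) F i w).
Proof.
move=> lF; elim: s => [|i s IH].
  by apply: (eq_L1 (f := fun=> 0)) => [w|]; [rewrite big_nil|exact: L1_cst].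
have [Qi|Qi] := boolP (Q i).
  apply: (eq_L1 (f := fun w => F i w + \sum_(i <- s | Q i) F i w)) => [w|].
    by rewrite big_cons Qi.
  by apply: L1D => //; exact: lF.
by apply: eq_L1 IH => w; rewrite big_cons (negbTE Qi).
Qed.

Lemma L1_le f g : measurable_fun setT f -> L1 g ->
  (forall w, `|f w| <= g w) -> L1 f.
Proof.
move=> mf lg fg; apply: (le_integrable measurableT) lg; first exact/measurable_EFinP.
by move=> w _ /=; rewrite lee_fin (le_trans (fg w))// ler_norm.
Qed.

Lemma L1_norm f : L1 f -> L1 (fun w => `|f w|).
Proof. exact: integrable_abse. Qed.

Lemma L1_bounded f (c : R) : measurable_fun setT f -> (forall w, `|f w| <= c) -> L1 f.
Proof. by move=> mf fc; exact: (L1_le mf (L1_cst c)). Qed.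

Lemma Ex_cst (c : R) : Ex P (fun=> c) = c.
Proof. by rewrite /Ex integral_cst//= probability_setT mule1. Qed.

Lemma eq_Ex f g : f =1 g -> Ex P f = Ex P g.
Proof. by move=> /funext ->. Qed.

Lemma ExD f g : L1 f -> L1 g -> Ex P (fun w => f w + g w) = Ex P f + Ex P g.
Proof.
move=> lf lg; apply: EFin_inj; rewrite EFinD -!integral_Ex//; last exact: L1D.
by rewrite -integralD//; apply: eq_integral.
Qed.

Lemma ExZ (c : R) f : L1 f -> Ex P (fun w => c * f w) = c * Ex P f.
Proof.
move=> lf; apply: EFin_inj; rewrite EFinM -!integral_Ex//; last exact: L1Z.
by rewrite -integralZl//; apply: eq_integral.
Qed.

Lemma ExN f : L1 f -> Ex P (fun w => - f w) = - Ex P f.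
Proof.
move=> lf; rewrite -mulN1r -ExZ//; apply: eq_Ex => w; by rewrite mulN1r.
Qed.

Lemma ExB f g : L1 f -> L1 g -> Ex P (fun w => f w - g w) = Ex P f - Ex P g.
Proof. by move=> lf lg; rewrite ExD ?ExN//; exact: L1N. Qed.

Lemma Ex_sum (I : Type) (s : seq I) (Q : pred I) (F : I -> T -> R) :
  (forall i, Q i -> L1 (F i)) ->
  Ex P (fun w => \sum_(i <- s | Q i) F i w) = \sum_(i <- s | Q i) Ex P (F i).
Proof.
move=> lF; elim: s => [|i s IH].
  by rewrite big_nil -[RHS](Ex_cst 0); apply: eq_Ex => w; rewrite big_nil.
rewrite big_cons -IH; case: ifPn => Qi.
  rewrite -ExD; [|exact: lF|exact: L1_sum].
  by apply: eq_Ex => w; rewrite big_cons Qi.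
by apply: eq_Ex => w; rewrite big_cons (negbTE Qi).
Qed.

Lemma Ex_le f g : L1 f -> L1 g -> (forall w, f w <= g w) -> Ex P f <= Ex P g.
Proof.
move=> lf lg fg; rewrite -lee_fin -!integral_Ex//; apply: le_integral => //.
by move=> w _; rewrite lee_fin.
Qed.

Lemma Ex_ge0 f : (forall w, 0 <= f w) -> 0 <= Ex P f.
Proof. by move=> f0; apply/fine_ge0/integral_ge0 => w _; rewrite lee_fin. Qed.

(** Passage from extended to real expectations: bounds on nonnegative functions are proved for the
    extended integral, and finiteness then yields integrability. *)
Lemma L1_ge0 f (c : R) : measurable_fun setT f -> (forall w, 0 <= f w) ->
  (\int[P]_w (f w)%:E <= c%:E)%E -> L1 f /\ Ex P f <= c.
Proof.
move=> mf f0 fc.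
have lf : L1 f.
  apply/integrableP; split; first exact/measurable_EFinP.
  apply: le_lt_trans (ltry c); apply: le_trans fc; rewrite le_eqVlt; apply/orP; left.
  by apply/eqP/eq_integral => w _ /=; rewrite ger0_norm.
by split => //; rewrite -lee_fin -integral_Ex.
Qed.

Lemma L1M f g : measurable_fun setT f -> measurable_fun setT g ->
  L1 (fun w => f w ^+ 2) -> L1 (fun w => g w ^+ 2) -> L1 (fun w => f w * g w).
Proof.
move=> mf mg lf lg.
apply: (L1_le _ (L1D lf lg)); first exact: measurable_funM.
move=> w; rewrite ler_norml.
have := sqr_ge0 (f w + g w); have := sqr_ge0 (f w - g w).
have := sqr_ge0 (f w); have := sqr_ge0 (g w); rewrite sqrrB sqrrD.
by move=> ? ? ? ?; apply/andP; split; lra.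
Qed.

Lemma L1_of_sqr f : measurable_fun setT f -> L1 (fun w => f w ^+ 2) -> L1 f.
Proof.
move=> mf lf; apply: (L1_le mf (L1D (L1_cst 1) lf)) => w.
rewrite ler_norml; have := sqr_ge0 (f w + 1); have := sqr_ge0 (f w - 1).
by rewrite sqrrB sqrrD => ? ?; apply/andP; split; nra.
Qed.

Lemma L1_sqrD f g : measurable_fun setT f -> measurable_fun setT g ->
  L1 (fun w => f w ^+ 2) -> L1 (fun w => g w ^+ 2) ->
  L1 (fun w => (f w + g w) ^+ 2).
Proof.
move=> mf mg lf lg; apply: (L1_le _ (L1Z 2 (L1D lf lg))).
  by apply: measurable_funX; exact: measurable_funD.
move=> w; rewrite ger0_norm ?sqr_ge0//.
by have := sqr_ge0 (f w - g w); rewrite sqrrB sqrrD; lra.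
Qed.

Lemma L1_sqrZ (c : R) f : L1 (fun w => f w ^+ 2) -> L1 (fun w => (c * f w) ^+ 2).
Proof. by move=> lf; apply: eq_L1 (L1Z (c ^+ 2) lf) => w; rewrite exprMn. Qed.

Lemma L1_sqr_sum (I : finType) (F : I -> T -> R) :
  (forall i, measurable_fun setT (F i)) -> (forall i, L1 (fun w => F i w ^+ 2)) ->
  L1 (fun w => (\sum_i F i w) ^+ 2).
Proof.
move=> mF lF; elim: (index_enum I) => [|i s IH].
  by apply: eq_L1 (L1_cst 0) => w; rewrite big_nil expr0n.
apply: (eq_L1 (f := fun w => (F i w + \sum_(j <- s) F j w) ^+ 2)).
  by move=> w; rewrite big_cons.
by apply: L1_sqrD => //; exact: measurable_sum.
Qed.

Lemma Ex_CauchySchwarz f g : measurable_fun setT f -> measurable_fun setT g ->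
  L1 (fun w => f w ^+ 2) -> L1 (fun w => g w ^+ 2) ->
  Ex P (fun w => f w * g w) ^+ 2 <=
  Ex P (fun w => f w ^+ 2) * Ex P (fun w => g w ^+ 2).
Proof.
move=> mf mg lf lg; apply: discriminant_le => [|t].
  by apply: Ex_ge0 => w; rewrite sqr_ge0.
have lfg := L1M mf mg lf lg.
rewrite -mulrnAr -mulr_natl mulrA -!ExZ// -ExB//; last exact: L1Z.
rewrite -ExD; [|by apply: L1B => //; exact: L1Z|exact: L1Z].
apply: Ex_ge0 => w.
have -> : f w ^+ 2 - t * 2 * (f w * g w) + t ^+ 2 * g w ^+ 2 = (f w - t * g w) ^+ 2.
  by ring.
exact: sqr_ge0.
Qed.

Lemma Markov_compl f (a e : R) : measurable_fun setT f -> (forall w, 0 <= f w) ->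
  0 < a -> (\int[P]_w (f w)%:E <= (a * e)%:E)%E ->
  ((1 - e)%:E <= P [set w | (f w < a)%R])%E.
Proof.
move=> mf f0 a0 fe.
have mS : measurable [set w | f w < a].
  rewrite (_ : [set w | f w < a] = setT `&` f @^-1` `]-oo, a[).
    exact: mf.
  by rewrite setTI; apply/seteqP; split => w /=; rewrite in_itv.
suff : (P (~` [set w | (f w < a)%R]) <= e%:E)%E.
  have -> : P [set w | (f w < a)%R] = (fine (P [set w | (f w < a)%R]))%:E.
    by rewrite fineK// fin_num_measure.
  rewrite probability_setC// -(fineK (fin_num_measure P _ mS)).
  by rewrite -[X in (X - _)%E]/(1%:E)%E -EFinB !lee_fin/= lerBlDr -lerBlDl.
have [lf _] := L1_ge0 mf f0 fe.
have mC := measurableC mS.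
rewrite -(fineK (fin_num_measure P _ mC)) lee_fin -(ler_pM2l a0) -lee_fin.
apply: le_trans fe.
rewrite EFinM fineK ?fin_num_measure//.
rewrite -(setIT (~` _)) -integral_indic// -ge0_integralZl//; first last.
- by rewrite lee_fin ltW.
- by apply/measurable_EFinP; exact: measurable_indic.
apply: ge0_le_integral => //.
- by move=> w _; rewrite mule_ge0 ?lee_fin ?indicE// ltW.
- by apply: measurable_funeM; apply/measurable_EFinP; exact: measurable_indic.
- exact/measurable_EFinP.
move=> w _; rewrite -EFinM lee_fin indicE; case: (boolP (w \in _)).
  by rewrite inE mulr1 /= => /negP; rewrite -leNgt.
by rewrite mulr0.
Qed.

End expectation.

(** * Independence and equality of laws through generating pi-systems *)

Section independence.
Context {R : realType} {d : measure_display} {T : measurableType d}.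
Variable P : probability T R.

(** Since the generators contain the whole space, cylinders over generating sets are themselves
    rectangles; both projections are therefore measurable for the sigma-algebra generated by
    rectangles, which is the nontrivial inclusion. *)
Lemma measurable_prod_generated (T1 T2 : pointedType) (C1 : set (set T1))
    (C2 : set (set T2)) : C1 setT -> C2 setT ->
  @measurable _ (g_sigma_algebraType C1 * g_sigma_algebraType C2)%type =
  <<s [set A `*` B | A in C1 & B in C2] >>.
Proof.
move=> C1T C2T; set G := [set A `*` B | A in C1 & B in C2].
rewrite measurable_prod_measurableType eqEsubset; split; last first.
  apply: smallest_sub; first exact: smallest_sigma_algebra.
  move=> _ [A C1A [B C2B <-]]; apply: sub_sigma_algebra.
  by exists A; [exact: sub_sigma_algebra|exists B => //; exact: sub_sigma_algebra].
apply: smallest_sub; first exact: smallest_sigma_algebra.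
move=> _ [A mA [B mB <-]].
pose GT : measurableType _ := @g_sigma_algebraType (T1 * T2)%type G.
have mfst : measurable_fun [set: GT] (fst : GT -> g_sigma_algebraType C1).
  apply: (@measurability _ _ GT (g_sigma_algebraType C1) setT fst C1) => //.
  move=> _ [A' C1A' <-]; apply: sub_sigma_algebra; exists A' => //; exists setT => //.
  change (A' `*` [set: T2] = [set: T1 * T2] `&` fst @^-1` A').
  by rewrite setTI; apply/seteqP; split => [z []|z].
have msnd : measurable_fun [set: GT] (snd : GT -> g_sigma_algebraType C2).
  apply: (@measurability _ _ GT (g_sigma_algebraType C2) setT snd C2) => //.
  move=> _ [B' C2B' <-]; apply: sub_sigma_algebra; exists setT => //; exists B' => //.
have := @measurableI _ GT _ _ (mfst measurableT A mA) (msnd measurableT B mB).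
by rewrite !setTI.
Qed.

Section independent_pair.
Context (T1 T2 : pointedType) (C1 : set (set T1)) (C2 : set (set T2)).
Hypotheses (C1T : C1 setT) (C2T : C2 setT).
Hypotheses (C1I : setI_closed C1) (C2I : setI_closed C2).
Context (U : T -> g_sigma_algebraType C1) (V : T -> g_sigma_algebraType C2).
Hypotheses (mU : measurable_fun setT U) (mV : measurable_fun setT V).
Hypothesis indepUV : forall A B, C1 A -> C2 B ->
  (P (U @^-1` A `&` V @^-1` B) = P (U @^-1` A) * P (V @^-1` B))%E.

Let U' : {mfun T >-> g_sigma_algebraType C1} :=
  HB.pack U (isMeasurableFun.Build _ _ _ _ U mU).
Let V' : {mfun T >-> g_sigma_algebraType C2} :=
  HB.pack V (isMeasurableFun.Build _ _ _ _ V mV).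
Let W' : {mfun T >-> (g_sigma_algebraType C1 * g_sigma_algebraType C2)%type} :=
  HB.pack (fun w => (U w, V w))
    (isMeasurableFun.Build _ _ _ _ _ (measurable_fun_pair mU mV)).

(** The joint law and the product of the marginals agree on rectangles of generators, a pi-system
    that generates the product sigma-algebra, hence everywhere. *)
Lemma indep_joint_law A : measurable A ->
  distribution P W' A = (distribution P U' \x distribution P V')%E A.
Proof.
move: A.
have := @measure_unique _ R (g_sigma_algebraType C1 * g_sigma_algebraType C2)%type
   [set A `*` B | A in C1 & B in C2] (fun=> setT) _ _ _ _
   (distribution P W') (distribution P U' \x distribution P V')%E.
apply => //.
- exact: measurable_prod_generated.
- move=> _ _ [A C1A [B C2B <-]] [A' C1A' [B' C2B' <-]].
  rewrite -setXI; exists (A `&` A'); first exact: C1I.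
  by exists (B `&` B') => //; exact: C2I.
- by move=> _; exists setT => //; exists setT => //; rewrite setXTT.
- by apply: bigcup_const; exists 0%N.
- move=> _ [A C1A [B C2B <-]].
  have mA : measurable (A : set (g_sigma_algebraType C1)) by exact: sub_sigma_algebra.
  have mB : measurable (B : set (g_sigma_algebraType C2)) by exact: sub_sigma_algebra.
  apply: eq_trans (esym (product_measure1E (distribution P U') (distribution P V') mA mB)).
  exact: indepUV.
- by move=> _; rewrite (le_lt_trans (probability_le1 _ measurableT))// ltry.
Qed.

(** Tonelli's theorem for the product law; nonnegativity makes it valid even for infinite
    integrals. *)
Lemma indep_integralM (f : g_sigma_algebraType C1 -> R) (g : g_sigma_algebraType C2 -> R) :
  measurable_fun setT f -> measurable_fun setT g ->
  (forall x, 0 <= f x) -> (forall x, 0 <= g x) ->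
  (\int[P]_w (f (U w) * g (V w))%:E =
   (\int[P]_w (f (U w))%:E) * \int[P]_w (g (V w))%:E)%E.
Proof.
move=> mf mg f0 g0.
pose h (z : g_sigma_algebraType C1 * g_sigma_algebraType C2) := (f z.1 * g z.2)%:E.
have mh : measurable_fun setT h.
  by apply/measurable_EFinP; apply: measurable_funM; apply: measurableT_comp.
have h0 z : (0 <= h z)%E by rewrite lee_fin mulr_ge0.
transitivity (\int[distribution P W']_z h z)%E.
  by rewrite ge0_integral_distribution.
transitivity (\int[distribution P U' \x distribution P V']_z h z)%E.
  by apply: eq_measure_integral => A mA _; exact: indep_joint_law.
rewrite fubini_tonelli1//.
have -> : (\int[P]_w (g (V w))%:E = \int[distribution P V']_y (g y)%:E)%E.
  by rewrite ge0_integral_distribution//; exact/measurable_EFinP.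
have -> : (\int[P]_w (f (U w))%:E = \int[distribution P U']_y (f y)%:E)%E.
  by rewrite ge0_integral_distribution//; exact/measurable_EFinP.
rewrite -ge0_integralZr//; first last.
- by apply: integral_ge0 => y _; rewrite lee_fin.
- by move=> y _; rewrite lee_fin.
- exact/measurable_EFinP.
apply: eq_integral => x _; rewrite /fubini_F /h/=.
under eq_integral do rewrite EFinM.
rewrite ge0_integralZl//; last by rewrite lee_fin.
  exact/measurable_EFinP.
by move=> y _; rewrite lee_fin.
Qed.

Lemma indep_Ex_ge0M (f : g_sigma_algebraType C1 -> R) (g : g_sigma_algebraType C2 -> R) :
  measurable_fun setT f -> measurable_fun setT g ->
  (forall x, 0 <= f x) -> (forall x, 0 <= g x) ->
  L1 P (f \o U) -> L1 P (g \o V) ->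
  L1 P (fun w => f (U w) * g (V w)) /\
  Ex P (fun w => f (U w) * g (V w)) = Ex P (f \o U) * Ex P (g \o V).
Proof.
move=> mf mg f0 g0 lf lg.
have E := indep_integralM mf mg f0 g0.
rewrite (integral_Ex lf) (integral_Ex lg) -EFinM in E.
have [l _] : L1 P (fun w => f (U w) * g (V w)) /\
    Ex P (fun w => f (U w) * g (V w)) <= Ex P (f \o U) * Ex P (g \o V).
  apply: L1_ge0 => [|w|]; last by rewrite E.
    apply: measurable_funM; [exact: (measurableT_comp mf mU)|exact: (measurableT_comp mg mV)].
  by rewrite mulr_ge0.
by split => //; apply: EFin_inj; rewrite -integral_Ex.
Qed.

Lemma indep_ExM (f : g_sigma_algebraType C1 -> R) (g : g_sigma_algebraType C2 -> R) :
  measurable_fun setT f -> measurable_fun setT g ->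
  L1 P (f \o U) -> L1 P (g \o V) ->
  L1 P (fun w => f (U w) * g (V w)) /\
  Ex P (fun w => f (U w) * g (V w)) = Ex P (f \o U) * Ex P (g \o V).
Proof.
move=> mf mg lf lg.
(* [(|h| + s * h) / 2] is the positive part of [h] for [s = 1] and the negative part for [s = -1];
   the product then splits into four nonnegative ones. *)
have mabs d' (T' : measurableType d') (h : T' -> R) (s : R) : measurable_fun setT h ->
    measurable_fun setT (fun x => (`|h x| + s * h x) / 2).
  move=> mh; apply: measurable_funM => //; apply: measurable_funD.
    exact: (measurableT_comp _ mh).
  exact: measurable_funM.
have abs0 (h : R) : (0 <= (`|h| + 1 * h) / 2) /\ (0 <= (`|h| + -1 * h) / 2).
  by have := ler_norm h; have := ler_norm (- h); rewrite normrN => ? ?; split; lra.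
have labs (h : T -> R) (s : R) : L1 P h -> L1 P (fun x => (`|h x| + s * h x) / 2).
  move=> lh; apply: (eq_L1 (f := fun x => 2^-1 * (`|h x| + s * h x))).
    by move=> w; rewrite mulrC.
  by apply: L1Z; apply: L1D; [exact: L1_norm|exact: L1Z].
have E2 (h : T -> R) : L1 P h -> Ex P h = Ex P (fun x => (`|h x| + 1 * h x) / 2) -
    Ex P (fun x => (`|h x| + -1 * h x) / 2).
  by move=> lh; rewrite -ExB; [apply: eq_Ex => w; field|exact: labs..].
pose F s x : R := (`|f x| + s * f x) / 2; pose G s x : R := (`|g x| + s * g x) / 2.
have FG s t : (s == 1) || (s == -1) -> (t == 1) || (t == -1) ->
  L1 P (fun w => F s (U w) * G t (V w)) /\
  Ex P (fun w => F s (U w) * G t (V w)) = Ex P (F s \o U) * Ex P (G t \o V).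
  move=> s1 t1; apply: indep_Ex_ge0M; [exact: mabs|exact: mabs| | | | ].
  - by move=> x; case/orP: s1 => /eqP ->; case: (abs0 (f x)).
  - by move=> x; case/orP: t1 => /eqP ->; case: (abs0 (g x)).
  - exact: (labs _ s lf).
  - exact: (labs _ t lg).
have h11 : ((1 : R) == 1) || ((1 : R) == -1) by rewrite eqxx.
have h1N : ((-1 : R) == 1) || ((-1 : R) == -1) by rewrite eqxx orbT.
have [l1 e1] := FG 1 1 h11 h11; have [l2 e2] := FG 1 (-1) h11 h1N.
have [l3 e3] := FG (-1) 1 h1N h11; have [l4 e4] := FG (-1) (-1) h1N h1N.
have FGE w : f (U w) * g (V w) =
    (F 1 (U w) * G 1 (V w) - F 1 (U w) * G (-1) (V w)) -
    (F (-1) (U w) * G 1 (V w) - F (-1) (U w) * G (-1) (V w)).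
  by rewrite /F /G; field.
split.
  by apply: (eq_L1 (fun w => esym (FGE w))); apply: L1B; exact: L1B.
rewrite (eq_Ex P FGE) !ExB//; [|exact: L1B..].
rewrite e1 e2 e3 e4 (E2 _ lf) (E2 _ lg) /F /G /comp; ring.
Qed.

End independent_pair.

Section independent_family.
Context (S : pointedType) (C : set (set S)) (N : nat).
Hypotheses (CT : C setT) (CI : setI_closed C).
Context (Phi : 'I_N -> T -> g_sigma_algebraType C).
Hypothesis mPhi : forall i, measurable_fun setT (Phi i).
Hypothesis indepPhi : forall A : 'I_N -> set S, (forall i, C (A i)) ->
  (P (\bigcap_(i in [set: 'I_N]) (Phi i @^-1` A i)) =
   \prod_(i < N) P (Phi i @^-1` A i))%E.

Lemma family_indep_pair i j : i != j -> forall A B, C A -> C B ->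
  (P (Phi i @^-1` A `&` Phi j @^-1` B) = P (Phi i @^-1` A) * P (Phi j @^-1` B))%E.
Proof.
move=> ij A B CA CB.
pose D k := if k == i then A else if k == j then B else setT.
have -> : Phi i @^-1` A `&` Phi j @^-1` B =
    \bigcap_(k in [set: 'I_N]) (Phi k @^-1` D k).
  apply/seteqP; split=> [w [wA wB] k _|w h].
    by rewrite /D /=; case: eqP => [->//|_]; case: eqP => [->|].
  split; first by have := h i I; rewrite /D eqxx.
  by have := h j I; rewrite /D eqxx eq_sym (negbTE ij).
rewrite indepPhi; last by move=> k; rewrite /D; do 2 case: ifP => //.
rewrite (bigD1 i)//= (bigD1 j)/=; last by rewrite eq_sym.
rewrite /D !eqxx eq_sym (negbTE ij) [X in (_ * (_ * X))%E]big1 ?mule1// => k /andP[ki kj].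
by rewrite (negbTE ki) (negbTE kj) preimage_setT probability_setT.
Qed.

Lemma family_ExM i j (f g : g_sigma_algebraType C -> R) : i != j ->
  measurable_fun setT f -> measurable_fun setT g ->
  L1 P (f \o Phi i) -> L1 P (g \o Phi j) ->
  L1 P (fun w => f (Phi i w) * g (Phi j w)) /\
  Ex P (fun w => f (Phi i w) * g (Phi j w)) = Ex P (f \o Phi i) * Ex P (g \o Phi j).
Proof.
move=> ij; apply: indep_ExM => //; exact: family_indep_pair.
Qed.

(** Events decided by the members of index below [n]. Filling the other slots with [setT] keeps them
    in the form covered by [indepPhi], and makes them a pi-system. *)
Let past (n : nat) : set (set T) :=
  [set E | exists A : 'I_N -> set S, [/\ forall i, C (A i),
     forall i : 'I_N, (n <= i)%N -> A i = setT &
     E = \bigcap_(i in [set: 'I_N]) (Phi i @^-1` A i)]].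

Let measurable_past n E : past n E -> measurable E.
Proof.
move=> [A [CA _ ->]]; apply: fin_bigcap_measurable; first exact: finite_finset.
move=> i _; rewrite -[X in measurable X]setTI; apply: mPhi => //.
exact: sub_sigma_algebra.
Qed.

(** Induction on the number of factors. The product of the first [n] factors is a function on [T]
    itself, measurable for the sigma-algebra generated by [past n]; the identity into this coarser
    space is a random element independent of the next [Phi k], so the result for two elements splits
    off one factor. *)
Lemma family_integral_prod (f : 'I_N -> g_sigma_algebraType C -> R) :
  (forall i, measurable_fun setT (f i)) -> (forall i x, 0 <= f i x) ->
  (\int[P]_w (\prod_i f i (Phi i w))%:E = \prod_i \int[P]_w (f i (Phi i w))%:E)%E.
Proof.
move=> mf f0.
suff H n : (n <= N)%N -> (\int[P]_w (\prod_(i < N | (i < n)%N) f i (Phi i w))%:E =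
    \prod_(i < N | (i < n)%N) \int[P]_w (f i (Phi i w))%:E)%E.
  have := H N (leqnn N).
  under [X in _ = X -> _]eq_bigl do rewrite ltn_ord.
  move=> <-; apply: eq_integral => w _; congr EFin; apply: eq_bigl => i.
  by rewrite ltn_ord.
elim: n => [_|n IH nN].
  rewrite big_pred0//; under eq_integral do rewrite big_pred0//.
  by rewrite integral_cst//= probability_setT mule1.
pose k := Ordinal nN.
have splitk (i : 'I_N) : (i < n.+1)%N && (i != k) = (i < n)%N.
  rewrite ltnS leq_eqVlt -(inj_eq val_inj) /=.
  by case: eqP => [->|_]/=; rewrite ?andbF ?andbT ?ltnn.
rewrite (bigD1 k)//=.
under [X in _ = (_ * X)%E]eq_bigl do rewrite splitk.
rewrite -(IH (ltnW nN)) muleC.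
pose GT := g_sigma_algebraType (past n).
pose F (w : GT) := \prod_(i < N | (i < n)%N) f i (Phi i w).
have pastT : past n setT.
  exists (fun=> setT); split => //.
  by apply/seteqP; split.
have pastI : setI_closed (past n).
  move=> _ _ [A [CA An ->]] [B [CB Bn ->]]; exists (fun i => A i `&` B i); split.
  - by move=> i; exact: CI.
  - by move=> i ni; rewrite An// Bn// setTI.
  - apply/seteqP; split=> [w [h1 h2] i _|w h].
      by split; [exact: h1|exact: h2].
    by split=> i _; case: (h i I).
have mid : @measurable_fun _ _ T GT setT (fun w => w).
  apply: (@measurability _ _ T GT setT _ (past n)) => //.
  by move=> _ [A pA <-]; rewrite setTI; exact: measurable_past pA.
have mPhin (i : 'I_N) : (i < n)%N ->
    @measurable_fun _ _ GT (g_sigma_algebraType C) setT (Phi i).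
  move=> ni; apply: (@measurability _ _ GT (g_sigma_algebraType C) setT _ C) => //.
  move=> _ [A CA <-]; rewrite setTI; apply: sub_sigma_algebra.
  exists (fun j => if j == i then A else setT); split.
  - by move=> j; case: ifP.
  - by move=> j nj; case: eqP => // ji; rewrite ji leqNgt ni in nj.
  - apply/seteqP; split=> [w wA j _|w h]; first by case: eqP => [->|].
    by have := h i I; rewrite eqxx.
have mF : measurable_fun setT F.
  rewrite /F; rewrite (_ : (fun w => _) =
    fun w => \prod_(i < N) (if (i < n)%N then f i (Phi i w) else 1)); last first.
    by apply/funext => w; rewrite big_mkcond.
  apply: measurable_prod => i _; case: (boolP (i < n)%N) => ni; last exact: measurable_cst.
  apply: (@measurableT_comp _ _ _ GT _ _ (f i) _ (Phi i)); first exact: mf.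
  exact: mPhin.
have := @indep_integralM _ _ (past n) C pastT CT pastI CI (fun w => w) (Phi k)
  mid (mPhi k) _ F (f k) mF (mf k) _ (f0 k).
move=> <-.
- apply: eq_integral => w _; congr EFin; rewrite (bigD1 k)//= mulrC.
  by congr *%R; apply: eq_bigl => i; rewrite splitk.
- move=> E B pE CB; have [A [CA An EA]] := pE.
  pose A' i := if i == k then B else A i.
  have -> : (fun w => w) @^-1` E `&` Phi k @^-1` B =
      \bigcap_(i in [set: 'I_N]) (Phi i @^-1` A' i).
    rewrite EA; apply/seteqP; split=> [w [h wB] i _|w h].
      rewrite /A'; case: eqP => [->//|_]; exact: h.
    split => [i _|]; last by have := h k I; rewrite /A' eqxx.
    have := h i I; rewrite /A'; case: eqP => [->|//] _.
    by rewrite An//= .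
  rewrite indepPhi; last by move=> i; rewrite /A'; case: ifP.
  rewrite (_ : (fun w => w) @^-1` E = E)// EA indepPhi//.
  rewrite (bigD1 k)//= [in RHS](bigD1 k)//= /A' eqxx An//=.
  rewrite preimage_setT probability_setT mul1e muleC; congr (_ * _)%E.
  by apply: eq_bigr => i /negbTE ->.
- by move=> w; apply: prodr_ge0 => i _.
Qed.

End independent_family.
End independence.

Section identical_law.
Context {R : realType} {d : measure_display} {T : measurableType d}.
Variable P : probability T R.
Context (S : pointedType) (C : set (set S)).
Hypotheses (CT : C setT) (CI : setI_closed C).
Context (U V : T -> g_sigma_algebraType C).
Hypotheses (mU : measurable_fun setT U) (mV : measurable_fun setT V).
Hypothesis UV : forall A, C A -> P (U @^-1` A) = P (V @^-1` A).

Let U' : {mfun T >-> g_sigma_algebraType C} :=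
  HB.pack U (isMeasurableFun.Build _ _ _ _ U mU).
Let V' : {mfun T >-> g_sigma_algebraType C} :=
  HB.pack V (isMeasurableFun.Build _ _ _ _ V mV).

Lemma identical_law A : measurable A -> distribution P U' A = distribution P V' A.
Proof.
have := @measure_unique _ R (g_sigma_algebraType C) C (fun=> setT) _ _ _ _
   (distribution P U') (distribution P V').
apply => //.
- by apply: bigcup_const; exists 0%N.
- by move=> _; rewrite (le_lt_trans (probability_le1 _ measurableT))// ltry.
Qed.

Lemma identical_law_integral (f : g_sigma_algebraType C -> R) :
  measurable_fun setT f -> (forall x, 0 <= f x) ->
  (\int[P]_w (f (U w))%:E = \int[P]_w (f (V w))%:E)%E.
Proof.
move=> mf f0.
transitivity (\int[distribution P U']_z (f z)%:E)%E.
  by rewrite ge0_integral_distribution//; exact/measurable_EFinP.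
transitivity (\int[distribution P V']_z (f z)%:E)%E.
  by apply: eq_measure_integral => A mA _; exact: identical_law.
by rewrite ge0_integral_distribution//; exact/measurable_EFinP.
Qed.

Lemma identical_law_L1 (f : g_sigma_algebraType C -> R) :
  measurable_fun setT f -> L1 P (f \o V) -> L1 P (f \o U).
Proof.
move=> mf /integrableP[_ lf]; apply/integrableP; split.
  by apply/measurable_EFinP; exact: (measurableT_comp mf mU).
apply: le_lt_trans lf; rewrite le_eqVlt; apply/orP; left; apply/eqP.
rewrite /= -[LHS]/(\int[P]_w ((fun x => `|f x|) (U w))%:E)%E identical_law_integral//.
exact: measurableT_comp.
Qed.

Lemma identical_law_Ex (f : g_sigma_algebraType C -> R) :
  measurable_fun setT f -> L1 P (f \o V) -> Ex P (f \o U) = Ex P (f \o V).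
Proof.
move=> mf lf; have lf' := identical_law_L1 mf lf.
rewrite /Ex; congr fine.
transitivity (\int[distribution P U']_z (f z)%:E)%E.
  by rewrite integral_distribution//; exact/measurable_EFinP.
transitivity (\int[distribution P V']_z (f z)%:E)%E.
  by apply: eq_measure_integral => A mA _; exact: identical_law.
by rewrite integral_distribution//; exact/measurable_EFinP.
Qed.

End identical_law.

(** * Pairs of random vectors as elements of a space generated by boxes *)

Section pairs_of_vectors.
Context {R : realType}.

Definition box m n (A : 'I_m -> set R) (B : 'I_n -> set R) :
    set ('cV[R]_m * 'cV[R]_n) :=
  [set z : 'cV[R]_m * 'cV[R]_n |
    (forall k, A k (z.1 k 0)) /\ (forall l, B l (z.2 l 0))].

(** [same_law] and [indep_pairs] speak of boxes. Taking boxes as generators turns these hypotheses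
    into statements about a pi-system, to which the preceding uniqueness arguments apply
    directly. *)
Definition boxes m n : set (set ('cV[R]_m * 'cV[R]_n)) :=
  [set E | exists A B, measurable_box A B /\ E = box A B].

End pairs_of_vectors.

Notation pairs R m n := (g_sigma_algebraType (@boxes R m n)).

Section pairs_of_random_vectors.
Context {R : realType}.

Lemma boxesT m n : @boxes R m n setT.
Proof.
exists (fun=> setT), (fun=> setT); split; first by split=> ?; exact: measurableT.
by apply/seteqP; split.
Qed.

Lemma boxesI m n : setI_closed (@boxes R m n).
Proof.
move=> _ _ [A [B [[mA mB] ->]]] [A' [B' [[mA' mB'] ->]]].
exists (fun k => A k `&` A' k), (fun l => B l `&` B' l); split.
  by split=> ?; exact: measurableI.
apply/seteqP; split=> [z [[h1 h2] [h3 h4]]|z [h1 h2]].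
  by split=> ?; split.
by split; split=> k; [case: (h1 k)|case: (h2 k)|case: (h1 k)|case: (h2 k)].
Qed.

Lemma measurable_coordl m n k :
  measurable_fun setT (fun z : pairs R m n => z.1 k 0).
Proof.
move=> _ A mA; apply: sub_sigma_algebra.
exists (fun j => if j == k then A else setT), (fun=> setT); split.
  by split=> // j; case: ifP.
apply/seteqP; split=> [z [_ zA]|z [h _]].
  by split=> // j; case: eqP => // ->.
by split=> //; have := h k; rewrite eqxx.
Qed.

Lemma measurable_coordr m n l :
  measurable_fun setT (fun z : pairs R m n => z.2 l 0).
Proof.
move=> _ B mB; apply: sub_sigma_algebra.
exists (fun=> setT), (fun j => if j == l then B else setT); split.
  by split=> // j; case: ifP.
apply/seteqP; split=> [z [_ zB]|z [_ h]].
  by split=> // j; case: eqP => // ->.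
by split=> //; have := h l; rewrite eqxx.
Qed.

Context {d : measure_display} {T : measurableType d}.
Variable P : probability T R.

Definition pairing m n (X : T -> 'cV[R]_m) (Y : T -> 'cV[R]_n) : T -> pairs R m n :=
  fun w => (X w, Y w).

Lemma measurable_pairing m n (X : T -> 'cV[R]_m) (Y : T -> 'cV[R]_n) :
  measurable_coords X -> measurable_coords Y -> measurable_fun setT (pairing X Y).
Proof.
move=> mX mY.
apply: (@measurability _ _ T (pairs R m n) setT (pairing X Y) (@boxes R m n)) => //.
move=> _ [_ [A [B [[mA mB] ->]]] <-]; rewrite setTI.
have -> : pairing X Y @^-1` box A B =
    (\bigcap_(k in [set: 'I_m]) ((fun w => X w k 0) @^-1` A k)) `&`
    (\bigcap_(l in [set: 'I_n]) ((fun w => Y w l 0) @^-1` B l)).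
  apply/seteqP; split=> [w [h1 h2]|w [h1 h2]]; first by split=> k _ /=.
  by split=> k; [exact: h1|exact: h2].
apply: measurableI; apply: fin_bigcap_measurable; try exact: finite_finset.
  by move=> k _; rewrite -[X in measurable X]setTI; exact: mX.
by move=> k _; rewrite -[X in measurable X]setTI; exact: mY.
Qed.

Lemma same_law_boxes m n (X' X : T -> 'cV[R]_m) (Y' Y : T -> 'cV[R]_n) :
  same_law P X' X Y' Y -> forall E, boxes E ->
  P (pairing X' Y' @^-1` E) = P (pairing X Y @^-1` E).
Proof. by move=> h _ [A [B [mAB ->]]]; exact: h mAB. Qed.

Lemma indep_pairs_boxes N m n (Xs : 'I_N -> T -> 'cV[R]_m) (Ys : 'I_N -> T -> 'cV[R]_n) :
  indep_pairs P Xs Ys -> forall E : 'I_N -> set ('cV[R]_m * 'cV[R]_n),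
  (forall i, boxes (E i)) ->
  (P (\bigcap_(i in [set: 'I_N]) (pairing (Xs i) (Ys i) @^-1` E i)) =
   \prod_(i < N) P (pairing (Xs i) (Ys i) @^-1` E i))%E.
Proof.
move=> h E /choice[A] /choice[B hAB].
have EAB i : E i = box (A i) (B i) by have [] := hAB i.
rewrite (_ : E = fun i => box (A i) (B i)); last exact/funext.
by apply: h => i; have [] := hAB i.
Qed.

End pairs_of_random_vectors.

(** * Subgaussian variables and covariance *)

Section exponential_bounds.
Context {R : realType}.
Implicit Types x y : R.

(** Everything comes from [expR y * (1 - y) <= 1]. For [0 <= y] it is applied twice; for [y < 0] it
    gives [expR y <= 1 + y + y ^+ 2], because multiplying the right side by [1 - y] yields
    [1 - y ^+ 3]. *)
Lemma expR_le_quadratic y : expR y <= 1 + y + y ^+ 2 * expR `|y|.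
Proof.
have [y0|y0] := leP 0 y.
  rewrite ger0_norm//.
  have h : expR y * (1 - y) <= 1.
    rewrite -[leRHS](expRxMexpNx_1 y) ler_wpM2l ?expR_ge0//.
    by have := expR_ge1Dx (- y).
  have := expR_ge1Dx y; have := expR_ge0 y; nra.
rewrite ltr0_norm//.
have h1 : expR y * (1 - y) <= 1.
  rewrite -[leRHS](expRxMexpNx_1 y) ler_wpM2l ?expR_ge0//.
  by have := expR_ge1Dx (- y).
have h2 : 1 - y <= expR (- y) by have := expR_ge1Dx (- y).
have h3 : 0 <= y ^+ 2 by rewrite sqr_ge0.
have h4 : expR y <= 1 + y + y ^+ 2.
  rewrite -(@ler_pM2r _ (1 - y)); last lra.
  by apply: (le_trans h1); nra.
by rewrite (le_trans h4)// lerD2l ler_peMr//; lra.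
Qed.

Lemma sqr_le_expR x : 0 <= x -> x ^+ 2 <= 8 * expR (x / 2).
Proof.
move=> x0; have := @expR_ge1Dxn R (x / 2) 1 _.
rewrite divr_ge0//= => /(_ isT); rewrite (_ : 2`! = 2%N)// expr_div_n; lra.
Qed.

Lemma expR_mean_le x y : expR ((x + y) / 2) <= (expR x + expR y) / 2.
Proof.
have -> : expR x = expR (x / 2) ^+ 2 by rewrite expr2 -expRD -splitr.
have -> : expR y = expR (y / 2) ^+ 2 by rewrite expr2 -expRD -splitr.
have := sqr_ge0 (expR (x / 2) - expR (y / 2)).
by rewrite mulrDl expRD; set a := expR _; set b := expR _; rewrite sqrrB; lra.
Qed.

(** Half of the exponent in the final exponential pays for the exponential of [l * x], the other
    half for the factor [x ^+ 2]. *)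
Lemma expR_scaled_le (l x : R) : `|l| <= 2^-1 ->
  expR (l * x) <= 1 + l * x + 8 * l ^+ 2 * expR `|x|.
Proof.
move=> l2; rewrite (le_trans (expR_le_quadratic _))// lerD2l exprMn.
set E := expR `|l * x|.
have -> : 8 * l ^+ 2 * expR `|x| = l ^+ 2 * (8 * expR `|x|) by ring.
have -> : l ^+ 2 * x ^+ 2 * E = l ^+ 2 * (x ^+ 2 * E) by ring.
rewrite ler_wpM2l ?sqr_ge0//.
have h1 : E <= expR (`|x| / 2).
  by rewrite ler_expR normrM mulrC ler_wpM2l.
have h2 : x ^+ 2 <= 8 * expR (`|x| / 2).
  by rewrite -real_normK ?num_real// sqr_le_expR.
rewrite [X in 8 * expR X]splitr expRD mulrA.
by apply: ler_pM => //; rewrite ?expR_ge0 ?sqr_ge0.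
Qed.

End exponential_bounds.

Lemma measurable_vnorm {R : realType} {d : measure_display} {S : measurableType d} k
    (Z : S -> 'cV[R]_k) :
  (forall j, measurable_fun setT (fun w => Z w j 0)) ->
  measurable_fun setT (fun w => vnorm (Z w)).
Proof.
move=> mZ; have ms : measurable_fun setT (@Num.sqrt R).
  by apply: continuous_measurable_fun; exact: sqrt_continuous.
apply: (measurableT_comp ms); apply: measurable_sum => j; exact: measurable_funX.
Qed.

Section subgaussian_variables.
Context {R : realType} {d : measure_display} {T : measurableType d}.
Variable P : probability T R.

(** The infimum need not be attained, but a strict inequality yields an admissible parameter below
    [t], and the exponential moment decreases with the parameter. *)
Lemma psi2norm_lt (Z : T -> R) (t : R) : measurable_fun setT Z ->
  (psi2norm P Z < t%:E)%E -> (\int[P]_w (expR (Z w ^+ 2 / t ^+ 2))%:E <= 2%:E)%E.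
Proof.
move=> mZ /ereal_inf_lt[_ [s [s0 sZ] <-]]; rewrite lte_fin => st.
apply: le_trans sZ; apply: ge0_le_integral => //.
- apply/measurable_EFinP; apply: measurableT_comp => //.
  by apply: measurable_funM => //; exact: measurable_funX.
- apply/measurable_EFinP; apply: measurableT_comp => //.
  by apply: measurable_funM => //; exact: measurable_funX.
- move=> w _; rewrite lee_fin ler_expR ler_wpM2l ?sqr_ge0//.
  have t0 : 0 < t by exact: lt_trans st.
  by rewrite lef_pV2 ?posrE ?exprn_gt0// ler_sqr ?nnegrE ltW// ltW.
Qed.

Section product.
Context (Z W : T -> R) (a b : R).
Hypotheses (mZ : measurable_fun setT Z) (mW : measurable_fun setT W).
Hypotheses (a0 : 0 < a) (b0 : 0 < b).
Hypothesis Za : (\int[P]_w (expR (Z w ^+ 2 / a ^+ 2))%:E <= 2%:E)%E.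
Hypothesis Wb : (\int[P]_w (expR (W w ^+ 2 / b ^+ 2))%:E <= 2%:E)%E.

Let mexpsqr (V : T -> R) (c : R) : measurable_fun setT V ->
  measurable_fun setT (fun w => expR (V w ^+ 2 / c ^+ 2)).
Proof.
by move=> mV; apply: measurableT_comp => //; apply: measurable_funM => //; exact: measurable_funX.
Qed.

(** The product is at most half the sum of the squares and the exponential is convex, so the bound
    is the average of the two marginal ones, whatever the dependence of [Z] and [W]. *)
Lemma expR_product_L1 : L1 P (fun w => expR `|Z w * W w / (a * b)|) /\
  Ex P (fun w => expR `|Z w * W w / (a * b)|) <= 2.
Proof.
have [lZ eZ] := L1_ge0 (mexpsqr a mZ) (fun w => expR_ge0 _) Za.
have [lW eW] := L1_ge0 (mexpsqr b mW) (fun w => expR_ge0 _) Wb.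
pose B w := 2^-1 * (expR (Z w ^+ 2 / a ^+ 2) + expR (W w ^+ 2 / b ^+ 2)).
have lB : L1 P B by apply: L1Z; exact: L1D.
have ZWB w : expR `|Z w * W w / (a * b)| <= B w.
  rewrite /B [leRHS]mulrC; apply: (le_trans _ (expR_mean_le _ _)); rewrite ler_expR.
  have -> : Z w * W w / (a * b) = (Z w / a) * (W w / b).
    by field; rewrite !gt_eqF.
  rewrite -!expr_div_n; move: (Z w / a) (W w / b) => z v.
  rewrite ler_norml; have := sqr_ge0 (z + v); have := sqr_ge0 (z - v).
  by rewrite sqrrB sqrrD => ? ?; apply/andP; split; lra.
have lE : L1 P (fun w => expR `|Z w * W w / (a * b)|).
  apply: (L1_le _ lB) => [|w]; last by rewrite ger0_norm ?expR_ge0.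
  apply: measurableT_comp => //; apply: measurableT_comp => //.
  by apply: measurable_funM => //; exact: measurable_funM.
split; first exact: lE.
apply: le_trans (Ex_le lE lB ZWB) _.
rewrite /B ExZ; last exact: L1D.
rewrite ExD; [|exact: lZ|exact: lW].
by move: eZ eW; move: (Ex P _) (Ex P _) => p q p2 q2; lra.
Qed.

(** With [V] the normalised product and [m = l * (a * b)], the mean of [expR (m * V w)] is at most
    [1 + m * Ex P V + 8 * m ^+ 2 * 2]; centring cancels the linear term. This is the origin of 16
    and of the restriction to [2^-1]. *)
Lemma product_mgf (l : R) : `|l| * (a * b) <= 2^-1 ->
  (\int[P]_w (expR (l * (Z w * W w - Ex P (fun w => Z w * W w))))%:E <=
   (expR (16 * (l * (a * b)) ^+ 2))%:E)%E.
Proof.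
move=> lab; set c := Ex P (fun w => Z w * W w); have [lE eE] := expR_product_L1.
pose V w := Z w * W w / (a * b); pose m := l * (a * b).
have ab0 : 0 < a * b by rewrite mulr_gt0.
have mV : measurable_fun setT V.
  by apply: measurable_funM => //; exact: measurable_funM.
have lV : L1 P V.
  apply: (L1_le mV lE) => w; rewrite -/(V w).
  by have := expR_ge1Dx `|V w|; lra.
have m2 : `|m| <= 2^-1 by rewrite /m normrM (gtr0_norm ab0).
have VE w : Z w * W w = (a * b) * V w by rewrite /V [RHS]mulrC divfK// gt_eqF.
have cE : c = (a * b) * Ex P V.
  by rewrite -ExZ//; apply: eq_Ex => w; rewrite VE.
pose B w := 1 + m * V w + 8 * m ^+ 2 * expR `|V w|.
have lB : L1 P B.
  by apply: L1D; [apply: L1D; [exact: L1_cst|exact: L1Z]|exact: L1Z].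
have eB : Ex P B <= expR (m * Ex P V + 16 * m ^+ 2).
  rewrite /B ExD; [|by apply: L1D; [exact: L1_cst|exact: L1Z]|exact: L1Z].
  rewrite ExD; [|exact: L1_cst|exact: L1Z].
  rewrite Ex_cst !ExZ//; apply: (le_trans _ (expR_ge1Dx _)); rewrite addrA lerD2l.
  by have := sqr_ge0 m; nra.
have mG : measurable_fun setT (fun w => expR (m * V w)).
  by apply: measurableT_comp => //; exact: measurable_funM.
have lG : L1 P (fun w => expR (m * V w)).
  apply: (L1_le mG lB) => w; rewrite ger0_norm ?expR_ge0//.
  exact: expR_scaled_le.
have eG : Ex P (fun w => expR (m * V w)) <= expR (m * Ex P V + 16 * m ^+ 2).
  by rewrite (le_trans _ eB)//; apply: Ex_le => // w; exact: expR_scaled_le.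
under eq_integral => w _.
  have -> : l * (Z w * W w - c) = - (m * Ex P V) + m * V w.
    by rewrite VE cE /m; ring.
  rewrite expRD; over.
rewrite (integral_Ex (f := fun w => expR (- (m * Ex P V)) * expR (m * V w))); last exact: L1Z.
rewrite ExZ// lee_fin -ler_pdivlMl ?expR_gt0// -expRN opprK -expRD.
by rewrite -/m.
Qed.

End product.

(** For [0 <= a] the event [opnorm > a] is a countable union over rational test vectors. The test
    inequality is homogeneous in the vector, so rational vectors need not be normalised. *)
Lemma opnorm_measurable m n (M : T -> 'M[R]_(m, n)) :
  (forall i j, measurable_fun setT (fun w => M w i j)) ->
  measurable_fun setT (fun w => opnorm (M w)).
Proof.
move=> mM.
have mvn (v : 'cV[R]_n) : measurable_fun setT (fun w => vnorm (M w *m v)).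
  apply: measurable_vnorm => k.
  rewrite (_ : (fun w => _) = fun w => \sum_j M w k j * v j 0); last first.
    by apply/funext => w; rewrite mxE.
  by apply: measurable_sum => j; apply: measurable_funM.
pose q (r : 'cV[rat]_n) : 'cV[R]_n := \col_k ratr (r k 0).
(* Rational vectors suffice to test an operator norm bound. *)
have opnorm_rat (A : 'M[R]_(m, n)) (c : R) : 0 <= c ->
    (forall r, vnorm (A *m q r) <= c * vnorm (q r)) -> opnorm A <= c.
  move=> c0 hr; apply: opnorm_le => // v.
  apply/ler_addgt0Pr => e e0.
  (* A coordinatewise error [e / K] changes the two sides by at most
     [(c + opnorm A) * n%:R * (e / K) <= e] in total; the added 1 keeps [K] positive. *)
  pose K := (c + opnorm A) * n%:R + 1.
  have oA := opnorm_ge0 A.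
  have K0 : 0 < K by rewrite /K ltr_wpDl// mulr_ge0// addr_ge0.
  have : forall k, exists r : rat, `|v k 0 - ratr r| < e / K.
    move=> k; have vk : v k 0 - e / K < v k 0 by rewrite ltrBlDr ltrDl divr_gt0.
    have [r] := rat_in_itvoo vk; rewrite in_itv/= => /andP[h1 h2].
    by exists r; rewrite gtr0_norm ?subr_gt0// ltrBlDr -ltrBlDl.
  move=> /choice[r hrr]; pose rv := \col_k r k : 'cV[rat]_n.
  have dv : vnorm (v - q rv) <= n%:R * (e / K).
    rewrite -ler_sqr ?nnegrE ?vnorm_ge0 ?mulr_ge0 ?invr_ge0 ?(ltW e0) ?(ltW K0)//.
    rewrite vnorm_sqr exprMn.
    apply: (@le_trans _ _ (\sum_(k < n) (e / K) ^+ 2)).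
      apply: ler_sum => k _; rewrite -expr2 !mxE -real_normK ?num_real//.
      by rewrite ler_sqr ?nnegrE// ?ltW// divr_gt0.
    rewrite sumr_const card_ord -[leLHS]mulr_natl ler_wpM2r ?sqr_ge0//.
    by rewrite -natrX ler_nat; case: (n) => // n'; rewrite leq_pmulr.
  have -> : v = q rv + (v - q rv) by rewrite addrC subrK.
  set u := v - q rv in dv *.
  rewrite mulmxDr (le_trans (vnormD _ _))//.
  have h1 := vnorm_mulmx A u; have h2 := hr rv.
  have h3 : vnorm (q rv) <= vnorm (q rv + u) + vnorm u.
    rewrite -{1}(addrK u (q rv)) (le_trans (vnormD _ _))// lerD2l.
    by rewrite -scaleN1r vnormZ normrN1 mul1r.
  have h4 : (c + opnorm A) * vnorm u <= e.
    rewrite (le_trans (ler_wpM2l _ dv)) ?addr_ge0//.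
    have -> : (c + opnorm A) * (n%:R * (e / K)) = e * (((c + opnorm A) * n%:R) / K) by ring.
    rewrite ger_pMr// ler_pdivrMr// mul1r /K; lra.
  have h5 := ler_wpM2l c0 h3; lra.
apply: (measurability _ (RGenOInfty.measurableE R)) => //.
move=> _ [_ [a ->] <-]; rewrite setTI.
have [a0|a0] := ltP a 0.
  rewrite (_ : _ @^-1` _ = setT)//; apply/seteqP; split => // w _ /=.
  by rewrite in_itv/= andbT (lt_le_trans a0)// opnorm_ge0.
rewrite (_ : _ @^-1` _ =
    \bigcup_(r : 'cV[rat]_n) [set w | a * vnorm (q r) < vnorm (M w *m q r)]).
  apply: countable_bigcupT_measurable => [|r]; first exact: countableP.
  rewrite -[X in measurable X]setTI.
  rewrite (_ : [set w | _] = (fun w => vnorm (M w *m q r)) @^-1` `]a * vnorm (q r), +oo[).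
    exact: mvn.
  by apply/seteqP; split => w /=; rewrite in_itv/= andbT.
apply/seteqP; split => w /=; rewrite in_itv/= andbT.
  move=> aw; apply: contrapT => h; move: aw; rewrite ltNge => /negP; apply.
  apply: opnorm_rat => // r; rewrite leNgt; apply/negP => ar.
  by apply: h; exists r.
move=> [r _ /= h]; rewrite ltNge; apply/negP => wa; move: h.
by rewrite ltNge => /negP; apply; move/(opnorm_leP _ a0) : wa; exact.
Qed.

End subgaussian_variables.

(** * Covariance matrices and subgaussian constants *)

Section covariance.
Context {R : realType} {d : measure_display} {T : measurableType d}.
Variable P : probability T R.

Lemma measurable_ip n (X : T -> 'cV[R]_n) v :
  measurable_coords X -> measurable_fun setT (ip X v).
Proof.
by move=> mX; apply: measurable_sum => k; apply: measurable_funM => //; exact: mX.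
Qed.

Lemma ipE n (X : T -> 'cV[R]_n) v w : ip X v w = dot (X w) v.
Proof. by []. Qed.

Lemma L2_coords n (X : T -> 'cV[R]_n) : L2_random_vector P X -> measurable_coords X.
Proof. by move=> X2 k; have [] := X2 k. Qed.

Lemma L2_coord_sqr n (X : T -> 'cV[R]_n) : L2_random_vector P X ->
  forall k, L1 P (fun w => X w k 0 ^+ 2).
Proof. by move=> X2 k; have [] := X2 k. Qed.

Lemma L2_ip_sqr n (X : T -> 'cV[R]_n) v : L2_random_vector P X ->
  L1 P (fun w => ip X v w ^+ 2).
Proof.
move=> X2; apply: L1_sqr_sum => k.
  by apply: measurable_funM => //; exact: L2_coords.
by apply: eq_L1 (L1_sqrZ (v k 0) (L2_coord_sqr X2 k)) => w; rewrite mulrC.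
Qed.

Lemma L1_ipM m n (X : T -> 'cV[R]_m) (Y : T -> 'cV[R]_n) u v :
  L2_random_vector P X -> L2_random_vector P Y ->
  L1 P (fun w => ip X u w * ip Y v w).
Proof.
by move=> X2 Y2; apply: L1M; [apply/measurable_ip/L2_coords|
  apply/measurable_ip/L2_coords|exact: L2_ip_sqr|exact: L2_ip_sqr].
Qed.

Lemma L1_coordM m n (X : T -> 'cV[R]_m) (Y : T -> 'cV[R]_n) k l :
  L2_random_vector P X -> L2_random_vector P Y ->
  L1 P (fun w => X w k 0 * Y w l 0).
Proof.
by move=> X2 Y2; apply: L1M;
  [exact: L2_coords|exact: L2_coords|exact: L2_coord_sqr|exact: L2_coord_sqr].
Qed.

Lemma Ex_ipM m n (X : T -> 'cV[R]_m) (Y : T -> 'cV[R]_n) u v :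
  L2_random_vector P X -> L2_random_vector P Y ->
  Ex P (fun w => ip X u w * ip Y v w) = dot u (cross_cov P X Y *m v).
Proof.
move=> X2 Y2.
have E w : ip X u w * ip Y v w = \sum_k \sum_l (u k 0 * v l 0) * (X w k 0 * Y w l 0).
  rewrite /ip mulr_suml; apply: eq_bigr => k _.
  by rewrite mulr_sumr; apply: eq_bigr => l _; ring.
have lXY k l := L1_coordM k l X2 Y2.
rewrite (eq_Ex P E) Ex_sum; last by move=> k _; apply: L1_sum => l _; exact: L1Z.
apply: eq_bigr => k _; rewrite Ex_sum; last by move=> l _; exact: L1Z.
rewrite mxE mulr_sumr; apply: eq_bigr => l _.
by rewrite ExZ// mxE; ring.
Qed.

Lemma Ex_ip_sqr n (X : T -> 'cV[R]_n) v : L2_random_vector P X ->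
  Ex P (fun w => ip X v w ^+ 2) = dot v (cross_cov P X X *m v).
Proof. by move=> X2; rewrite -Ex_ipM//; apply: eq_Ex => w; rewrite expr2. Qed.

Lemma covariance_diag_ge0 n (X : T -> 'cV[R]_n) k : 0 <= cross_cov P X X k k.
Proof. by rewrite mxE; apply: Ex_ge0 => w; rewrite -expr2 sqr_ge0. Qed.

Lemma covariance_quad_ge0 n (X : T -> 'cV[R]_n) v : L2_random_vector P X ->
  0 <= dot v (cross_cov P X X *m v).
Proof. by move=> X2; rewrite -Ex_ip_sqr//; apply: Ex_ge0 => w; rewrite sqr_ge0. Qed.

Lemma cross_cov_CauchySchwarz m n (X : T -> 'cV[R]_m) (Y : T -> 'cV[R]_n) u v :
  L2_random_vector P X -> L2_random_vector P Y ->
  dot u (cross_cov P X Y *m v) ^+ 2 <=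
  dot u (cross_cov P X X *m u) * dot v (cross_cov P Y Y *m v).
Proof.
move=> X2 Y2; rewrite -Ex_ipM// -!Ex_ip_sqr//.
by apply: Ex_CauchySchwarz; [apply/measurable_ip/L2_coords|
  apply/measurable_ip/L2_coords|exact: L2_ip_sqr|exact: L2_ip_sqr].
Qed.

Lemma covariance_quad_le n (X : T -> 'cV[R]_n) v :
  dot v (cross_cov P X X *m v) <= opnorm (cross_cov P X X) * vnorm v ^+ 2.
Proof. by rewrite expr2; exact: dot_mulmx_le. Qed.

Lemma cross_cov_dot_le m n (X : T -> 'cV[R]_m) (Y : T -> 'cV[R]_n) u v :
  L2_random_vector P X -> L2_random_vector P Y ->
  dot u (cross_cov P X Y *m v) <=
  Num.sqrt (opnorm (cross_cov P X X) * opnorm (cross_cov P Y Y)) * (vnorm u * vnorm v).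
Proof.
move=> X2 Y2; rewrite (le_trans (ler_norm _))//.
rewrite -ler_sqr ?nnegrE ?mulr_ge0 ?sqrtr_ge0 ?vnorm_ge0//.
rewrite real_normK ?num_real// (le_trans (cross_cov_CauchySchwarz _ _ X2 Y2))//.
rewrite exprMn sqr_sqrtr; last by rewrite mulr_ge0// opnorm_ge0.
rewrite exprMn mulrACA; apply: ler_pM; rewrite ?covariance_quad_ge0//;
  exact: covariance_quad_le.
Qed.

(* Cauchy-Schwarz for the semidefinite form bounds its off-diagonal values by the diagonal ones. *)
Lemma opnorm_covariance_le n (X : T -> 'cV[R]_n) q : L2_random_vector P X ->
  0 <= q -> (forall v, dot v (cross_cov P X X *m v) <= q * vnorm v ^+ 2) ->
  opnorm (cross_cov P X X) <= q.
Proof.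
move=> X2 q0 hq; apply: opnorm_le_bilinear => // u v.
rewrite (le_trans (ler_norm _))//.
rewrite -ler_sqr ?nnegrE ?mulr_ge0 ?vnorm_ge0//.
rewrite real_normK ?num_real// (le_trans (cross_cov_CauchySchwarz _ _ X2 X2))//.
have -> : (q * (vnorm u * vnorm v)) ^+ 2 = (q * vnorm u ^+ 2) * (q * vnorm v ^+ 2) by ring.
by apply: ler_pM; rewrite ?covariance_quad_ge0.
Qed.

Lemma trace_covariance n (X : T -> 'cV[R]_n) :
  \tr (cross_cov P X X) = \sum_k Ex P (fun w => X w k 0 ^+ 2).
Proof. by apply: eq_bigr => k _; rewrite mxE; apply: eq_Ex => w; rewrite expr2. Qed.

Lemma opnorm_covariance_le_trace n (X : T -> 'cV[R]_n) : L2_random_vector P X ->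
  opnorm (cross_cov P X X) <= \tr (cross_cov P X X).
Proof.
move=> X2; apply: opnorm_covariance_le => // [|v].
  by apply: sumr_ge0 => k _; exact: covariance_diag_ge0.
rewrite -Ex_ip_sqr// trace_covariance mulrC -Ex_sum; last first.
  by move=> k _; exact: L2_coord_sqr.
have lS : L1 P (fun w => \sum_k X w k 0 ^+ 2).
  by apply: L1_sum => k _; exact: L2_coord_sqr.
rewrite -ExZ//; apply: Ex_le => [||w]; [exact: L2_ip_sqr|exact: L1Z|].
rewrite ipE -real_normK ?num_real// (_ : \sum_k _ = vnorm (X w) ^+ 2).
  by rewrite -exprMn ler_sqr ?nnegrE ?mulr_ge0 ?vnorm_ge0// mulrC normr_dot_le.
by rewrite vnorm_sqr; apply: eq_bigr => k _; rewrite expr2.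
Qed.

Section nonzero.
Context (n : nat) (X : T -> 'cV[R]_n).
Hypotheses (X2 : L2_random_vector P X) (X0 : cross_cov P X X != 0).
Let S := cross_cov P X X.

Lemma opnorm_covariance_gt0 : 0 < opnorm S.
Proof.
by rewrite lt_def opnorm_ge0 andbT; apply: contra_neq X0 => /opnorm_eq0.
Qed.

Lemma trace_eff_rank : \tr S = eff_rank S * opnorm S.
Proof. by rewrite /eff_rank divfK// gt_eqF// opnorm_covariance_gt0. Qed.

Lemma eff_rank_ge1 : 1 <= eff_rank S.
Proof.
rewrite ler_pdivlMr ?opnorm_covariance_gt0// mul1r.
exact: opnorm_covariance_le_trace.
Qed.

(** Were every quadratic value at most half the norm, the norm itself would be at most half of
    itself. Settling for one half makes it unnecessary to attain the supremum. *)
Lemma covariance_large_direction :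
  exists2 v, vnorm v = 1 & opnorm S / 2 < dot v (S *m v).
Proof.
have S0 := opnorm_covariance_gt0.
have [v vS] : exists v, opnorm S / 2 * vnorm v ^+ 2 < dot v (S *m v).
  apply: contrapT => /forallNP h.
  have : opnorm S <= opnorm S / 2.
    apply: opnorm_covariance_le => // [|v]; first by rewrite divr_ge0// ltW.
    by rewrite leNgt; apply/negP; exact: h.
  by lra.
have v0 : vnorm v != 0.
  by apply: contraTneq vS => v0; rewrite v0 expr0n/= mulr0 (vnorm_eq0 v0) dot0l ltxx.
have v0' : 0 < vnorm v by rewrite lt_def v0 vnorm_ge0.
exists ((vnorm v)^-1 *: v); first by rewrite vnormZ normfV gtr0_norm// mulVf.
rewrite -scalemxAr dotZl dotZr mulrA -expr2 exprVn [ltRHS]mulrC ltr_pdivlMr//.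
by rewrite exprn_gt0.
Qed.

(** If [K < 1], some [t] lies strictly between [K] times the L2 norm and the L2 norm of a
    nondegenerate marginal. Its exponential moment is at most 2, while [1 + x <= expR x] makes it at
    least 1 plus the second moment over [t ^+ 2], which exceeds 2. *)
Lemma subg_condition_ge1 K : subg_condition P X K -> 1 <= K.
Proof.
move=> [K0 hK]; have [v v1 vS] := covariance_large_direction.
have S0 := opnorm_covariance_gt0.
have L2E : L2norm P (ip X v) ^+ 2 = dot v (S *m v).
  by rewrite /L2norm sqr_sqrtr ?Ex_ip_sqr// covariance_quad_ge0.
have L0 : 0 < L2norm P (ip X v).
  by rewrite sqrtr_gt0 Ex_ip_sqr// (lt_trans _ vS)// divr_gt0.
have mv : measurable_fun setT (ip X v) by apply/measurable_ip/L2_coords.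
rewrite leNgt; apply/negP => K1.
pose t := (K * L2norm P (ip X v) + L2norm P (ip X v)) / 2.
have t1 : K * L2norm P (ip X v) < t by rewrite /t; nra.
have t2 : t < L2norm P (ip X v) by rewrite /t; nra.
have t0 : 0 < t by rewrite (le_lt_trans _ t1)// mulr_ge0// ltW.
have h : (psi2norm P (ip X v) < t%:E)%E.
  by rewrite (le_lt_trans (hK _ v1))// lte_fin.
have me : measurable_fun setT (fun w => expR (ip X v w ^+ 2 / t ^+ 2)).
  apply: measurableT_comp => //; apply: measurable_funM => //.
  exact: measurable_funX.
have [l e] := L1_ge0 me (fun w => expR_ge0 _) (psi2norm_lt mv h).
have : Ex P (fun w => 1 + (t ^+ 2)^-1 * ip X v w ^+ 2) <= 2.
  apply: le_trans e; apply: Ex_le => [|//|w].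
    by apply: L1D; [exact: L1_cst|apply: L1Z; exact: L2_ip_sqr].
  by rewrite /= [X in 1 + X]mulrC; exact: expR_ge1Dx.
rewrite ExD; [|exact: L1_cst|by apply: L1Z; exact: L2_ip_sqr].
rewrite Ex_cst ExZ; last exact: L2_ip_sqr.
rewrite Ex_ip_sqr// -L2E -lerBrDl mulrC ler_pdivrMr ?exprn_gt0//.
have -> : 2 - 1 = 1 :> R by lra.
rewrite mul1r ler_sqr ?nnegrE ?(ltW t0) ?(ltW L0)//.
by rewrite leNgt t2.
Qed.

Hypothesis Xs : subgaussian P X.

Lemma subg_const_ge1 : 1 <= subg_const P X.
Proof.
have [_ [K hK]] := Xs; apply: lb_le_inf; first by exists K.
by move=> K' /= /subg_condition_ge1.
Qed.

(** The factor 2 supplies an admissible [K] strictly below [2 * subg_const P X] and the strict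
    inequality that [psi2norm_lt] requires. Only an upper bound [B] on the standard deviation
    enters, because truncation gives no more. *)
Lemma subgaussian_ip_expR v B : 0 < B -> dot v (S *m v) <= B ^+ 2 ->
  (\int[P]_w (expR (ip X v w ^+ 2 / (2 * subg_const P X * B) ^+ 2))%:E <= 2%:E)%E.
Proof.
move=> B0 vB; have K1 := subg_const_ge1.
have [v0|v0] := eqVneq (vnorm v) 0.
  rewrite (eq_integral (cst 1%:E)); last first.
    by move=> w _; rewrite ipE (vnorm_eq0 v0) dotC dot0l expr0n/= mul0r expR0.
  by rewrite integral_cst//= probability_setT mule1 lee_fin ler1n.
have v0' : 0 < vnorm v by rewrite lt_def v0 vnorm_ge0.
pose u := (vnorm v)^-1 *: v.
have u1 : vnorm u = 1 by rewrite vnormZ normfV gtr0_norm// mulVf.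
have [K [K0 hK] KK] : exists2 K, subg_condition P X K & K < 2 * subg_const P X.
  have [_ [K hK]] := Xs.
  have /inf_adherent : has_inf [set K | subg_condition P X K].
    by split; [exists K|exists 1 => K' /= /subg_condition_ge1].
  have c0 : 0 < subg_const P X by rewrite (lt_le_trans ltr01).
  move=> /(_ _ c0)[K' hK' KK]; exists K' => //.
  by rewrite (lt_le_trans KK)// mulr_natl mulr2n lerD2r.
pose t := 2 * subg_const P X * B / vnorm v.
have mu : measurable_fun setT (ip X u) by apply/measurable_ip/L2_coords.
have LB : L2norm P (ip X u) <= B / vnorm v.
  rewrite /L2norm Ex_ip_sqr// -[leRHS]ger0_norm; last by rewrite divr_ge0// ltW.
  rewrite -sqrtr_sqr ler_wsqrtr// -scalemxAr dotZl dotZr mulrA -expr2.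
  by rewrite expr_div_n mulrC exprVn ler_wpM2r// invr_ge0 sqr_ge0.
have h : (psi2norm P (ip X u) < t%:E)%E.
  apply: le_lt_trans (hK _ u1) _; rewrite lte_fin.
  apply: (@le_lt_trans _ _ (K * (B / vnorm v))); first by rewrite ler_wpM2l// ltW.
  by rewrite /t -mulrA ltr_pM2r// divr_gt0.
apply: le_trans (psi2norm_lt mu h).
rewrite le_eqVlt; apply/orP; left; apply/eqP/eq_integral => w _; do 2 congr (_ _).
rewrite -!expr_div_n !ipE /t /u dotZr; congr (_ ^+ 2).
by field; rewrite !gt_eqF// ?mulr_gt0// (lt_le_trans ltr01).
Qed.

End nonzero.
End covariance.

(** * Upper bounds *)

Section truncation.
Context {R : realType}.

(* Truncation keeps the tested linear forms subgaussian with a fixed constant;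
   by Markov the discarded mass is at most 1/32, and Cauchy-Schwarz bounds the
   resulting shift of the barycentre. *)
Lemma truncated_barycentre n (I : finType) (theta : I -> 'cV[R]_n) (rho : I -> R)
    (S : 'M[R]_n) (beta a r : R) (v : 'cV[R]_n) :
  1 <= beta -> vnorm v <= 1 ->
  (forall i, 0 <= rho i) -> (forall x, \sum_i rho i * dot (theta i) x = dot v x) ->
  (forall Q : 'M[R]_n, (forall k, 0 <= Q k k) ->
     \sum_i rho i * dot (theta i) (Q *m theta i) <= dot v (Q *m v) + \tr Q / beta) ->
  (forall k, 0 <= S k k) -> (forall x, 0 <= dot x (S *m x)) ->
  dot v (S *m v) <= a -> 0 < r -> 32 * (a + \tr S / beta) <= r ->
  vnorm (v - \sum_i (rho i * (dot (theta i) (S *m theta i) <= r)%R%:R) *: theta i) <= 4^-1.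
Proof.
move=> b1 v1 rho0 bary quad Skk Spos vS r0 hr.
have b0 : 0 < beta by rewrite (lt_le_trans ltr01).
set g := fun i : I => (dot (theta i) (S *m theta i) <= r).
apply: vnorm_le => [|x]; first by rewrite invr_ge0.
rewrite dotBl dot_suml -bary -sumrB.
have -> : \sum_i (rho i * dot (theta i) x - dot ((rho i * (g i)%:R) *: theta i) x) =
    \sum_i rho i * ((~~ g i)%:R * dot (theta i) x).
  by apply: eq_bigr => i _; rewrite dotZl; case: (g i) => /=; ring.
rewrite (le_trans (ler_norm _))// -ler_sqr ?nnegrE ?mulr_ge0 ?invr_ge0 ?vnorm_ge0//.
rewrite real_normK ?num_real//.
apply: (le_trans (weighted_CauchySchwarz (fun i => (~~ g i)%:R) (fun i => dot (theta i) x) rho0)).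
(* Markov's inequality: the quadratic form exceeds [r] on the discarded indices and has mean at most
   [r / 32]. *)
have h1 : \sum_i rho i * (~~ g i)%:R ^+ 2 <= 32^-1.
  rewrite -(@ler_pM2l _ r)// mulr_sumr.
  apply: (@le_trans _ _ (a + \tr S / beta)).
    apply: le_trans (_ : dot v (S *m v) + \tr S / beta <= _); last by rewrite lerD2r.
    apply: (le_trans _ (quad _ Skk)); apply: ler_sum => i _.
    rewrite mulrCA ler_wpM2l// /g -ltNge; case: ltP => h /=.
      by rewrite expr1n mulr1 ltW.
    by rewrite expr0n/= mulr0.
  by lra.
(* [quad] for the rank-one form [x *m x^T], with [1 <= beta]. The number 32 is chosen so that
   [32^-1 * 2 = 4^-1 ^+ 2]. *)
have h2 : \sum_i rho i * dot (theta i) x ^+ 2 <= 2 * vnorm x ^+ 2.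
  have := quad (x *m x^T) _.
  have dxx (y : 'cV[R]_n) : dot y (x *m x^T *m y) = dot y x ^+ 2.
    have xy : (x^T *m y) 0 0 = dot y x.
      by rewrite mxE dotC; apply: eq_bigr => k _; rewrite mxE.
    by rewrite -mulmxA dot_mulmx [LHS]big_ord1 xy expr2.
  have -> : \tr (x *m x^T) = vnorm x ^+ 2.
    rewrite vnorm_sqr; apply: eq_bigr => k _; rewrite mxE big_ord1.
    by rewrite mxE.
  move=> /(_ (fun k => _)) h; apply: le_trans (_ : dot v x ^+ 2 + vnorm x ^+ 2 / beta <= _).
    rewrite -dxx; under eq_bigr do rewrite -dxx.
    by apply: h => k; rewrite mxE big_ord1 mxE -expr2 sqr_ge0.
  have h3 : dot v x ^+ 2 <= vnorm x ^+ 2.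
    rewrite -[leLHS]real_normK ?num_real// ler_sqr ?nnegrE ?vnorm_ge0//.
    by rewrite (le_trans (normr_dot_le _ _))// ler_piMl// vnorm_ge0.
  have h4 : vnorm x ^+ 2 / beta <= vnorm x ^+ 2.
    by rewrite ler_pdivrMr// ler_peMr// sqr_ge0.
  lra.
apply: (@le_trans _ _ (32^-1 * (2 * vnorm x ^+ 2))).
  apply: ler_pM => //; apply: sumr_ge0 => i _; by rewrite mulr_ge0 ?sqr_ge0.
by rewrite exprMn; lra.
Qed.

End truncation.

Section empirical_deviation.
Context {R : realType} {d : measure_display} {T : measurableType d}.
Variable P : probability T R.
Context (N m n : nat) (X : T -> 'cV[R]_m) (Y : T -> 'cV[R]_n).
Context (Xs : 'I_N -> T -> 'cV[R]_m) (Ys : 'I_N -> T -> 'cV[R]_n).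
Hypothesis N0 : (1 <= N)%N.
Hypotheses (X2 : L2_random_vector P X) (Y2 : L2_random_vector P Y).
Hypotheses (mXs : forall i, measurable_coords (Xs i)).
Hypotheses (mYs : forall i, measurable_coords (Ys i)).
Hypothesis lawXY : forall i, same_law P (Xs i) X (Ys i) Y.
Hypothesis indepXY : indep_pairs P Xs Ys.

Let N0' : 0 < N%:R :> R. Proof. by rewrite ltr0n. Qed.

Lemma emp_dev_dot u v w : dot u (emp_dev P Xs Ys X Y w *m v) =
  N%:R^-1 * \sum_i (ip (Xs i) u w * ip (Ys i) v w - dot u (cross_cov P X Y *m v)).
Proof.
rewrite mulmxBl dotBr -scalemxAl dotZr mulmx_suml dot_sumr sumrB mulrBr.
congr (_ - _).
  congr (_ * _); apply: eq_bigr => i _.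
  rewrite -mulmxA dot_mulmx /dot big_ord1; congr (_ * _).
    by rewrite mxE /ip; apply: eq_bigr => k _; rewrite mxE.
  by rewrite mxE /ip; apply: eq_bigr => k _; rewrite mxE.
by rewrite sumr_const card_ord -[X in _ * X]mulr_natl mulrA mulVf ?mul1r// gt_eqF.
Qed.

Lemma measurable_emp_dev k l : measurable_fun setT (fun w => emp_dev P Xs Ys X Y w k l).
Proof.
rewrite (_ : (fun w => _) = fun w => N%:R^-1 * (\sum_i Xs i w k 0 * Ys i w l 0)
   - cross_cov P X Y k l).
  apply: measurable_funB => //; apply: measurable_funM => //.
  apply: measurable_sum => i; apply: measurable_funM; [exact: mXs|exact: mYs].
apply/funext => w; rewrite !mxE summxE; congr (_ * _ - _).
by apply: eq_bigr => i _; rewrite mxE big_ord1 mxE.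
Qed.

Lemma measurable_dev : measurable_fun setT (fun w => opnorm (emp_dev P Xs Ys X Y w)).
Proof. by apply: opnorm_measurable; exact: measurable_emp_dev. Qed.

Lemma measurable_pairs_ip u v :
  measurable_fun setT (fun z : pairs R m n => dot z.1 u * dot z.2 v).
Proof.
apply: measurable_funM; apply: measurable_sum => k; apply: measurable_funM => //.
  exact: measurable_coordl.
exact: measurable_coordr.
Qed.

(** The factor [N%:R] turns the empirical mean into a sum, whose exponential moment factorises over
    the samples; each factor has the law of the reference pair and obeys [product_mgf]. *)
Lemma emp_dev_mgf (u : 'cV[R]_m) (v : 'cV[R]_n) (a b l : R) : 0 < a -> 0 < b ->
  (\int[P]_w (expR (ip X u w ^+ 2 / a ^+ 2))%:E <= 2%:E)%E ->
  (\int[P]_w (expR (ip Y v w ^+ 2 / b ^+ 2))%:E <= 2%:E)%E ->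
  `|l| * (a * b) <= 2^-1 ->
  (\int[P]_w (expR (l * N%:R * dot u (emp_dev P Xs Ys X Y w *m v)))%:E <=
   (expR (16 * (l * (a * b)) ^+ 2 * N%:R))%:E)%E.
Proof.
move=> a0 b0 ha hb lab.
pose c := dot u (cross_cov P X Y *m v).
pose f (z : pairs R m n) := expR (l * (dot z.1 u * dot z.2 v - c)).
have mf : measurable_fun setT f.
  apply: measurableT_comp => //; apply: measurable_funM => //.
  by apply: measurable_funB => //; exact: measurable_pairs_ip.
have f0 z : 0 <= f z by exact: expR_ge0.
rewrite (eq_integral (fun w => (\prod_i f (pairing (Xs i) (Ys i) w))%:E)); last first.
  move=> w _; rewrite emp_dev_dot mulrA mulfK ?gt_eqF// mulr_sumr.
  by rewrite -expR_sum.
rewrite (@family_integral_prod _ _ _ P _ _ N (@boxesT R m n) (@boxesI R m n)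
  (fun i => pairing (Xs i) (Ys i)) _ _ (fun=> f))//; last 2 first.
- by move=> i; exact: measurable_pairing.
- exact: indep_pairs_boxes.
have mP : measurable_fun setT (pairing X Y).
  by apply: measurable_pairing; exact: L2_coords.
have E i : (\int[P]_w (f (pairing (Xs i) (Ys i) w))%:E =
    \int[P]_w (f (pairing X Y w))%:E)%E.
  apply: (@identical_law_integral _ _ _ P _ _ (@boxesT R m n) (@boxesI R m n)) => //.
    exact: measurable_pairing.
  exact: same_law_boxes.
have [lf ef] : L1 P (fun w => f (pairing X Y w)) /\
    Ex P (fun w => f (pairing X Y w)) <= expR (16 * (l * (a * b)) ^+ 2).
  apply: L1_ge0 => //; first exact: (measurableT_comp mf mP).
  rewrite /f /c -Ex_ipM//; apply: product_mgf => //;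
    by apply/measurable_ip/L2_coords.
under eq_bigr do rewrite E (integral_Ex lf).
rewrite prodEFin lee_fin prodr_const card_ord expRM_natr.
by rewrite lerXn2r ?nnegrE ?expR_ge0// Ex_ge0.
Qed.

Section upper.
Hypotheses (X0 : cross_cov P X X != 0) (Y0 : cross_cov P Y Y != 0).
Hypotheses (sX : subgaussian P X) (sY : subgaussian P Y).

(** Its square is the truncation level: the parenthesis bounds the mean of the quadratic form under
    every smoothed law centred in the unit ball, and 32 is the factor demanded by
    [truncated_barycentre]. *)
Definition radius k (Z : T -> 'cV[R]_k) (beta : R) : R :=
  Num.sqrt (32 * (opnorm (cross_cov P Z Z) + \tr (cross_cov P Z Z) / beta)).

Lemma radius_gt0 k (Z : T -> 'cV[R]_k) beta : L2_random_vector P Z ->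
  cross_cov P Z Z != 0 -> 0 < beta -> 0 < radius Z beta.
Proof.
move=> Z2 Z0 b0; rewrite sqrtr_gt0 mulr_gt0// ltr_wpDr//; last first.
  exact: opnorm_covariance_gt0.
rewrite divr_ge0 ?(ltW b0)//.
by rewrite (le_trans (opnorm_ge0 _) (opnorm_covariance_le_trace Z2)).
Qed.

Lemma radius_sqr k (Z : T -> 'cV[R]_k) beta : L2_random_vector P Z -> 0 < beta ->
  radius Z beta ^+ 2 = 32 * (opnorm (cross_cov P Z Z) + \tr (cross_cov P Z Z) / beta).
Proof.
move=> Z2 b0; rewrite sqr_sqrtr// mulr_ge0// addr_ge0 ?opnorm_ge0// divr_ge0 ?(ltW b0)//.
by rewrite (le_trans (opnorm_ge0 _) (opnorm_covariance_le_trace Z2)).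
Qed.

(* [W] is one plus the prior average of the exponential of the centred bilinear
   statistics; the Gibbs inequality turns it into a bound uniform over the unit balls. *)
Lemma deviation_le_log (beta s : R) : 1 <= beta -> 0 < s -> s <= 2^-1 ->
  let t := (2 * subg_const P X * radius X beta) * (2 * subg_const P Y * radius Y beta) in
  exists W : T -> R, [/\ measurable_fun setT W, forall w, 1 <= W w,
    (\int[P]_w (W w)%:E <= 2%:E)%E &
    forall w, opnorm (emp_dev P Xs Ys X Y w) <=
      16 / 7 * (t / (s * N%:R) * (16 * s ^+ 2 * N%:R + 2 * beta + ln (W w)))].
Proof.
move=> b1 s0 s2 t; have b0 : 0 < beta by rewrite (lt_le_trans ltr01).
have [I [theta [mu [mu0 mu1 smX]]]] := smoothing m b1.
have [J [eta [nu [nu0 nu1 smY]]]] := smoothing n b1.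
pose SX := cross_cov P X X; pose SY := cross_cov P Y Y.
pose rX := radius X beta; pose rY := radius Y beta.
have rX0 : 0 < rX by exact: radius_gt0.
have rY0 : 0 < rY by exact: radius_gt0.
have KX := subg_const_ge1 X2 X0 sX; have KY := subg_const_ge1 Y2 Y0 sY.
pose tX := 2 * subg_const P X * rX; pose tY := 2 * subg_const P Y * rY.
have tX0 : 0 < tX by rewrite !mulr_gt0// (lt_le_trans ltr01).
have tY0 : 0 < tY by rewrite !mulr_gt0// (lt_le_trans ltr01).
have tE : t = tX * tY by [].
have t0 : 0 < t by rewrite tE mulr_gt0.
(* Normalisation by the product of the subgaussian scales, so that the exponent seen by
   [emp_dev_mgf] is [s]. *)
pose l := s / t; have l0 : 0 < l by rewrite divr_gt0.
have lt_s : l * (tX * tY) = s by rewrite -tE divfK// gt_eqF.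
pose gX i := dot (theta i) (SX *m theta i) <= rX ^+ 2.
pose gY j := dot (eta j) (SY *m eta j) <= rY ^+ 2.
pose M w := emp_dev P Xs Ys X Y w.
(* The truncation multiplies the exponent rather than the exponential: a discarded pair contributes
   [expR 0 = 1]. The subtracted [16 * s ^+ 2 * N%:R] brings the mean for a kept pair below 1 as
   well. *)
pose F i j w := (gX i)%:R * (gY j)%:R *
  (l * N%:R * dot (theta i) (M w *m eta j) - 16 * s ^+ 2 * N%:R).
have mdot u v : measurable_fun setT (fun w => dot u (M w *m v)).
  rewrite (_ : (fun w => _) = fun w => \sum_k u k 0 * \sum_q M w k q * v q 0).
    apply: measurable_sum => k; apply: measurable_funM => //.
    apply: measurable_sum => q; apply: measurable_funM => //.
    exact: measurable_emp_dev.
  by apply/funext => w; apply: eq_bigr => k _; rewrite mxE.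
have mF i j : measurable_fun setT (fun w => expR (F i j w)).
  apply: measurableT_comp => //; apply: measurable_funM => //.
  by apply: measurable_funB => //; apply: measurable_funM.
have intF i j : (\int[P]_w (expR (F i j w))%:E <= 1%:E)%E.
  rewrite /F; case: (boolP (gX i && gY j)) => [/andP[gi gj]|]; last first.
    rewrite negb_and => /orP[] /negbTE ->.
      under eq_integral do rewrite !mul0r expR0.
      by rewrite integral_cst//= probability_setT mule1.
    under eq_integral do rewrite mulr0 mul0r expR0.
    by rewrite integral_cst//= probability_setT mule1.
  have H := @emp_dev_mgf (theta i) (eta j) tX tY l tX0 tY0
    (subgaussian_ip_expR X2 X0 sX rX0 gi) (subgaussian_ip_expR Y2 Y0 sY rY0 gj).
  rewrite lt_s (gtr0_norm l0) lt_s in H; move: (H s2) => {}H.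
  have [lG eG] := L1_ge0 (measurableT_comp (@measurable_expR R)
     (measurable_funM (measurable_cst (l * N%:R)) (mdot (theta i) (eta j))))
     (fun w => expR_ge0 _) H.
  rewrite (eq_integral (fun w => (expR (- (16 * s ^+ 2 * N%:R)) *
    expR (l * N%:R * dot (theta i) (M w *m eta j)))%:E)); last first.
    by move=> w _; rewrite gi gj mulr1 mul1r expRD mulrC.
  rewrite (integral_Ex (L1Z (expR (- (16 * s ^+ 2 * N%:R))) lG)) lee_fin ExZ//.
  by rewrite expRN ler_pdivrMl ?expR_gt0// mulr1.
(* The leading 1 makes [ln (W w)] nonnegative, at the cost of a mean of 2 instead of 1. *)
pose W w := 1 + \sum_i \sum_j mu i * nu j * expR (F i j w).
have Wge w : 1 <= W w.
  rewrite /W lerDl; apply: sumr_ge0 => i _; apply: sumr_ge0 => j _.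
  by rewrite !mulr_ge0 ?expR_ge0.
have lF i j : L1 P (fun w => expR (F i j w)) /\ Ex P (fun w => expR (F i j w)) <= 1.
  by apply: L1_ge0 => // w; exact: expR_ge0.
have lmF i j : L1 P (fun w => mu i * nu j * expR (F i j w)) by apply: L1Z; case: (lF i j).
have lS i : L1 P (fun w => \sum_j mu i * nu j * expR (F i j w)).
  by apply: L1_sum => j _; exact: lmF.
have lW : L1 P W.
  by apply: L1D; [exact: L1_cst|apply: L1_sum => i _; exact: lS].
exists W; split => //; first exact: L1_measurable lW.
  rewrite integral_Ex// lee_fin /W ExD ?Ex_cst; [|exact: L1_cst|by apply: L1_sum => i _; exact: lS].
  suff : Ex P (fun w => \sum_i \sum_j mu i * nu j * expR (F i j w)) <= 1 by lra.
  rewrite Ex_sum; last by move=> i _; exact: lS.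
  apply: (@le_trans _ _ (\sum_i \sum_j mu i * nu j)); last first.
    by under eq_bigr do rewrite -mulr_sumr nu1 mulr1; rewrite mu1.
  apply: ler_sum => i _; rewrite Ex_sum; last by move=> j _; exact: lmF.
  apply: ler_sum => j _; have [lFij eFij] := lF i j.
  by rewrite ExZ// ler_piMr// mulr_ge0.
move=> w; have N1 := N0'.
have c0 : 0 <= t / (s * N%:R) * (16 * s ^+ 2 * N%:R + 2 * beta + ln (W w)).
  rewrite mulr_ge0 ?divr_ge0 ?(ltW t0) ?mulr_ge0 ?(ltW s0) ?ler0n//.
  rewrite addr_ge0 ?ln_ge0//.
  have := sqr_ge0 s; have := ltW N1; have := ltW b0; nra.
apply: opnorm_le_approx => // u v u1 v1.
have [rho [L [[rho0 rho1] baryX quadX rmX LX]]] := smX _ u1.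
have [rho' [L' [[rho0' rho1'] baryY quadY rmY LY]]] := smY _ v1.
(* Truncated barycentres, left unnormalised: by bilinearity the statistic at this pair is the
   truncated average of the statistics, and the weight on the compensator is at most 1. *)
exists (\sum_i (rho i * (gX i)%:R) *: theta i), (\sum_j (rho' j * (gY j)%:R) *: eta j).
have usub k (Z : T -> 'cV[R]_k) z : vnorm z <= 1 ->
    dot z (cross_cov P Z Z *m z) <= opnorm (cross_cov P Z Z).
  move=> z1; rewrite (le_trans (covariance_quad_le _ _ _))// ler_piMr ?opnorm_ge0//.
  by rewrite expr_le1// vnorm_ge0.
split.
- apply: (truncated_barycentre (a := opnorm SX) b1 u1 rho0 baryX quadX) => //.
  + by move=> k; exact: covariance_diag_ge0.
  + by move=> x; exact: covariance_quad_ge0.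
  + exact: usub.
  + by rewrite exprn_gt0.
  + by rewrite radius_sqr.
- apply: (truncated_barycentre (a := opnorm SY) b1 v1 rho0' baryY quadY) => //.
  + by move=> k; exact: covariance_diag_ge0.
  + by move=> x; exact: covariance_quad_ge0.
  + exact: usub.
  + by rewrite exprn_gt0.
  + by rewrite radius_sqr.
set u' := \sum_i _; set v' := \sum_j _.
have G := Gibbs_product (fun i j => F i j w) rho0 rho1 rho0' rho1' rmX rmY.
have lnW : \sum_i \sum_j rho i * rho' j * F i j w - \sum_i rho i * L i
    - \sum_j rho' j * L' j <= ln (W w).
  rewrite -[leLHS]expRK ler_ln ?posrE ?expR_gt0 ?(lt_le_trans ltr01 (Wge w))//.
  by rewrite (le_trans G)// /W lerDr.
have Fsum : l * N%:R * dot u' (M w *m v') - 16 * s ^+ 2 * N%:R <=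
    \sum_i \sum_j rho i * rho' j * F i j w.
  have -> : \sum_i \sum_j rho i * rho' j * F i j w =
     l * N%:R * dot u' (M w *m v') -
     (16 * s ^+ 2 * N%:R) * \sum_i \sum_j (rho i * (gX i)%:R) * (rho' j * (gY j)%:R).
    rewrite /u' /v' dot_suml !mulr_sumr -sumrB; apply: eq_bigr => i _.
    rewrite mulmx_sumr dot_sumr !mulr_sumr -sumrB; apply: eq_bigr => j _.
    by rewrite -scalemxAr dotZl dotZr /F; ring.
  have sN0 : 0 <= 16 * s ^+ 2 * N%:R by have := sqr_ge0 s; have := ltW N1; nra.
  rewrite lerD2l lerN2 ler_piMr//.
  apply: (@le_trans _ _ (\sum_i \sum_j rho i * rho' j)); last first.
    by under eq_bigr do rewrite -mulr_sumr rho1' mulr1; rewrite rho1.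
  apply: ler_sum => i _; apply: ler_sum => j _; apply: ler_pM; rewrite ?mulr_ge0 ?ler0n//.
    by rewrite ler_piMr// lern1 leq_b1.
  by rewrite ler_piMr// lern1 leq_b1.
have -> : t / (s * N%:R) = (l * N%:R)^-1.
  by rewrite /l; field; rewrite !gt_eqF.
have lN0 : 0 < l * N%:R by rewrite mulr_gt0.
rewrite ler_pdivlMl//; lra.
Qed.

End upper.
End empirical_deviation.

(** * Arithmetic of the rate *)

Section rates.
Context {R : realType}.

(** With [q = Num.sqrt (beta / n)] the left side is [t * (16 * s + 4 * (q ^+ 2 / s))]. The balancing
    choice [s = q] is available only up to [2^-1]; beyond that, [q ^+ 2 / s = 2 * q ^+ 2] creates
    the second term. The factor [g] of [t] times [q] and times [q ^+ 2] gives the two summands of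
    the rate. *)
Lemma rate_bound (kX kY a b rX rY u n beta s t : R) : 0 <= kX -> 0 <= kY -> 0 < a -> 0 < b ->
  1 <= rX -> 1 <= rY -> 1 <= u -> 0 < n ->
  beta = Num.min rX rY + u -> s = Num.min 2^-1 (Num.sqrt (beta / n)) ->
  t = (2 * kX * Num.sqrt (32 * (a + rX * a / beta))) *
      (2 * kY * Num.sqrt (32 * (b + rY * b / beta))) ->
  t / (s * n) * (16 * s ^+ 2 * n + 4 * beta) <=
  (64 * 80) * kX * kY * Num.sqrt (a * b) *
    (Num.sqrt ((rX + rY + u) / n) + Num.sqrt ((rX + u) * (rY + u)) / n).
Proof.
move=> kX0 kY0 a0 b0 rX1 rY1 u1 n0 betaE sE tE0.
have beta_sym : (beta = rX + u /\ rX <= rY) \/ (beta = rY + u /\ rY <= rX).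
  by rewrite betaE; case: (leP rX rY) => h; [left|right; split => //; exact: ltW].
have be1 : 1 <= beta by case: beta_sym => -[? _]; lra.
have be0 : 0 < beta by lra.
pose q := Num.sqrt (beta / n).
have q0 : 0 < q by rewrite sqrtr_gt0 divr_gt0.
have q2 : q ^+ 2 = beta / n by rewrite sqr_sqrtr// divr_ge0// ltW.
have s0 : 0 < s by rewrite sE lt_min q0 invr_gt0 ltr0n.
have sq : s <= q by rewrite sE ge_min lexx orbT.
have q2s : q ^+ 2 / s <= 2 * q ^+ 2 + q.
  rewrite ler_pdivrMr// sE -/q; case: (leP 2^-1 q) => h.
    by have := sqr_ge0 q; nra.
  by rewrite expr2; nra.
pose g := Num.sqrt ((1 + rX / beta) * (1 + rY / beta)).
have gX : 0 <= 1 + rX / beta by rewrite addr_ge0// divr_ge0; lra.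
have gY : 0 <= 1 + rY / beta by rewrite addr_ge0// divr_ge0; lra.
have g2 : g ^+ 2 = (beta + rX) * (beta + rY) / beta ^+ 2.
  by rewrite sqr_sqrtr ?mulr_ge0//; field; rewrite gt_eqF.
have g0 : 0 <= g by rewrite sqrtr_ge0.
pose s0' := Num.sqrt (a * b).
have tE : t = 128 * kX * kY * s0' * g.
  have -> : 128 * kX * kY * s0' * g = (2 * kX) * (2 * kY) * (32 * (s0' * g)) by ring.
  rewrite tE0 mulrACA; congr (_ * _).
  rewrite -sqrtrM; last by rewrite !mulr_ge0 ?addr_ge0 ?mulr_ge0 ?invr_ge0 ?ler0n//; lra.
  rewrite /s0' /g -sqrtrM; last by rewrite mulr_ge0// ltW.
  have -> : 32 = Num.sqrt (32 ^+ 2) :> R by rewrite sqrtr_sqr ger0_norm.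
  rewrite -sqrtrM ?sqr_ge0//; congr Num.sqrt.
  rewrite sqrtr_sqr ger0_norm//; field; by rewrite gt_eqF.
have prod_le : (beta + rX) * (beta + rY) <= 2 * beta * (rX + rY + u).
  by case: beta_sym => -[-> h]; nra.
(* The minimum in [beta] matters here: [beta] is one factor on the right, and the other is at least
   half of [rX + rY + u] because it carries the larger rank. *)
have sum_le : beta * (rX + rY + u) <= 2 * ((rX + u) * (rY + u)).
  by case: beta_sym => -[-> h]; nra.
have gq : g * q <= 2 * Num.sqrt ((rX + rY + u) / n).
  rewrite -ler_sqr ?nnegrE ?mulr_ge0 ?sqrtr_ge0 ?(ltW q0)//.
  rewrite !exprMn q2 g2 sqr_sqrtr; last by rewrite divr_ge0 ?(ltW n0)//; lra.
  have -> : (beta + rX) * (beta + rY) / beta ^+ 2 * (beta / n) =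
    ((beta + rX) * (beta + rY) / beta) / n by field; rewrite !gt_eqF.
  rewrite mulrA ler_pM2r ?invr_gt0// ler_pdivrMr//; nra.
have gq2 : g * q ^+ 2 <= 2 * (Num.sqrt ((rX + u) * (rY + u)) / n).
  have h1 : 0 <= g * q ^+ 2 by rewrite mulr_ge0// sqr_ge0.
  have h2 : 0 <= 2 * (Num.sqrt ((rX + u) * (rY + u)) / n).
    by rewrite mulr_ge0// divr_ge0 ?sqrtr_ge0// ltW.
  rewrite -ler_sqr ?nnegrE//.
  rewrite exprMn g2 q2 [leRHS]exprMn [X in _ <= _ * X]exprMn sqr_sqrtr; last first.
    by rewrite mulr_ge0; lra.
  have -> : (beta + rX) * (beta + rY) / beta ^+ 2 * (beta / n) ^+ 2 =
    (beta + rX) * (beta + rY) * n^-1 ^+ 2 by field; rewrite !gt_eqF.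
  by rewrite [leRHS]mulrA ler_pM2r ?exprn_gt0 ?invr_gt0//; nra.
have -> : t / (s * n) * (16 * s ^+ 2 * n + 4 * beta) = t * (16 * s + 4 * (q ^+ 2 / s)).
  by rewrite q2; field; rewrite !gt_eqF.
have h : 16 * s + 4 * (q ^+ 2 / s) <= 20 * q + 8 * q ^+ 2 by lra.
have T0 : 0 <= 128 * kX * kY * s0' by rewrite !mulr_ge0 ?sqrtr_ge0.
apply: (@le_trans _ _ (t * (20 * q + 8 * q ^+ 2))).
  by rewrite ler_wpM2l// tE mulr_ge0.
rewrite tE -/s0'.
have -> : (64 * 80) * kX * kY * s0' = (128 * kX * kY * s0') * 40 by ring.
rewrite -!mulrA; do 4 (rewrite ler_wpM2l ?sqrtr_ge0//).
have := sqrtr_ge0 ((rX + u) * (rY + u)); have : 0 < n^-1 by rewrite invr_gt0.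
move=> ni0 sq0; have : 0 <= Num.sqrt ((rX + u) * (rY + u)) / n by rewrite mulr_ge0// ltW.
lra.
Qed.

Lemma rate_double (rX rY n : R) : 1 <= rX -> 1 <= rY -> 0 < n ->
  Num.sqrt ((rX + rY + 1) / n) + Num.sqrt ((rX + 1) * (rY + 1)) / n <=
  2 * (Num.sqrt ((rX + rY) / n) + Num.sqrt (rX * rY) / n).
Proof.
move=> rX1 rY1 n0.
have h1 : 0 <= (rX + rY + 1) / n by rewrite divr_ge0 ?(ltW n0)//; lra.
have h2 : 0 <= (rX + rY) / n by rewrite divr_ge0 ?(ltW n0)//; lra.
have h3 : 0 <= (rX + 1) * (rY + 1) by nra.
have h4 : 0 <= rX * rY by nra.
rewrite [leRHS]mulrDr; apply: lerD.
  rewrite -ler_sqr ?nnegrE ?mulr_ge0 ?sqrtr_ge0// exprMn !sqr_sqrtr//.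
  by rewrite [leRHS]mulrA ler_pM2r ?invr_gt0//; lra.
rewrite [leRHS]mulrA ler_pM2r ?invr_gt0//.
rewrite -ler_sqr ?nnegrE ?mulr_ge0 ?sqrtr_ge0// exprMn !sqr_sqrtr//.
nra.
Qed.

End rates.

Section upper_bounds.
Context {R : realType} {d : measure_display} {T : measurableType d}.
Variable P : probability T R.
Context (N m n : nat) (X : T -> 'cV[R]_m) (Y : T -> 'cV[R]_n).
Context (Xs : 'I_N -> T -> 'cV[R]_m) (Ys : 'I_N -> T -> 'cV[R]_n).
Hypothesis N0 : (1 <= N)%N.
Hypotheses (mXs : forall i, measurable_coords (Xs i)).
Hypotheses (mYs : forall i, measurable_coords (Ys i)).
Hypothesis lawXY : forall i, same_law P (Xs i) X (Ys i) Y.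
Hypothesis indepXY : indep_pairs P Xs Ys.
Hypotheses (X0 : cross_cov P X X != 0) (Y0 : cross_cov P Y Y != 0).
Hypotheses (sX : subgaussian P X) (sY : subgaussian P Y).

Let rX := eff_rank (cross_cov P X X).
Let rY := eff_rank (cross_cov P Y Y).
Let KX := subg_const P X.
Let KY := subg_const P Y.
Let sigma := Num.sqrt (opnorm (cross_cov P X X) * opnorm (cross_cov P Y Y)).
Let dev w := opnorm (emp_dev P Xs Ys X Y w).
Let rate u := Num.sqrt ((rX + rY + u) / N%:R) + Num.sqrt ((rX + u) * (rY + u)) / N%:R.

(** [rate_bound] is spent with [4 * beta] although the two entropies cost only [2 * beta]; the
    surplus is kept to offset [ln (W w)]. The constant [120 * 100] rounds up
    [16 / 7 * (64 * 80)]. *)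
Lemma deviation_le_rate u : 1 <= u -> exists W : T -> R,
  [/\ measurable_fun setT W, forall w, 1 <= W w, (\int[P]_w (W w)%:E <= 2%:E)%E &
  exists2 c : R, 0 <= c & exists2 beta, 1 + u <= beta &
    16 / 7 * (c * (4 * beta)) <= (120 * 100) * KX * KY * sigma * rate u /\
    forall w, dev w <= (120 * 100) * KX * KY * sigma * rate u +
      16 / 7 * (c * (ln (W w) - 2 * beta))].
Proof.
move=> u1; have [X2 _] := sX; have [Y2 _] := sY.
have N0' : 0 < N%:R :> R by rewrite ltr0n.
have rX1 := eff_rank_ge1 X2 X0; have rY1 := eff_rank_ge1 Y2 Y0.
have KX1 := subg_const_ge1 X2 X0 sX; have KY1 := subg_const_ge1 Y2 Y0 sY.
have a0 := opnorm_covariance_gt0 X0; have b0 := opnorm_covariance_gt0 Y0.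
pose beta := Num.min rX rY + u.
have bu : 1 + u <= beta by rewrite /beta lerD2r le_min /rX /rY rX1 rY1.
have be1 : 1 <= beta by lra.
have be0 : 0 < beta by lra.
pose s := Num.min 2^-1 (Num.sqrt (beta / N%:R)).
have s0 : 0 < s by rewrite lt_min invr_gt0 ltr0n sqrtr_gt0 divr_gt0.
have s2 : s <= 2^-1 by rewrite ge_min lexx.
have KX0 : 0 <= KX by rewrite /KX; lra.
have KY0 : 0 <= KY by rewrite /KY; lra.
have := @deviation_le_log _ _ _ P N m n X Y Xs Ys N0 X2 Y2 mXs mYs lawXY indepXY
  X0 Y0 sX sY beta s be1 s0 s2.
rewrite /= /radius !trace_eff_rank//; set t := (X in X / (s * _)).
move=> [W [mW W1 EW HW]]; exists W; split => //.
have B := rate_bound KX0 KY0 a0 b0 rX1 rY1 u1 N0' (erefl beta) (erefl s) (erefl t).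
rewrite -/rX -/rY -/sigma -/(rate u) in B.
have B0 : 0 <= KX * KY * sigma * rate u.
  have r0 : 0 <= rate u by rewrite addr_ge0 ?divr_ge0 ?sqrtr_ge0 ?ler0n.
  by rewrite !mulr_ge0 ?sqrtr_ge0.
have t0 : 0 <= t.
  rewrite /t mulr_ge0// mulr_ge0 ?sqrtr_ge0// mulr_ge0//.
pose c := t / (s * N%:R).
have c0 : 0 <= c by rewrite divr_ge0// mulr_ge0// ltW.
exists c => //; exists beta => //.
have sN : 0 <= 16 * s ^+ 2 * N%:R by rewrite mulr_ge0// mulr_ge0// sqr_ge0.
have E k : k * KX * KY * sigma * rate u = k * (KX * KY * sigma * rate u) by ring.
rewrite E in B; rewrite E -/c in B *.
split.
  have : c * (4 * beta) <= c * (16 * s ^+ 2 * N%:R + 4 * beta) by rewrite ler_wpM2l// lerDr.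
  by lra.
move=> w; rewrite (le_trans (HW w))// -/c.
have -> : c * (16 * s ^+ 2 * N%:R + 2 * beta + ln (W w)) =
   c * (16 * s ^+ 2 * N%:R + 4 * beta) + c * (ln (W w) - 2 * beta) by ring.
by lra.
Qed.

(** As [W] has mean at most [2 <= expR 1], it stays below [expR (1 + u)] off an event of probability
    at most [expR (- u)]; there [ln (W w) <= 1 + u <= 2 * beta], so the remainder is nonpositive. *)
Lemma deviation_tail u : 1 <= u ->
  ((1 - expR (- u))%:E <= P [set w | (dev w <= (120 * 100) * KX * KY * sigma * rate u)%R])%E.
Proof.
move=> u1; have [W [mW W1 EW [c c0 [beta bu [_ HW]]]]] := deviation_le_rate u1.
have [X2 _] := sX; have [Y2 _] := sY.
have mdev : measurable_fun setT dev by exact: measurable_dev.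
have := @Markov_compl _ _ _ P W (expR (1 + u)) (expR (- u)) mW
  (fun w => le_trans ler01 (W1 w)) (expR_gt0 _).
rewrite -expRD addrK => H; apply: le_trans (H _) _.
  by apply: le_trans EW _; rewrite lee_fin; have := @expR_ge1Dx R 1; lra.
have meas (f : T -> R) (b : bool) (e : R) : measurable_fun setT f ->
    measurable (f @^-1` [set` Interval -oo%O (BSide b e)]).
  by move=> mf; rewrite -[X in measurable X]setTI; exact: mf.
apply: le_measure; rewrite ?inE.
- rewrite (_ : [set w | _] = W @^-1` `]-oo, expR (1 + u)[); first exact: meas.
  by apply/seteqP; split => w /=; rewrite in_itv.
- set B := _ * rate u; rewrite (_ : [set w | _] = dev @^-1` `]-oo, B]); first exact: meas.
  by apply/seteqP; split => w /=; rewrite in_itv.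
move=> w /= Ww; rewrite (le_trans (HW w))// gerDl mulr_ge0_le0// mulr_ge0_le0//.
rewrite subr_le0 (@le_trans _ _ (1 + u))//; last by lra.
have Ww0 : 0 < W w by exact: lt_le_trans (W1 w).
rewrite -ler_expR lnK ?posrE//; exact: ltW.
Qed.

Let rate0 := Num.sqrt ((rX + rY) / N%:R) + Num.sqrt (rX * rY) / N%:R.

(** At [u = 1], bounding [ln (W w)] by [W w] makes the remainder linear in [W]; its mean is
    nonpositive because [W] has mean at most 2 and [2 <= beta]. *)
Lemma deviation_mean :
  (\int[P]_w (dev w)%:E <= ((240 * 100) * KX * KY * sigma * rate0)%:E)%E.
Proof.
have [W [mW W1 EW [c c0 [beta bu [Hc HW]]]]] := deviation_le_rate (lexx 1).
have [X2 _] := sX; have [Y2 _] := sY.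
have N0' : 0 < N%:R :> R by rewrite ltr0n.
have rX1 : 1 <= rX by exact: eff_rank_ge1.
have rY1 : 1 <= rY by exact: eff_rank_ge1.
have KX1 := subg_const_ge1 X2 X0 sX; have KY1 := subg_const_ge1 Y2 Y0 sY.
have mdev : measurable_fun setT dev by exact: measurable_dev.
have [lW eW] := L1_ge0 mW (fun w => le_trans ler01 (W1 w)) EW.
set B := (120 * 100) * KX * KY * sigma * rate 1 in Hc HW.
pose D w := B + 16 / 7 * (c * (W w - 2 * beta)).
have lD : L1 P D.
  apply: L1D; first exact: L1_cst.
  by apply: L1Z; apply: L1Z; apply: L1B => //; exact: L1_cst.
have devD w : dev w <= D w.
  apply: (le_trans (HW w)); rewrite lerD2l ler_wpM2l// ler_wpM2l// lerD2r.
  have W0 : 0 < W w by rewrite (lt_le_trans ltr01).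
  rewrite -ler_expR lnK ?posrE//.
  by have := expR_ge1Dx (W w); lra.
have BB : B <= (240 * 100) * KX * KY * sigma * rate0.
  have -> : B = (120 * 100) * KX * KY * sigma * rate 1 by [].
  have -> : (240 * 100) * KX * KY * sigma * rate0 = (120 * 100) * KX * KY * sigma * (2 * rate0) by ring.
  have c1 : 0 <= (120 * 100) * KX * KY * sigma.
    by rewrite !mulr_ge0 ?sqrtr_ge0// /KX /KY; lra.
  by rewrite ler_wpM2l//; exact: rate_double.
apply: (@le_trans _ _ (\int[P]_w (D w)%:E)%E).
  apply: ge0_le_integral => //.
  - by move=> w _; rewrite lee_fin; exact: opnorm_ge0.
  - exact/measurable_EFinP.
  - by apply/measurable_EFinP; exact: L1_measurable lD.
  - by move=> w _; rewrite lee_fin.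
rewrite integral_Ex// lee_fin (le_trans _ BB)// /D.
rewrite ExD ?Ex_cst ?ExZ; last first.
all: try (by apply: L1B => //; exact: L1_cst).
all: try (exact: L1_cst).
all: try (by apply: L1Z; apply: L1B => //; exact: L1_cst).
all: try (by apply: L1Z; apply: L1Z; apply: L1B => //; exact: L1_cst).
rewrite ExB ?Ex_cst//; last exact: L1_cst.
rewrite gerDl mulr_ge0_le0// mulr_ge0_le0//; lra.
Qed.

End upper_bounds.

(** * Gaussian moments *)

Section density.
Context {d : measure_display} {T : measurableType d} {R : realType}.
Variables (mu nu : {measure set T -> \bar R}) (g : T -> \bar R).
Hypothesis gfin : forall x, g x \is a fin_num.
Local Open Scope ereal_scope.
Hypotheses (mg : measurable_fun setT g) (g0 : forall x, 0 <= g x).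
Hypothesis nuE : forall A, measurable A -> nu A = \int[mu]_(x in A) g x.
Import HBNNSimple.

(** The density identity is given on sets only. It extends to simple functions by linearity and to
    nonnegative functions by monotone convergence on both sides. *)
Lemma integral_density (f : T -> \bar R) : measurable_fun setT f ->
  (forall x, 0 <= f x) -> \int[nu]_x f x = \int[mu]_x (f x * g x).
Proof.
move=> mf f0.
pose h := nnsfun_approx measurableT mf.
have hf x : (EFin \o h n) x @[n --> \oo] --> f x.
  by apply: (@cvg_nnsfun_approx _ _ _ _ measurableT _ mf).
have -> : \int[nu]_x f x = lim (\int[nu]_x (EFin \o h n) x @[n --> \oo]).
  rewrite -monotone_convergence//.
  - by apply: eq_integral => x _; apply/esym/cvg_lim => //; exact: hf.
  - by move=> n; apply/measurable_EFinP; exact: measurable_funP.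
  - by move=> n x _ /=; rewrite lee_fin.
  - by move=> x _ a b ab; rewrite lee_fin; exact/lefP/nd_nnsfun_approx.
have -> : \int[mu]_x (f x * g x) =
    lim (\int[mu]_x (((EFin \o h n) \* g) x) @[n --> \oo]).
  rewrite -monotone_convergence//.
  - apply: eq_integral => x _; apply/esym/cvg_lim => //.
    by apply: cvgeZr => //; exact: hf.
  - by move=> n; apply: emeasurable_funM => //; exact/measurable_EFinP.
  - by move=> n x _ /=; rewrite mule_ge0// lee_fin.
  - move=> x _ a b ab /=; apply: lee_wpmul2r; first exact: g0.
    by rewrite lee_fin; exact/lefP/nd_nnsfun_approx.
apply: congr_lim; apply/funext => n.
transitivity (\int[nu]_x
   (\sum_(y \in range (h n)) (y * \1_(h n @^-1` [set y]) x)%:E)).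
  by apply: eq_integral => t _; rewrite /= fimfunE -fsumEFin.
have indich r : measurable_fun setT (fun x => (r * \1_(h n @^-1` [set r]) x)%:E).
  by apply/measurable_EFinP; exact: measurable_funM.
rewrite ge0_integral_fsum//; last by move=> r x _; exact: nnfun_muleindic_ge0.
transitivity (\int[mu]_x (\sum_(y \in range (h n))
    (y * \1_(h n @^-1` [set y]) x)%:E * g x)); last first.
  apply: eq_integral => x _ /=.
  rewrite -ge0_mule_fsuml => [|y]; last exact: nnfun_muleindic_ge0.
  by rewrite fsumEFin // -(fimfunE _ x).
rewrite ge0_integral_fsum//; last 2 first.
- by move=> r; exact: emeasurable_funM.
- by move=> r x _; rewrite mule_ge0// nnfun_muleindic_ge0.
apply: eq_fsbigr => r rh.
have mA : measurable (h n @^-1` [set r]) by exact: measurable_funPTI.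
under [RHS]eq_integral do rewrite EFinM -muleA.
have r0 : (0 <= r)%R by move: rh; rewrite inE => -[x _ <-].
rewrite integralZl_indic_nnsfun//= integral_indic//= setIT.
rewrite ge0_integralZl_EFin//; last 2 first.
- by move=> x _; rewrite mule_ge0// lee_fin.
- by apply: emeasurable_funM => //; apply/measurable_EFinP; exact: measurable_indic.
rewrite nuE//; congr (_ * _); rewrite integral_mkcond.
apply: eq_integral => x _; rewrite patchE indicE.
by case: (x \in _); rewrite ?mul1e ?mul0e.
Qed.

End density.

Lemma integral_normal_prob {R : realType} (m s : R) (f : R -> R) :
  measurable_fun setT f -> (forall x, 0 <= f x) ->
  (\int[normal_prob m s]_x (f x)%:E =
   \int[@lebesgue_measure R]_x (f x * normal_pdf m s x)%:E)%E.
Proof.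
move=> mf f0; apply: (@integral_density _ _ _ (@lebesgue_measure R) (normal_prob m s)
  (fun x => (normal_pdf m s x)%:E) _ _ _ _ (fun x => (f x)%:E)) => //.
- by apply/measurable_EFinP; exact: measurable_normal_pdf.
- by move=> x; rewrite lee_fin normal_pdf_ge0.
- by apply/measurable_EFinP.
Qed.

Section gaussian_tilt.
Context {R : realType}.

(* Multiplying the centred normal density by the exponential of a multiple of
   [x ^ 2] rescales it; every Gaussian moment below is read off this identity. *)
Lemma normal_pdf_rescale (s c x : R) : 0 < s -> 0 < c ->
  expR ((1 - c ^- 2) * x ^+ 2 / (2 * s ^+ 2)) * normal_pdf 0 s x =
  c * normal_pdf 0 (c * s) x.
Proof.
move=> s0 c0; have cs0 : 0 < c * s by rewrite mulr_gt0.
have pk : normal_peak s = c * normal_peak (c * s).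
  rewrite /normal_peak (_ : (c * s) ^+ 2 * pi *+ 2 = c ^+ 2 * (s ^+ 2 * pi *+ 2)).
    by rewrite sqrtrM ?sqr_ge0// sqrtr_sqr gtr0_norm// invfM mulrA divff ?mul1r// gt_eqF.
  by ring.
rewrite !normal_pdfE ?gt_eqF// pk /normal_fun mulrCA -expRD [RHS]mulrA. congr (_ * expR _).
by rewrite !subr0; field; rewrite !gt_eqF.
Qed.

Lemma normal_pdf_shift (m s t x : R) : 0 < s ->
  expR (t * x) * normal_pdf m s x =
  expR (m * t + t ^+ 2 * s ^+ 2 / 2) * normal_pdf (m + t * s ^+ 2) s x.
Proof.
move=> s0; rewrite !normal_pdfE ?gt_eqF// /normal_fun.
rewrite mulrCA [RHS]mulrCA -!expRD; congr (_ * expR _).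
by field; rewrite !gt_eqF.
Qed.

Lemma normal_integral_rescale (s c : R) (f : R -> R) : 0 < s -> 0 < c ->
  measurable_fun setT f -> (forall x, 0 <= f x) ->
  (\int[normal_prob 0 s]_x (f x * expR ((1 - c ^- 2) * x ^+ 2 / (2 * s ^+ 2)))%:E =
   c%:E * \int[normal_prob 0 (c * s)]_x (f x)%:E)%E.
Proof.
move=> s0 c0 mf f0.
have me : measurable_fun setT (fun x : R => expR ((1 - c ^- 2) * x ^+ 2 / (2 * s ^+ 2))).
  apply: measurableT_comp => //; apply: measurable_funM => //.
  by apply: measurable_funM => //; exact: measurable_funX.
rewrite !integral_normal_prob//; last 2 first.
- exact: measurable_funM.
- by move=> x; rewrite mulr_ge0 ?expR_ge0.
rewrite -ge0_integralZl//; last 3 first.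
- apply/measurable_EFinP; apply: measurable_funM => //; exact: measurable_normal_pdf.
- by move=> x _; rewrite lee_fin mulr_ge0// normal_pdf_ge0.
- by rewrite lee_fin ltW.
apply: eq_integral => x _; rewrite -mulrA normal_pdf_rescale// -EFinM.
by congr EFin; ring.
Qed.

Lemma normal_prob_mass (m s : R) : (\int[normal_prob m s]_x (1 : R)%:E = 1%E)%E.
Proof. by rewrite integral_cst//= mul1e probability_setT. Qed.

Lemma normal_mgf (m s t : R) : 0 < s ->
  (\int[normal_prob m s]_x (expR (t * x))%:E =
   (expR (m * t + t ^+ 2 * s ^+ 2 / 2))%:E)%E.
Proof.
move=> s0; have me : measurable_fun setT (fun x : R => expR (t * x)).
  by apply: measurableT_comp => //; exact: measurable_funM.
rewrite integral_normal_prob//.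
under eq_integral do rewrite normal_pdf_shift// EFinM.
rewrite ge0_integralZl//; first by rewrite integral_normal_pdf mule1.
  by apply/measurable_EFinP; exact: measurable_normal_pdf.
by move=> x _; rewrite lee_fin normal_pdf_ge0.
Qed.

(** The rescaled density has total mass 1. Every [c > 0] is allowed, so the exponent takes both
    signs; this drives the moment computations. *)
Lemma normal_gauss_exp (s c : R) : 0 < s -> 0 < c ->
  (\int[normal_prob 0 s]_x (expR ((1 - c ^- 2) * x ^+ 2 / (2 * s ^+ 2)))%:E = c%:E)%E.
Proof.
move=> s0 c0.
have := @normal_integral_rescale s c (fun=> 1) s0 c0 (measurable_cst _) (fun=> ler01).
rewrite normal_prob_mass mule1 => <-.
by apply: eq_integral => x _; rewrite mul1r.
Qed.

End gaussian_tilt.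

Section normal_moments.
Context {R : realType}.
Local Notation nu s := (normal_prob (0 : R) s : probability (measurableTypeR R) R).

Section fixed_variance.
Variable s : R.
Hypothesis s0 : 0 < s.

Let q (c : R) := (1 - c ^- 2) / (2 * s ^+ 2).

Lemma normal_L1_expR_sqr c : 0 < c ->
  L1 (nu s) (fun x : R => expR (q c * x ^+ 2)) /\
  Ex (nu s) (fun x : R => expR (q c * x ^+ 2)) = c.
Proof.
move=> c0.
have E : (\int[nu s]_x (expR (q c * x ^+ 2))%:E = c%:E)%E.
  rewrite -[RHS](normal_gauss_exp s0 c0); apply: eq_integral => x _.
  by rewrite /q mulrAC.
have [l _] : L1 (nu s) (fun x : R => expR (q c * x ^+ 2)) /\
    Ex (nu s) (fun x : R => expR (q c * x ^+ 2)) <= c.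
  apply: L1_ge0 => [|x|]; last by rewrite E.
    by apply: measurableT_comp => //; apply: measurable_funM.
  exact: expR_ge0.
by split => //; apply: EFin_inj; rewrite -integral_Ex.
Qed.

Lemma normal_L1_pow4 : L1 (nu s) (fun x : R => x ^+ 4).
Proof.
have [l _] := normal_L1_expR_sqr (ltr0n R 2).
have q0 : 0 < q 2 by rewrite /q divr_gt0 ?mulr_gt0 ?exprn_gt0//; lra.
apply: (L1_le _ (L1Z (8 * (q 2) ^- 2) l)) => [|x]; first exact: measurable_funX.
rewrite ger0_norm; last by rewrite exprn_even_ge0.
have y0 : 0 <= q 2 * x ^+ 2 by rewrite mulr_ge0 ?sqr_ge0// ltW.
have h := sqr_le_expR y0.
have h2 : expR (q 2 * x ^+ 2 / 2) <= expR (q 2 * x ^+ 2) by rewrite ler_expR; lra.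
have -> : x ^+ 4 = q 2 ^- 2 * (q 2 * x ^+ 2) ^+ 2 by field; rewrite gt_eqF.
set E := expR (q 2 * x ^+ 2) in h2 *.
have -> : 8 * q 2 ^- 2 * E = q 2 ^- 2 * (8 * E) by ring.
by rewrite ler_wpM2l ?invr_ge0 ?sqr_ge0//; lra.
Qed.

Lemma normal_L1_sqr : L1 (nu s) (fun x : R => x ^+ 2).
Proof.
apply: L1_of_sqr; first exact: measurable_funX.
by apply: eq_L1 normal_L1_pow4 => x; rewrite -exprM.
Qed.

(** Tangency instead of differentiation: [1 + x <= expR x] turns the exact exponential moment into
    [1 + q c * v <= c] for all [c > 0], with equality at [c = 1]. Comparing [c] slightly above and
    slightly below 1 leaves only [v = s ^+ 2]. *)
Lemma normal_second_moment : Ex (nu s) (fun x : R => x ^+ 2) = s ^+ 2.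
Proof.
set v := Ex _ _.
have v0 : 0 <= v by apply: Ex_ge0 => x; rewrite sqr_ge0.
have s20 : 0 < s ^+ 2 by rewrite exprn_gt0.
have H c : 0 < c -> 1 + q c * v <= c.
  move=> c0; have [l e] := normal_L1_expR_sqr c0.
  rewrite -[leRHS]e -ExZ; last exact: normal_L1_sqr.
  rewrite -[X in X + _](Ex_cst (nu s) 1) -ExD; [|exact: L1_cst|by apply: L1Z; exact: normal_L1_sqr].
  apply: Ex_le => // [|x]; last exact: expR_ge1Dx.
  by apply: L1D; [exact: L1_cst|by apply: L1Z; exact: normal_L1_sqr].
pose k := v / s ^+ 2.
have k0 : 0 <= k by rewrite divr_ge0// ltW.
have vE : v = k * s ^+ 2 by rewrite /k divfK// gt_eqF.
suff k1 : k = 1 by rewrite vE k1 mul1r.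
have H' c : 0 < c -> (c - 1) * ((c + 1) * k) <= (c - 1) * (2 * c ^+ 2).
  move=> c0; have := H c c0.
  rewrite vE /q (_ : (1 - c ^- 2) / (2 * s ^+ 2) * (k * s ^+ 2) = (c - 1) * (c + 1) * k / (2 * c ^+ 2)).
    rewrite -lerBrDl ler_pdivrMr ?mulr_gt0 ?exprn_gt0//; lra.
  by field; rewrite !gt_eqF.
apply/eqP; rewrite eq_le; apply/andP; split; rewrite leNgt; apply/negP => hk.
  (* [h] is the supposed gap; [c = 1 + e] with [e] small against [h] contradicts the inequality at
     first order. *)
  pose h := k - 1; pose e := Num.min 1 (h / 4).
  have h0 : 0 < h by rewrite /h; lra.
  have e0 : 0 < e by rewrite lt_min ltr01 divr_gt0.
  have e1 : e <= 1 by rewrite ge_min lexx.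
  have eh : e <= h / 4 by rewrite ge_min lexx orbT.
  have := H' (1 + e); rewrite addr_gt0// => /(_ isT).
  rewrite (_ : 1 + e - 1 = e); last by ring.
  by rewrite ler_pM2l// (_ : k = 1 + h); [nra|rewrite /h; ring].
pose h := 1 - k; pose e := h / 4.
have h0 : 0 < h by rewrite /h; lra.
have h1 : h <= 1 by rewrite /h; lra.
have e0 : 0 < e by rewrite divr_gt0.
have eh : e = h / 4 by [].
have := H' (1 - e); rewrite (_ : 0 < 1 - e); last by lra.
move=> /(_ isT); rewrite (_ : 1 - e - 1 = - e); last by ring.
rewrite !mulNr lerN2 ler_pM2l// (_ : k = 1 - h); last by rewrite /h; ring.
nra.
Qed.

End fixed_variance.

(** The same tangency at [c = 1] with the weight [x ^+ 2]: rescaling makes the weighted exponential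
    moment [c * (c * s) ^+ 2], and the 3 is the logarithmic derivative of [c ^+ 3] at 1. *)
Lemma normal_fourth_moment s : 0 < s -> Ex (nu s) (fun x : R => x ^+ 4) = 3 * s ^+ 4.
Proof.
move=> s0; set v := Ex _ _.
have v0 : 0 <= v by apply: Ex_ge0 => x; rewrite exprn_even_ge0.
have s40 : 0 < s ^+ 4 by rewrite exprn_gt0.
pose q (c : R) := (1 - c ^- 2) / (2 * s ^+ 2).
have l2 := normal_L1_sqr s0; have l4 := normal_L1_pow4 s0.
have H c : 0 < c -> s ^+ 2 + q c * v <= c * (c * s) ^+ 2.
  move=> c0; have cs0 : 0 < c * s by rewrite mulr_gt0.
  have mx2 : measurable_fun setT (fun x : measurableTypeR R => x ^+ 2) by exact: measurable_funX.
  have E : (\int[nu s]_x (x ^+ 2 * expR (q c * x ^+ 2))%:E = (c * (c * s) ^+ 2)%:E)%E.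
    rewrite EFinM -(normal_second_moment cs0) -integral_Ex; last exact: normal_L1_sqr.
    transitivity (\int[nu s]_x (x ^+ 2 * expR ((1 - c ^- 2) * x ^+ 2 / (2 * s ^+ 2)))%:E)%E.
      by apply: eq_integral => x _; rewrite /q [_ * x ^+ 2 / _]mulrAC.
    by apply: (@normal_integral_rescale _ s c (fun x => x ^+ 2)) => // x; rewrite sqr_ge0.
  have [l e] : L1 (nu s) (fun x : R => x ^+ 2 * expR (q c * x ^+ 2)) /\
      Ex (nu s) (fun x : R => x ^+ 2 * expR (q c * x ^+ 2)) <= c * (c * s) ^+ 2.
    apply: L1_ge0 => [|x|]; last by rewrite E.
      apply: measurable_funM => //; apply: measurableT_comp => //.
      exact: measurable_funM.
    by rewrite mulr_ge0 ?sqr_ge0 ?expR_ge0.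
  apply: le_trans e; rewrite -(normal_second_moment s0) -ExZ// -ExD//; last exact: L1Z.
  apply: Ex_le => // [|x]; first by apply: L1D => //; exact: L1Z.
  rewrite (_ : x ^+ 2 + q c * x ^+ 4 = x ^+ 2 * (1 + q c * x ^+ 2)); last by ring.
  by rewrite ler_wpM2l ?sqr_ge0// expR_ge1Dx.
pose k := v / s ^+ 4.
have k0 : 0 <= k by rewrite divr_ge0// ltW.
have vE : v = k * s ^+ 4 by rewrite /k divfK// gt_eqF.
suff k3 : k = 3 by rewrite vE k3.
have H' c : 0 < c ->
    (c - 1) * ((c + 1) * k) <= (c - 1) * (2 * (c ^+ 2 + c + 1) * c ^+ 2).
  move=> c0; have := H c c0.
  rewrite vE /q (_ : (1 - c ^- 2) / (2 * s ^+ 2) * (k * s ^+ 4) =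
    ((c - 1) * (c + 1) * k) * s ^+ 2 / (2 * c ^+ 2)); last by field; rewrite !gt_eqF.
  rewrite -lerBrDl ler_pdivrMr ?mulr_gt0 ?exprn_gt0//.
  rewrite (_ : (c * (c * s) ^+ 2 - s ^+ 2) * (2 * c ^+ 2) =
    ((c - 1) * (2 * (c ^+ 2 + c + 1) * c ^+ 2)) * s ^+ 2); last by ring.
  by rewrite ler_pM2r ?exprn_gt0// mulrA.
apply/eqP; rewrite eq_le; apply/andP; split; rewrite leNgt; apply/negP => hk.
  pose h := k - 3; pose e := Num.min 1 (h / 50).
  have h0 : 0 < h by rewrite /h; lra.
  have e0 : 0 < e by rewrite lt_min ltr01 divr_gt0.
  have e1 : e <= 1 by rewrite ge_min lexx.
  have eh : e <= h / 50 by rewrite ge_min lexx orbT.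
  have := H' (1 + e); rewrite addr_gt0// => /(_ isT).
  rewrite (_ : 1 + e - 1 = e); last by ring.
  rewrite ler_pM2l// (_ : k = 3 + h); last by rewrite /h; ring.
  have a1 : (1 + e) ^+ 2 <= 1 + 3 * e by nra.
  have a2 : (1 + e) ^+ 2 + (1 + e) + 1 <= 3 + 4 * e by nra.
  have a3 : ((1 + e) ^+ 2 + (1 + e) + 1) * (1 + e) ^+ 2 <= (3 + 4 * e) * (1 + 3 * e).
    by apply: ler_pM => //; rewrite ?sqr_ge0//; have := sqr_ge0 (1 + e); lra.
  nra.
pose h := 3 - k; pose e := h / 10.
have h0 : 0 < h by rewrite /h; lra.
have h1 : h <= 3 by rewrite /h; lra.
have e0 : 0 < e by rewrite divr_gt0.
have eh : e = h / 10 by [].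
have e1 : 0 < 1 - e by lra.
have := H' (1 - e) e1; rewrite (_ : 1 - e - 1 = - e); last by ring.
rewrite !mulNr lerN2 ler_pM2l// (_ : k = 3 - h); last by rewrite /h; ring.
have a1 : 1 - 2 * e <= (1 - e) ^+ 2 by nra.
have a2 : 3 - 3 * e <= (1 - e) ^+ 2 + (1 - e) + 1 by nra.
have a3 : (3 - 3 * e) * (1 - 2 * e) <= ((1 - e) ^+ 2 + (1 - e) + 1) * (1 - e) ^+ 2.
  by apply: ler_pM => //; lra.
nra.
Qed.

(** Peak density times length [s / 2]; the claim amounts to [2 <= Num.sqrt (2 * pi)], which follows
    from [2 <= pi]. *)
Lemma normal_small_ball s : 0 < s ->
  (normal_prob (0 : R) s `[(- (s / 4))%R, (s / 4)%R] <= (4^-1)%:E)%E.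
Proof.
move=> s0; rewrite /normal_prob.
apply: (@le_trans _ _ (\int[@lebesgue_measure R]_(x in `[(- (s / 4))%R, (s / 4)%R]) (normal_peak s)%:E)%E).
  apply: ge0_le_integral => //.
  - by move=> x _; rewrite lee_fin normal_pdf_ge0.
  - by apply/measurable_EFinP/measurable_funTS; exact: measurable_normal_pdf.
  - by move=> x _; rewrite lee_fin normal_pdf_ub// gt_eqF.
rewrite integral_cst//= lebesgue_measure_itv/= lte_fin.
rewrite (_ : - (s / 4) < s / 4) ?lte_fin; last by lra.
rewrite -EFinD -EFinM lee_fin opprK (_ : s / 4 + s / 4 = s / 2); last by field.
rewrite /normal_peak ler_pdivrMl; last first.
  by rewrite sqrtr_gt0 pmulrn_lgt0// mulr_gt0 ?exprn_gt0// pi_gt0.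
suff : 2 * s <= Num.sqrt (s ^+ 2 * pi *+ 2) by lra.
rewrite -[leLHS]ger0_norm; last by lra.
rewrite -sqrtr_sqr ler_wsqrtr// exprMn -mulr_natr.
have := pi_ge2 R; have := sqr_ge0 s; nra.
Qed.

End normal_moments.

(** * Centred Gaussian random variables *)

Section gaussian_variables.
Context {R : realType} {d : measure_display} {T : measurableType d}.
Variable P : probability T R.

Section nondegenerate.
Context (Z : T -> R) (m s : R).
Hypotheses (s0 : 0 < s) (mZ : measurable_fun setT Z).
Hypothesis lawZ : forall B : set R, measurable B -> P (Z @^-1` B) = normal_prob m s B.

Lemma gaussian_integral (f : R -> R) : measurable_fun setT f -> (forall x, 0 <= f x) ->
  (\int[P]_w (f (Z w))%:E = \int[normal_prob m s]_x (f x)%:E)%E.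
Proof.
move=> mf f0.
have mZ' : @measurable_fun _ _ T (measurableTypeR R) setT Z by exact: mZ.
pose Z' : {mfun T >-> measurableTypeR R} :=
  HB.pack Z (isMeasurableFun.Build _ _ T (measurableTypeR R) Z mZ').
transitivity (\int[distribution P Z']_x (f x)%:E)%E.
  rewrite ge0_integral_distribution//; first exact/measurable_EFinP.
apply: eq_measure_integral => A mA _; exact: lawZ.
Qed.

(** The exponential moment at [t] is at least [1 + t * Ex P Z = 1], so [m * t + t ^+ 2 * s ^+ 2 / 2]
    is nonnegative for all [t]; its minimum is [- m ^+ 2 / (2 * s ^+ 2)]. *)
Lemma gaussian_centered : L1 P Z -> Ex P Z = 0 -> m = 0.
Proof.
move=> lZ eZ; have H t : 0 <= m * t + t ^+ 2 * s ^+ 2 / 2.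
  have me : measurable_fun setT (fun x : R => expR (t * x)).
    by apply: measurableT_comp => //; exact: measurable_funM.
  have E := gaussian_integral me (fun x => expR_ge0 _).
  rewrite normal_mgf// in E.
  have [l e] : L1 P (fun w => expR (t * Z w)) /\
      Ex P (fun w => expR (t * Z w)) <= expR (m * t + t ^+ 2 * s ^+ 2 / 2).
    apply: L1_ge0 => [|w|]; [exact: (measurableT_comp me mZ)|exact: expR_ge0|].
    by rewrite E.
  rewrite -ler_expR expR0; apply: le_trans e.
  have -> : 1 = Ex P (fun w => 1 + t * Z w).
    by rewrite ExD ?Ex_cst ?ExZ ?eZ ?mulr0 ?addr0//; [exact: L1_cst|exact: L1Z].
  apply: Ex_le => // [|w]; last exact: expR_ge1Dx.
  by apply: L1D; [exact: L1_cst|exact: L1Z].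
have := H (- m / s ^+ 2).
rewrite (_ : m * (- m / s ^+ 2) + (- m / s ^+ 2) ^+ 2 * s ^+ 2 / 2 =
  - (m ^+ 2 / (2 * s ^+ 2))); last by field; rewrite gt_eqF.
rewrite oppr_ge0 pmulr_lle0 ?invr_gt0 ?mulr_gt0 ?exprn_gt0// => h.
by apply/eqP; rewrite -sqrf_eq0 eq_le h sqr_ge0.
Qed.

End nondegenerate.

Context (Z : T -> R).
Hypotheses (gZ : gaussian_rv P Z) (l2 : L1 P (fun w => Z w ^+ 2)) (eZ : Ex P Z = 0).

Let mZ : measurable_fun setT Z. Proof. by case: gZ. Qed.
Let lZ : L1 P Z. Proof. exact: L1_of_sqr. Qed.

(** [gaussian_rv] admits point masses, as singular covariances require. Both alternatives come with
    a rule for integrating nonnegative functions, so later moment bounds treat them in parallel. *)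
Lemma gaussian_cases :
  (Ex P (fun w => Z w ^+ 2) = 0 /\ forall f : R -> R, measurable_fun setT f ->
     (forall x, 0 <= f x) -> (\int[P]_w (f (Z w))%:E = (f 0)%:E)%E) \/
  exists2 s, 0 < s & [/\ Ex P (fun w => Z w ^+ 2) = s ^+ 2,
    (forall B : set R, measurable B -> P (Z @^-1` B) = normal_prob 0 s B) &
    forall f : R -> R, measurable_fun setT f -> (forall x, 0 <= f x) ->
     (\int[P]_w (f (Z w))%:E = \int[normal_prob 0 s]_x (f x)%:E)%E].
Proof.
case: gZ => _ [m [s [s0 lawZ]]].
move: s0; rewrite le_eqVlt => /predU1P[s0|s0].
  left; rewrite -s0 eqxx in lawZ.
  have I (f : R -> R) : measurable_fun setT f -> (forall x, 0 <= f x) ->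
      (\int[P]_w (f (Z w))%:E = (f m)%:E)%E.
    move=> mf f0.
    pose Z' : {mfun T >-> R} := HB.pack Z (isMeasurableFun.Build _ _ _ _ Z mZ).
    transitivity (\int[distribution P Z']_x (f x)%:E)%E.
      rewrite ge0_integral_distribution//; first exact/measurable_EFinP.
    transitivity (\int[dirac m]_x (f x)%:E)%E.
      by apply: eq_measure_integral => A mA _; exact: lawZ.
    rewrite integral_dirac//=; last exact/measurable_EFinP.
    by rewrite diracT mul1e.
  (* Centring expands the second moment of [Z - m] to [m ^+ 2 + m ^+ 2], while the point mass makes
     it 0. *)
  have m0 : m = 0.
    have h1 : Ex P (fun w => Z w ^+ 2) = m ^+ 2.
      by rewrite /Ex (I (fun x => x ^+ 2))// => x; rewrite sqr_ge0.
    have h2 : Ex P (fun w => (Z w - m) ^+ 2) = 0.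
      rewrite /Ex (I (fun x => (x - m) ^+ 2)) => [||x]; rewrite ?sqr_ge0//.
        by rewrite subrr expr0n.
      by apply: measurable_funX; exact: measurable_funB.
    have h3 : Ex P (fun w => (Z w - m) ^+ 2) = m ^+ 2 + m ^+ 2.
      rewrite -{1}h1 -(Ex_cst P (m ^+ 2)).
      rewrite -[RHS]addr0 -(mulr0 (- 2 * m)) -eZ -ExZ// -!ExD//; last first.
      all: try exact: L1_cst.
      all: try exact: L1Z.
      - by apply: L1D => //; exact: L1_cst.
      - by apply: eq_Ex => w; ring.
    have := sqr_ge0 m; rewrite h2 in h3 => h4.
    by apply/eqP; rewrite -sqrf_eq0; apply/eqP; lra.
  rewrite m0 in I; split => //.
  by rewrite /Ex (I (fun x => x ^+ 2)) ?expr0n// => x; rewrite sqr_ge0.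
right; exists s => //; rewrite gt_eqF// in lawZ.
have m0 := gaussian_centered s0 mZ lawZ lZ eZ.
rewrite m0 in lawZ.
have I := gaussian_integral mZ lawZ.
split => //; rewrite -(normal_second_moment s0) /Ex.
by rewrite (I (fun x => x ^+ 2))// => x; rewrite sqr_ge0.
Qed.

Let v := Ex P (fun w => Z w ^+ 2).

Lemma gaussian_fourth_moment :
  L1 P (fun w => Z w ^+ 4) /\ Ex P (fun w => Z w ^+ 4) = 3 * v ^+ 2.
Proof.
have m4 : measurable_fun setT (fun x : R => x ^+ 4) by exact: measurable_funX.
have p4 (x : R) : 0 <= x ^+ 4 by rewrite exprn_even_ge0.
have E : (\int[P]_w (Z w ^+ 4)%:E = (3 * v ^+ 2)%:E)%E.
  rewrite /v; case: gaussian_cases => [[-> I]|[s s0 [-> _ I]]].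
    by rewrite (I (fun x => x ^+ 4))// !expr0n/= mulr0.
  rewrite (I (fun x => x ^+ 4))// integral_Ex; last exact: normal_L1_pow4.
  by rewrite normal_fourth_moment// -exprM.
have [l _] : L1 P (fun w => Z w ^+ 4) /\ Ex P (fun w => Z w ^+ 4) <= 3 * v ^+ 2.
  by apply: L1_ge0 => [|w|]; [exact: measurable_funX|exact: p4|rewrite E].
by split => //; apply: EFin_inj; rewrite -integral_Ex.
Qed.

(** The identity of [normal_gauss_exp] at [c = 2] has value exactly 2 and exponent
    [x ^+ 2 / (8 / 3 * s ^+ 2)], and [8 / 3 <= 4]. *)
Lemma gaussian_expR_sqr (t : R) : 0 < t -> 4 * v <= t ^+ 2 ->
  (\int[P]_w (expR (Z w ^+ 2 / t ^+ 2))%:E <= 2%:E)%E.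
Proof.
move=> t0 vt; pose f (x : R) := expR (x ^+ 2 / t ^+ 2).
have mf : measurable_fun setT f.
  by apply: measurableT_comp => //; apply: measurable_funM => //; exact: measurable_funX.
have f0 x : 0 <= f x by exact: expR_ge0.
move: vt; rewrite /v -/(f _).
case: gaussian_cases => [[-> I]|[s s0 [-> _ I]]] vt.
  by rewrite (I f)// /f expr0n/= mul0r expR0 lee_fin ler1n.
rewrite (I f)// -(normal_gauss_exp s0 (ltr0n R 2)).
have me : measurable_fun setT (fun x : R => expR ((1 - 2 ^- 2) * x ^+ 2 / (2 * s ^+ 2))).
  apply: measurableT_comp => //; apply: measurable_funM => //.
  by apply: measurable_funM => //; exact: measurable_funX.
apply: ge0_le_integral => //.
- by move=> x _; rewrite lee_fin.
- by apply/measurable_EFinP.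
- exact/measurable_EFinP.
move=> x _; rewrite lee_fin ler_expR.
have s20 : 0 < s ^+ 2 by rewrite exprn_gt0.
have -> : (1 - 2 ^- 2) * x ^+ 2 / (2 * s ^+ 2) = x ^+ 2 / (8 / 3 * s ^+ 2) :> R.
  by field; rewrite gt_eqF.
rewrite ler_wpM2l ?sqr_ge0// lef_pV2 ?posrE ?exprn_gt0 ?mulr_gt0//.
by rewrite (le_trans _ vt)//; lra.
Qed.

Lemma gaussian_psi2norm : (psi2norm P Z <= (2 * L2norm P Z)%:E)%E.
Proof.
(* At zero variance every positive parameter is admissible and the infimum 0 is only approached. *)
have [v0|v0] := eqVneq v 0.
  rewrite /L2norm -/v v0 sqrtr0 mulr0; apply/lee_addgt0Pr => e e0.
  rewrite add0e; apply: ereal_inf_lbound; exists e => //; split => //.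
  by apply: gaussian_expR_sqr => //; rewrite v0 mulr0 sqr_ge0.
have v1 : 0 < v by rewrite lt_def v0; apply: Ex_ge0 => w; rewrite sqr_ge0.
have t0 : 0 < 2 * L2norm P Z by rewrite mulr_gt0// sqrtr_gt0.
apply: ereal_inf_lbound; exists (2 * L2norm P Z) => //; split => //.
apply: gaussian_expR_sqr => //.
by rewrite exprMn /L2norm -/v sqr_sqrtr ?(ltW v1)//; lra.
Qed.

Lemma gaussian_small_ball : 0 < v ->
  (P [set w | (`|Z w| <= Num.sqrt v / 4)%R] <= (4^-1)%:E)%E.
Proof.
rewrite /v; case: gaussian_cases => [[-> _]|[s s0 [-> lawZ _]]]; first by rewrite ltxx.
move=> _; rewrite sqrtr_sqr gtr0_norm//.
apply: le_trans (normal_small_ball s0); rewrite -lawZ; last exact: measurable_itv.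
rewrite le_eqVlt; apply/orP; left; apply/eqP; congr (P _).
by apply/seteqP; split => w /=; rewrite in_itv/= ler_norml.
Qed.

End gaussian_variables.

(** * Lower bound for Gaussian pairs *)

Section small_ball_arithmetic.
Context {R : realType}.

Lemma small_ball_mean_ge (c p q : R) : 0 < c -> p <= 4^-1 -> q <= 4^-1 ->
  c / 32 <= c / 16 * (1 - (p + q)).
Proof. by move=> c0 p4 q4; nra. Qed.

(** A union bound in pointwise form: unless a factor is small the product exceeds [a * b / 16], and
    otherwise the left side is nonpositive. No joint law is needed after integration. *)
Lemma small_ball_product_le (a b x y : R) : 0 < a -> 0 < b -> 0 <= x -> 0 <= y ->
  a * b / 16 * (1 - ((x <= a / 4)%R%:R + (y <= b / 4)%R%:R)) <= x * y.
Proof.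
move=> a0 b0 x0 y0; have ab0 : 0 < a * b by rewrite mulr_gt0.
have xy0 : 0 <= x * y by rewrite mulr_ge0.
case: (leP x (a / 4)) => h1 /=.
  by apply: (le_trans _ xy0); case: (y <= b / 4) => /=; lra.
case: (leP y (b / 4)) => h2 /=; first by apply: (le_trans _ xy0); lra.
rewrite (_ : a * b / 16 * (1 - (0 + 0)) = (a / 4) * (b / 4)); last by field.
by apply: ler_pM; rewrite ?divr_ge0 ?ltW.
Qed.

End small_ball_arithmetic.

Section gaussian_pair.
Context {R : realType} {d : measure_display} {T : measurableType d}.
Variable P : probability T R.
Context (xi eta : T -> R).
Hypothesis gauss : forall a b : R, gaussian_rv P (fun w => a * xi w + b * eta w).
Hypotheses (lx : L1 P (fun w => xi w ^+ 2)) (ly : L1 P (fun w => eta w ^+ 2)).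
Hypotheses (ex : Ex P xi = 0) (ey : Ex P eta = 0).

Let gx : gaussian_rv P xi.
Proof. by move: (gauss 1 0); congr gaussian_rv; apply/funext => w; ring. Qed.

Let gy : gaussian_rv P eta.
Proof. by move: (gauss 0 1); congr gaussian_rv; apply/funext => w; ring. Qed.

Let mx : measurable_fun setT xi. Proof. by case: gx. Qed.
Let my : measurable_fun setT eta. Proof. by case: gy. Qed.
Let l1x : L1 P xi. Proof. exact: L1_of_sqr. Qed.
Let l1y : L1 P eta. Proof. exact: L1_of_sqr. Qed.
Let lxy : L1 P (fun w => xi w * eta w). Proof. exact: L1M. Qed.

Let vx := Ex P (fun w => xi w ^+ 2).
Let vy := Ex P (fun w => eta w ^+ 2).
Let rho := Ex P (fun w => xi w * eta w).

Let vx0 : 0 <= vx. Proof. by apply: Ex_ge0 => w; rewrite sqr_ge0. Qed.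
Let vy0 : 0 <= vy. Proof. by apply: Ex_ge0 => w; rewrite sqr_ge0. Qed.

Let combination (b : R) :
  [/\ L1 P (fun w => (xi w + b * eta w) ^+ 4) &
   Ex P (fun w => (xi w + b * eta w) ^+ 4) = 3 * (vx + 2 * b * rho + b ^+ 2 * vy) ^+ 2].
Proof.
have g : gaussian_rv P (fun w => xi w + b * eta w).
  by move: (gauss 1 b); congr gaussian_rv; apply/funext => w; rewrite mul1r.
have lb : L1 P (fun w => b * eta w) by exact: L1Z.
have l2 : L1 P (fun w => (xi w + b * eta w) ^+ 2).
  apply: L1_sqrD => //; first exact: measurable_funM.
  exact: L1_sqrZ.
have e0 : Ex P (fun w => xi w + b * eta w) = 0 by rewrite ExD// ExZ// ex ey mulr0 addr0.
have [l e] := gaussian_fourth_moment g l2 e0.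
split => //; rewrite e; congr (3 * _ ^+ 2).
have E w : (xi w + b * eta w) ^+ 2 =
    xi w ^+ 2 + 2 * b * (xi w * eta w) + b ^+ 2 * eta w ^+ 2 by ring.
rewrite (eq_Ex P E) ExD; [|by apply: L1D => //; exact: L1Z|exact: L1Z].
by rewrite ExD ?ExZ//; exact: L1Z.
Qed.

(* Polarisation reduces the mixed moment to fourth moments of one-dimensional marginals. *)
Lemma gaussian_product_sqr : L1 P (fun w => (xi w * eta w) ^+ 2) /\
  Ex P (fun w => (xi w * eta w) ^+ 2) = vx * vy + 2 * rho ^+ 2.
Proof.
have [lp ep] := combination 1; have [lm em] := combination (-1).
have [l4x e4x] := gaussian_fourth_moment gx lx ex.
have [l4y e4y] := gaussian_fourth_moment gy ly ey.
have E w : (xi w * eta w) ^+ 2 = 12^-1 * (((xi w + 1 * eta w) ^+ 4 + (xi w + -1 * eta w) ^+ 4)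
    - 2 * (xi w ^+ 4 + eta w ^+ 4)) by field.
have lA : L1 P (fun w => (xi w + 1 * eta w) ^+ 4 + (xi w + -1 * eta w) ^+ 4) by exact: L1D.
have lB : L1 P (fun w => 2 * (xi w ^+ 4 + eta w ^+ 4)) by apply: L1Z; exact: L1D.
split; first by apply: (eq_L1 (fun w => esym (E w))); apply: L1Z; exact: L1B.
rewrite (eq_Ex P E) ExZ ?ExB//; last exact: L1B.
rewrite ExD// ExZ ?ExD//; last exact: L1D.
by rewrite ep em e4x e4y -/vx -/vy; field.
Qed.

(** The variance is [vx * vy + rho ^+ 2]; correlation can only increase it. *)
Lemma gaussian_product_variance : L1 P (fun w => (xi w * eta w - rho) ^+ 2) /\
  vx * vy <= Ex P (fun w => (xi w * eta w - rho) ^+ 2).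
Proof.
have [l e] := gaussian_product_sqr.
have E w : (xi w * eta w - rho) ^+ 2 = (xi w * eta w) ^+ 2 - 2 * rho * (xi w * eta w) + rho ^+ 2.
  by ring.
have l1 : L1 P (fun w => (xi w * eta w) ^+ 2 - 2 * rho * (xi w * eta w)).
  by apply: L1B => //; exact: L1Z.
split; first by apply: (eq_L1 (fun w => esym (E w))); apply: L1D => //; exact: L1_cst.
rewrite (eq_Ex P E) ExD ?Ex_cst ?ExB ?ExZ//; [|exact: L1Z|exact: L1_cst].
by rewrite e -/rho; have := sqr_ge0 rho; lra.
Qed.

Let Ex_small (Z : T -> R) (a : R) : measurable_fun setT Z ->
  (P [set w | (`|Z w| <= a)%R] <= (4^-1)%:E)%E ->
  L1 P (fun w => (`|Z w| <= a)%R%:R) /\ Ex P (fun w => (`|Z w| <= a)%R%:R) <= 4^-1.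
Proof.
move=> mZ h; set A := [set w | _] in h.
have mA : measurable A.
  rewrite (_ : A = (fun w => `|Z w|) @^-1` `]-oo, a]).
    have mn : measurable_fun setT (fun w => `|Z w|) by exact: measurableT_comp.
    by rewrite -[X in measurable X]setTI; exact: mn.
  by apply/seteqP; split => w /=; rewrite in_itv.
have E w : (`|Z w| <= a)%R%:R = \1_A w :> R.
  by rewrite indicE; congr ((nat_of_bool _)%:R); apply/idP/idP; rewrite inE.
have l : L1 P (\1_A : T -> R).
  apply: (@L1_bounded _ _ _ _ _ 1) => [|w]; first exact: measurable_indic.
  by rewrite indicE; case: (_ \in _); rewrite ?normr1 ?normr0.
split; first by apply: (eq_L1 (fun w => esym (E w))).
by rewrite (eq_Ex P E) -lee_fin -integral_Ex// integral_indic//= setIT.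
Qed.

(** Each factor is below a quarter of its standard deviation with probability at most [4^-1]; hence
    [1 / 16] times the remaining probability [1 / 2], for any correlation. *)
Lemma gaussian_abs_product : L1 P (fun w => `|xi w| * `|eta w|) /\
  Num.sqrt vx * Num.sqrt vy / 32 <= Ex P (fun w => `|xi w| * `|eta w|).
Proof.
have l : L1 P (fun w => `|xi w| * `|eta w|).
  by apply: (eq_L1 (f := fun w => `|xi w * eta w|)) => [w|]; [rewrite normrM|exact: L1_norm].
split => //.
have E0 : 0 <= Ex P (fun w => `|xi w| * `|eta w|) by apply: Ex_ge0 => w; rewrite mulr_ge0.
have [vx1|vx1] := eqVneq vx 0; first by rewrite vx1 sqrtr0 !mul0r.
have [vy1|vy1] := eqVneq vy 0; first by rewrite vy1 sqrtr0 mulr0 mul0r.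
have vxp : 0 < vx by rewrite lt_def vx1 vx0.
have vyp : 0 < vy by rewrite lt_def vy1 vy0.
pose a := Num.sqrt vx; pose b := Num.sqrt vy.
have a0 : 0 < a by rewrite sqrtr_gt0.
have b0 : 0 < b by rewrite sqrtr_gt0.
pose I1 w : R := (`|xi w| <= a / 4)%R%:R; pose I2 w : R := (`|eta w| <= b / 4)%R%:R.
have [lA eA] : L1 P I1 /\ Ex P I1 <= 4^-1.
  exact: Ex_small mx (gaussian_small_ball gx lx ex vxp).
have [lB eB] : L1 P I2 /\ Ex P I2 <= 4^-1.
  exact: Ex_small my (gaussian_small_ball gy ly ey vyp).
have ab0 : 0 < a * b by rewrite mulr_gt0.
pose F w := a * b / 16 * (1 - (I1 w + I2 w)).
have lF : L1 P F by apply: L1Z; apply: L1B; [exact: L1_cst|exact: L1D].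
have FE : Ex P F = a * b / 16 * (1 - (Ex P I1 + Ex P I2)).
  rewrite ExZ; last by apply: L1B; [exact: L1_cst|exact: L1D].
  by rewrite ExB; [rewrite Ex_cst ExD|exact: L1_cst|exact: L1D].
apply: (@le_trans _ _ (Ex P F)).
  by rewrite FE; exact: small_ball_mean_ge.
by apply: Ex_le => // w; exact: small_ball_product_le.
Qed.

End gaussian_pair.

(** * Lower bounds for first moments *)

Section norm_lower_bounds.
Context {R : realType} {d : measure_display} {T : measurableType d}.
Variable P : probability T R.

Lemma weighted_abs_le_vnorm n (tau : 'I_n -> R) (z : 'cV[R]_n) :
  (forall l, 0 <= tau l) ->
  \sum_l tau l * `|z l 0| <= Num.sqrt (\sum_l tau l ^+ 2) * vnorm z.
Proof.
move=> tau0.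
have s0 : 0 <= \sum_l tau l * `|z l 0| by apply: sumr_ge0 => l _; rewrite mulr_ge0.
have t0 : 0 <= \sum_l tau l ^+ 2 by apply: sumr_ge0 => l _; rewrite sqr_ge0.
rewrite -ler_sqr ?nnegrE ?mulr_ge0 ?sqrtr_ge0 ?vnorm_ge0// exprMn sqr_sqrtr// vnorm_sqr.
have := @weighted_CauchySchwarz _ _ (fun=> 1) tau (fun l => `|z l 0|) (fun=> ler01).
congr (_ ^+ 2 <= _ * _); apply: eq_bigr => l _; rewrite mul1r//.
by rewrite real_normK ?num_real// expr2.
Qed.

(** Pairing the absolute coordinates with the weights [tau] reduces the mean of a norm to first
    moments of single coordinates. Weights proportional to the coordinate bounds lose nothing in
    Cauchy-Schwarz. *)
Lemma mean_norm_ge n (tau : 'I_n -> R) (z : T -> 'cV[R]_n) (D : T -> R) (kappa : R) :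
  (forall l, 0 <= tau l) -> (forall l, L1 P (fun w => `|z w l 0|)) ->
  (forall l, kappa * tau l <= Ex P (fun w => `|z w l 0|)) ->
  L1 P D -> (forall w, vnorm (z w) <= D w) -> 0 <= kappa ->
  kappa * Num.sqrt (\sum_l tau l ^+ 2) <= Ex P D.
Proof.
move=> tau0 lz ez lD zD k0; set t := \sum_l tau l ^+ 2.
have D0 : 0 <= Ex P D by apply: Ex_ge0 => w; rewrite (le_trans (vnorm_ge0 _) (zD w)).
have t0 : 0 <= t by apply: sumr_ge0 => l _; rewrite sqr_ge0.
have [t1|t1] := eqVneq t 0; first by rewrite t1 sqrtr0 mulr0.
have st0 : 0 < Num.sqrt t by rewrite sqrtr_gt0 lt_def t1.
rewrite -(ler_pM2l st0) mulrCA -expr2 sqr_sqrtr// -ExZ//.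
have lS : L1 P (fun w => \sum_l tau l * `|z w l 0|) by apply: L1_sum => l _; exact: L1Z.
apply: (@le_trans _ _ (Ex P (fun w => \sum_l tau l * `|z w l 0|))); last first.
  apply: Ex_le => //; first exact: L1Z.
  move=> w; apply: (le_trans (weighted_abs_le_vnorm _ tau0)).
  by rewrite ler_wpM2l ?sqrtr_ge0.
rewrite Ex_sum; last by move=> l _; exact: L1Z.
rewrite mulr_sumr; apply: ler_sum => l _.
by rewrite ExZ// expr2 mulrCA ler_wpM2l.
Qed.

(* Integrate [|y| >= y^2 / h - y^4 / h^3] with [h = 80 * expR 2]. *)
Lemma mean_abs_ge (y : T -> R) : measurable_fun setT y ->
  (\int[P]_w (expR (y w))%:E <= (expR 4)%:E)%E ->
  (\int[P]_w (expR (- y w))%:E <= (expR 4)%:E)%E ->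
  L1 P (fun w => y w ^+ 2) -> 64^-1 <= Ex P (fun w => y w ^+ 2) ->
  (128 * 80 * expR 2)^-1 <= Ex P (fun w => `|y w|).
Proof.
move=> my hp hm l2 e2.
have mp : measurable_fun setT (fun w => expR (y w)) by exact: measurableT_comp.
have mm : measurable_fun setT (fun w => expR (- y w)).
  by apply: measurableT_comp => //; exact: measurableT_comp.
have [lp ep] := L1_ge0 mp (fun w => expR_ge0 _) hp.
have [lm em] := L1_ge0 mm (fun w => expR_ge0 _) hm.
have h4 w : y w ^+ 4 <= 24 * (expR (y w) + expR (- y w)).
  have h (x : R) : 0 <= x -> x ^+ 4 <= 24 * expR x.
    by move=> x0; have := @expR_ge1Dxn R x 3 x0; rewrite (_ : 4`! = 24)//; lra.
  case: (leP 0 (y w)) => y0.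
    by have := h _ y0; have := expR_ge0 (- y w); lra.
  have := h (- y w) _; rewrite oppr_ge0 (ltW y0) => /(_ isT).
  rewrite (_ : (- y w) ^+ 4 = y w ^+ 4); last by ring.
  by have := expR_ge0 (y w); lra.
have lB : L1 P (fun w => 24 * (expR (y w) + expR (- y w))) by apply: L1Z; exact: L1D.
have l4 : L1 P (fun w => y w ^+ 4).
  apply: (L1_le _ lB) => [|w]; first exact: measurable_funX.
  by rewrite ger0_norm ?exprn_even_ge0.
have e4 : Ex P (fun w => y w ^+ 4) <= 48 * expR 4.
  apply: (le_trans (Ex_le l4 lB h4)); rewrite ExZ ?ExD//; last exact: L1D.
  by lra.
(* Large enough that [48 * expR 4 / h ^+ 2 = 48 / 6400 <= 128^-1]: the quartic term consumes at most
   half of [64^-1]. *)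
pose h := 80 * expR (2 : R).
have E2 : 0 < expR 2 :> R by exact: expR_gt0.
have h0 : 0 < h by rewrite /h mulr_gt0.
have e22 : expR 4 = expR 2 ^+ 2 :> R by rewrite expr2 -expRD; congr expR; ring.
pose F w := h^-1 * y w ^+ 2 - h ^- 3 * y w ^+ 4.
have lF : L1 P F by apply: L1B; exact: L1Z.
apply: (@le_trans _ _ (Ex P F)).
  rewrite ExB ?ExZ//; [|exact: L1Z|exact: L1Z].
  have b1 : h^-1 * 64^-1 <= h^-1 * Ex P (fun w => y w ^+ 2).
    by rewrite ler_wpM2l// invr_ge0 ltW.
  have b2 : h ^- 3 * Ex P (fun w => y w ^+ 4) <= h ^- 3 * (48 * expR 4).
    by rewrite ler_wpM2l// invr_ge0 exprn_ge0// ltW.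
  have -> : (128 * 80 * expR 2)^-1 = h^-1 * 128^-1 by rewrite /h; field; rewrite gt_eqF.
  have b3 : h ^- 3 * (48 * expR 4) = h^-1 * (48 / 80 / 80).
    by rewrite e22 /h; field; rewrite gt_eqF.
  have : 0 < h^-1 by rewrite invr_gt0.
  lra.
apply: Ex_le => // [|w]; first by apply: L1_norm; exact: L1_of_sqr.
rewrite /F; set x := `|y w| / h.
have x0 : 0 <= x by rewrite divr_ge0// ltW.
have -> : y w ^+ 2 = (x * h) ^+ 2 by rewrite divfK ?gt_eqF// real_normK ?num_real.
have -> : y w ^+ 4 = (x * h) ^+ 4.
  by rewrite divfK ?gt_eqF// -[4%N]/(2 * 2)%N !exprM real_normK ?num_real.
have -> : `|y w| = x * h by rewrite divfK ?gt_eqF.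
have -> : h^-1 * (x * h) ^+ 2 - h ^- 3 * (x * h) ^+ 4 = (x ^+ 2 - x ^+ 4) * h.
  by field; rewrite gt_eqF.
rewrite ler_pM2r//.
have [x1|x1] := leP x 1; first by have := exprn_ge0 4 x0; nra.
have h3 : x ^+ 2 <= x ^+ 4 by rewrite ler_eXn2l// ltW.
by apply: (@le_trans _ _ 0) => //; rewrite subr_le0.
Qed.

End norm_lower_bounds.

Section lower_bound_arithmetic.
Context {R : realType}.

(** The bound of [mean_abs_ge] times 8, which undoes the normalisation by [2 * (2 * s) * (2 * t)] in
    [bilinear_lower_bound]. *)
Definition kappa0 : R := 8 * (128 * 80 * expR 2)^-1.

Lemma kappa0_gt0 : 0 < kappa0.
Proof. by rewrite /kappa0 mulr_gt0// invr_gt0 mulr_gt0// expR_gt0. Qed.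

Lemma lower_rank_arith (k a b r n v : R) : 0 <= k -> 0 <= a -> 0 <= b -> 0 <= r ->
  0 < n -> a / 2 <= v ->
  k / 2 * (Num.sqrt (a * b) * Num.sqrt (r / n)) <=
  k * (Num.sqrt v / Num.sqrt n) * Num.sqrt (r * b).
Proof.
move=> k0 a0 b0 r0 n0 av; have v0 : 0 <= v by lra.
rewrite !sqrtrM// sqrtrV ?(ltW n0)//.
have h : Num.sqrt a <= 2 * Num.sqrt v.
  by rewrite -ler_sqr ?nnegrE ?mulr_ge0 ?sqrtr_ge0// exprMn !sqr_sqrtr//; lra.
set q := (Num.sqrt n)^-1; have q0 : 0 <= q by rewrite invr_ge0 sqrtr_ge0.
set A := Num.sqrt a in h *; set V := Num.sqrt v in h *.
set B := Num.sqrt b; set S := Num.sqrt r.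
have C0 : 0 <= k * (q * (S * B)) by rewrite !mulr_ge0// sqrtr_ge0.
rewrite (_ : k / 2 * (A * B * (S * q)) = A / 2 * (k * (q * (S * B)))); last by field.
rewrite (_ : k * (V * q) * (S * B) = V * (k * (q * (S * B)))); last by ring.
by rewrite ler_wpM2r//; lra.
Qed.

(** The loss [s / n] in the product estimate is paid by a rank estimate, since
    [n^-1 <= Num.sqrt (rX / n)]. In units of [D], the first summand of the rate costs [2 / k] and
    the second [32 * (1 + 1 / k)]. *)
Lemma lower_combination (k s rX rY n D : R) : 0 < k -> 0 <= s -> 1 <= rX -> 1 <= rY ->
  1 <= n -> k * (s * Num.sqrt (rY / n)) <= D -> k * (s * Num.sqrt (rX / n)) <= D ->
  s * Num.sqrt (rX * rY) / 32 - s <= n * D ->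
  (34 / k + 32)^-1 * s * (Num.sqrt ((rX + rY) / n) + Num.sqrt (rX * rY) / n) <= D.
Proof.
move=> k0 s0 rX1 rY1 n1 hY hX hXY; have n0 : 0 < n by lra.
set a := Num.sqrt (rX / n) in hX *; set b := Num.sqrt (rY / n) in hY *.
have rXn : 0 <= rX / n by rewrite divr_ge0 ?(ltW n0)//; lra.
have rYn : 0 <= rY / n by rewrite divr_ge0 ?(ltW n0)//; lra.
have a0 : 0 <= a by exact: sqrtr_ge0.
have b0 : 0 <= b by exact: sqrtr_ge0.
have h1 : Num.sqrt ((rX + rY) / n) <= a + b.
  rewrite -ler_sqr ?nnegrE ?addr_ge0 ?sqrtr_ge0// sqrrD !sqr_sqrtr//; last first.
    by rewrite mulrDl addr_ge0.
  have ab0 : 0 <= a * b by rewrite mulr_ge0.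
  by rewrite mulrDl; lra.
have h2 : n^-1 <= a.
  rewrite -ler_sqr ?nnegrE ?invr_ge0 ?(ltW n0)// sqr_sqrtr// expr2.
  rewrite ler_wpM2r ?invr_ge0 ?(ltW n0)//.
  by rewrite (le_trans _ rX1)// invf_le1.
set c := Num.sqrt ((rX + rY) / n) in h1 *; set e := Num.sqrt (rX * rY) in hXY *.
have k10 : 0 < 34 / k + 32 by rewrite addr_gt0// divr_gt0.
rewrite -mulrA ler_pdivrMl//.
have sa : s * a <= D / k by rewrite ler_pdivlMr// mulrC.
have sb : s * b <= D / k by rewrite ler_pdivlMr// mulrC.
have sc : s * c <= D / k + D / k by rewrite (le_trans (ler_wpM2l s0 h1))// mulrDr lerD.
have sn : s / n <= D / k by rewrite (le_trans (ler_wpM2l s0 h2)).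
have se : s * (e / n) <= 32 * (D + s / n).
  rewrite mulrA ler_pdivrMr// (_ : 32 * (D + s / n) * n = 32 * (n * D + s)); last first.
    by field; rewrite gt_eqF.
  lra.
rewrite mulrDr (_ : (34 / k + 32) * D = 34 * (D / k) + 32 * D); last by ring.
lra.
Qed.

End lower_bound_arithmetic.

(** * Lower bounds on the mean deviation *)

Section gaussian_lower_bound.
Context {R : realType} {d : measure_display} {T : measurableType d}.
Variable P : probability T R.
Context (N m n : nat) (X : T -> 'cV[R]_m) (Y : T -> 'cV[R]_n).
Context (Xs : 'I_N -> T -> 'cV[R]_m) (Ys : 'I_N -> T -> 'cV[R]_n).
Hypothesis N0 : (1 <= N)%N.
Hypotheses (X2 : L2_random_vector P X) (Y2 : L2_random_vector P Y).
Hypotheses (cX : centered P X) (cY : centered P Y).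
Hypotheses (mXs : forall i, measurable_coords (Xs i)).
Hypotheses (mYs : forall i, measurable_coords (Ys i)).
Hypothesis lawXY : forall i, same_law P (Xs i) X (Ys i) Y.
Hypothesis indepXY : indep_pairs P Xs Ys.

Let N0' : 0 < N%:R :> R. Proof. by rewrite ltr0n. Qed.
Let M w := emp_dev P Xs Ys X Y w.
Let Phi i := pairing (Xs i) (Ys i).
Let SXY := cross_cov P X Y.

Let mPhi i : measurable_fun setT (Phi i). Proof. exact: measurable_pairing. Qed.
Let mXY : measurable_fun setT (pairing X Y).
Proof. by apply: measurable_pairing; exact: L2_coords. Qed.

Let law_L1 i (f : pairs R m n -> R) : measurable_fun setT f ->
  L1 P (f \o pairing X Y) -> L1 P (f \o Phi i).
Proof.
move=> mf; apply: (@identical_law_L1 _ _ _ P _ _ (@boxesT R m n) (@boxesI R m n)) => //.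
exact: same_law_boxes.
Qed.

Let law_Ex i (f : pairs R m n -> R) : measurable_fun setT f ->
  L1 P (f \o pairing X Y) -> Ex P (f \o Phi i) = Ex P (f \o pairing X Y).
Proof.
move=> mf; apply: (@identical_law_Ex _ _ _ P _ _ (@boxesT R m n) (@boxesI R m n)) => //.
exact: same_law_boxes.
Qed.

Let indep_Ex i j (f g : pairs R m n -> R) : i != j ->
  measurable_fun setT f -> measurable_fun setT g ->
  L1 P (f \o Phi i) -> L1 P (g \o Phi j) ->
  L1 P (fun w => f (Phi i w) * g (Phi j w)) /\
  Ex P (fun w => f (Phi i w) * g (Phi j w)) = Ex P (f \o Phi i) * Ex P (g \o Phi j).
Proof.
move=> ij mf mg lf lg.
exact: (family_ExM (@boxesT R m n) (@boxesI R m n) mPhi (indep_pairs_boxes indepXY) ij mf mg lf lg).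
Qed.

Section bilinear_statistic.
Variables (u : 'cV[R]_m) (v : 'cV[R]_n).
Let c := dot u (SXY *m v).
Let f (z : pairs R m n) : R := dot z.1 u * dot z.2 v - c.

Let mf : measurable_fun setT f.
Proof. by apply: measurable_funB => //; exact: measurable_pairs_ip. Qed.

Let lXY : L1 P (f \o pairing X Y).
Proof. by apply: L1B; [exact: (L1_ipM u v X2 Y2)|exact: L1_cst]. Qed.

Let eXY : Ex P (f \o pairing X Y) = 0.
Proof.
rewrite (_ : Ex P (f \o pairing X Y) = Ex P (fun w => ip X u w * ip Y v w - c))//.
rewrite ExB; [|exact: L1_ipM|exact: L1_cst].
by rewrite Ex_cst Ex_ipM// subrr.
Qed.

Lemma emp_dev_dotE w : dot u (M w *m v) = N%:R^-1 * \sum_i f (Phi i w).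
Proof. exact: emp_dev_dot. Qed.

Lemma emp_dev_dot_L1 : L1 P (fun w => dot u (M w *m v)).
Proof.
apply: (eq_L1 (fun w => esym (emp_dev_dotE w))); apply: L1Z; apply: L1_sum => i _.
exact: law_L1.
Qed.

Hypothesis l2 : L1 P (fun w => f (pairing X Y w) ^+ 2).

(* Independence kills the off-diagonal terms. *)
Lemma emp_dev_dot_sqr : L1 P (fun w => dot u (M w *m v) ^+ 2) /\
  Ex P (fun w => dot u (M w *m v) ^+ 2) =
  N%:R^-1 * Ex P (fun w => f (pairing X Y w) ^+ 2).
Proof.
have mf2 : measurable_fun setT (fun z => f z ^+ 2) by exact: measurable_funX.
pose V := Ex P (fun w => f (pairing X Y w) ^+ 2).
have H i j : L1 P (fun w => f (Phi i w) * f (Phi j w)) /\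
    Ex P (fun w => f (Phi i w) * f (Phi j w)) = (i == j)%:R * V.
  have [<-|ij] := eqVneq i j.
    have E w : f (Phi i w) * f (Phi i w) = ((fun z => f z ^+ 2) \o Phi i) w by rewrite /= expr2.
    split; first by apply: (eq_L1 (fun w => esym (E w))); exact: law_L1.
    by rewrite (eq_Ex P E) law_Ex// mul1r.
  have li := law_L1 i mf lXY; have lj := law_L1 j mf lXY.
  have [l e] := indep_Ex ij mf mf li lj.
  by split => //; rewrite e (law_Ex i mf lXY) eXY !mul0r.
have E w : dot u (M w *m v) ^+ 2 = N%:R^-1 ^+ 2 * \sum_i \sum_j f (Phi i w) * f (Phi j w).
  rewrite emp_dev_dotE exprMn; congr (_ * _).
  by rewrite expr2 mulr_suml; apply: eq_bigr => i _; rewrite mulr_sumr.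
have lS : L1 P (fun w => \sum_i \sum_j f (Phi i w) * f (Phi j w)).
  by apply: L1_sum => i _; apply: L1_sum => j _; case: (H i j).
split; first by apply: (eq_L1 (fun w => esym (E w))); exact: L1Z.
rewrite (eq_Ex P E) ExZ// Ex_sum; last by move=> i _; apply: L1_sum => j _; case: (H i j).
have -> : \sum_(i < N) Ex P (fun w => \sum_j f (Phi i w) * f (Phi j w)) = N%:R * V.
  under eq_bigr => i _.
    rewrite Ex_sum; last by move=> j _; case: (H i j).
    rewrite (bigD1 i)//= big1; last first.
      by move=> j /negbTE ji; case: (H i j) => _ ->; rewrite eq_sym ji mul0r.
    rewrite addr0; case: (H i i) => _ ->; rewrite eqxx mul1r; over.
  by rewrite sumr_const card_ord mulr_natl.
by rewrite -/V; field; rewrite gt_eqF.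
Qed.

End bilinear_statistic.

Hypothesis gauss : jointly_gaussian P X Y.

Let gauss_ip u v (a b : R) : gaussian_rv P (fun w => a * ip X u w + b * ip Y v w).
Proof.
move: (gauss (a *: u) (b *: v)); congr gaussian_rv; apply/funext => w.
by rewrite !ipE !dotZr.
Qed.

Let gauss_X u : gaussian_rv P (ip X u).
Proof. by move: (gauss_ip u 0 1 0); congr gaussian_rv; apply/funext => w; ring. Qed.

Let gauss_Y v : gaussian_rv P (ip Y v).
Proof. by move: (gauss_ip 0 v 0 1); congr gaussian_rv; apply/funext => w; ring. Qed.

Let ip_centered k (Z : T -> 'cV[R]_k) x : L2_random_vector P Z -> centered P Z ->
  Ex P (ip Z x) = 0.
Proof.
move=> Z2 cZ; have lZ j : L1 P (fun w => Z w j 0).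
  by apply: L1_of_sqr; [exact: L2_coords|exact: L2_coord_sqr].
have lZx j : L1 P (fun w => Z w j 0 * x j 0).
  by apply: (eq_L1 (f := fun w => x j 0 * Z w j 0)) => [w|]; [rewrite mulrC|exact: L1Z].
rewrite Ex_sum// big1// => j _.
rewrite (eq_Ex P (g := fun w => x j 0 * Z w j 0)); last by move=> w; rewrite mulrC.
by rewrite ExZ// cZ mulr0.
Qed.

Lemma gaussian_subg_const :
  (cross_cov P X X != 0 -> subg_const P X <= 2) /\
  (cross_cov P Y Y != 0 -> subg_const P Y <= 2).
Proof.
have H k (Z : T -> 'cV[R]_k) : L2_random_vector P Z -> centered P Z ->
    (forall x, gaussian_rv P (ip Z x)) -> cross_cov P Z Z != 0 -> subg_const P Z <= 2.
  move=> Z2 cZ gZ Z0; apply: ge_inf.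
    by exists 0 => K [/ltW].
  split=> // x _; apply: gaussian_psi2norm => //; first exact: L2_ip_sqr.
  exact: ip_centered.
by split; exact: H.
Qed.

(** The statistic is scaled to have second moment at least [64^-1] and exponential moments at most
    [expR 4] on both sides, uniformly in [N], as [mean_abs_ge] requires. *)
Lemma bilinear_lower_bound u v :
  kappa0 * (Num.sqrt (dot u (cross_cov P X X *m u)) *
    Num.sqrt (dot v (cross_cov P Y Y *m v)) / Num.sqrt N%:R) <=
  Ex P (fun w => `|dot u (M w *m v)|).
Proof.
set vx := dot u _; set vy := dot v _.
have vxE : Ex P (fun w => ip X u w ^+ 2) = vx by exact: Ex_ip_sqr.
have vyE : Ex P (fun w => ip Y v w ^+ 2) = vy by exact: Ex_ip_sqr.
have E0 : 0 <= Ex P (fun w => `|dot u (M w *m v)|) by apply: Ex_ge0 => w.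
have vx0 : 0 <= vx by exact: covariance_quad_ge0.
have vy0 : 0 <= vy by exact: covariance_quad_ge0.
have [vx1|vx1] := eqVneq vx 0; first by rewrite vx1 sqrtr0 !mul0r mulr0.
have [vy1|vy1] := eqVneq vy 0; first by rewrite vy1 sqrtr0 mulr0 mul0r mulr0.
pose s := Num.sqrt vx; pose t := Num.sqrt vy; pose q := Num.sqrt (N%:R : R).
have s0 : 0 < s by rewrite sqrtr_gt0 lt_def vx1.
have t0 : 0 < t by rewrite sqrtr_gt0 lt_def vy1.
have q0 : 0 < q by rewrite sqrtr_gt0.
have q2 : q ^+ 2 = N%:R by rewrite sqr_sqrtr// ltW.
have q1 : 1 <= q.
  by rewrite -(@ler_sqr _ 1 q) ?nnegrE ?(ltW q0)// q2 expr1n ler1n.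
have lx := L2_ip_sqr u X2; have ly := L2_ip_sqr v Y2.
have ex := ip_centered u X2 cX; have ey := ip_centered v Y2 cY.
pose a := 2 * s; pose b := 2 * t.
have a0 : 0 < a by rewrite mulr_gt0.
have b0 : 0 < b by rewrite mulr_gt0.
have hx : (\int[P]_w (expR (ip X u w ^+ 2 / a ^+ 2))%:E <= 2%:E)%E.
  apply: gaussian_expR_sqr => //.
  by rewrite vxE /a exprMn sqr_sqrtr//; lra.
have hy : (\int[P]_w (expR (ip Y v w ^+ 2 / b ^+ 2))%:E <= 2%:E)%E.
  apply: gaussian_expR_sqr => //.
  by rewrite vyE /b exprMn sqr_sqrtr//; lra.
(* Then [l * (a * b) = (2 * q)^-1], which is at most [2^-1], and the exponent
   [16 * (l * (a * b)) ^+ 2 * N%:R] equals 4. *)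
pose l := (2 * (a * b) * q)^-1.
have ab0 : 0 < a * b by rewrite mulr_gt0.
have l0 : 0 < l by rewrite invr_gt0 !mulr_gt0.
have lab : l * (a * b) = (2 * q)^-1 by rewrite /l; field; rewrite !gt_eqF.
have lab2 : l * (a * b) <= 2^-1.
  by rewrite lab lef_pV2 ?posrE ?mulr_gt0// ler_peMr.
have l16 : 16 * (l * (a * b)) ^+ 2 * N%:R = 4.
  by rewrite lab -q2; field; rewrite gt_eqF.
pose y w := l * N%:R * dot u (M w *m v).
have hp : (\int[P]_w (expR (y w))%:E <= (expR 4)%:E)%E.
  have := @emp_dev_mgf _ _ _ P N m n X Y Xs Ys N0 X2 Y2 mXs mYs lawXY indepXY u v a b l a0 b0 hx hy.
  by rewrite (gtr0_norm l0) l16; apply.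
have hm : (\int[P]_w (expR (- y w))%:E <= (expR 4)%:E)%E.
  have -> : (\int[P]_w (expR (- y w))%:E =
      \int[P]_w (expR (- l * N%:R * dot u (M w *m v)))%:E)%E.
    by apply: eq_integral => w _; rewrite /y !mulNr.
  have -> : 4 = 16 * (- l * (a * b)) ^+ 2 * N%:R :> R by rewrite -l16; ring.
  have := @emp_dev_mgf _ _ _ P N m n X Y Xs Ys N0 X2 Y2 mXs mYs lawXY indepXY u v a b (- l) a0 b0 hx hy.
  by rewrite normrN (gtr0_norm l0); apply.
have [lv ev] := gaussian_product_variance (gauss_ip u v) lx ly ex ey.
rewrite vxE vyE Ex_ipM// in lv ev.
have [l2 e2] := emp_dev_dot_sqr lv.
have ly1 := emp_dev_dot_L1 u v.
have my : measurable_fun setT y.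
  by apply: measurable_funM => //; exact: L1_measurable ly1.
have ly2 : L1 P (fun w => y w ^+ 2) by exact: L1_sqrZ.
have ey2 : 64^-1 <= Ex P (fun w => y w ^+ 2).
  rewrite (eq_Ex P (g := fun w => (l * N%:R) ^+ 2 * dot u (M w *m v) ^+ 2)); last first.
    by move=> w; rewrite /y exprMn.
  rewrite ExZ// e2.
  apply: (@le_trans _ _ ((l * N%:R) ^+ 2 * (N%:R^-1 * (vx * vy)))).
    rewrite (_ : vx = s ^+ 2); last by rewrite sqr_sqrtr.
    rewrite (_ : vy = t ^+ 2); last by rewrite sqr_sqrtr.
    rewrite /l /a /b -q2 le_eqVlt; apply/orP; left; apply/eqP.
    by field; rewrite !gt_eqF.
  by rewrite ler_wpM2l ?sqr_ge0// ler_wpM2l// invr_ge0 ltW.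
have := mean_abs_ge my hp hm ly2 ey2.
have lN0 : 0 < l * N%:R by rewrite mulr_gt0.
rewrite (eq_Ex P (g := fun w => l * N%:R * `|dot u (M w *m v)|)); last first.
  by move=> w; rewrite /y normrM gtr0_norm.
rewrite ExZ; last exact: L1_norm.
rewrite -ler_pdivrMl//; apply: le_trans.
rewrite /kappa0 -/s -/t -/q le_eqVlt; apply/orP; left; apply/eqP.
rewrite /l /a /b -q2; field; rewrite !gt_eqF//; exact: expR_gt0.
Qed.

Hypotheses (X0 : cross_cov P X X != 0) (Y0 : cross_cov P Y Y != 0).
Let SX := cross_cov P X X.
Let SY := cross_cov P Y Y.
Let rX := eff_rank SX.
Let rY := eff_rank SY.
Let sigma := Num.sqrt (opnorm SX * opnorm SY).
Let dev w := opnorm (M w).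
Hypothesis ldev : L1 P dev.

Let diagE k (Z : T -> 'cV[R]_k) j :
  dot (delta_mx j 0) (cross_cov P Z Z *m delta_mx j 0) = cross_cov P Z Z j j.
Proof.
rewrite dotC dot_deltar mxE (bigD1 j)//= [X in _ * X]mxE !eqxx mulr1.
by rewrite big1 ?addr0// => i ij; rewrite [X in _ * X]mxE (negbTE ij) mulr0.
Qed.

Let sum_diag k (Z : T -> 'cV[R]_k) :
  \sum_j Num.sqrt (cross_cov P Z Z j j) ^+ 2 = \tr (cross_cov P Z Z).
Proof. by apply: eq_bigr => j _; rewrite sqr_sqrtr// covariance_diag_ge0. Qed.

(** For fixed [u] the norm of [(M w)^T *m u] is bounded below through its coordinates, each a
    bilinear statistic; the squared weights [SY j j] sum to the trace, which is [rY * opnorm SY]. *)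
Lemma lower_rank_right : kappa0 / 2 * (sigma * Num.sqrt (rY / N%:R)) <= Ex P dev.
Proof.
have [u u1 uS] := covariance_large_direction X2 X0.
have a0 := opnorm_covariance_gt0 X0; have b0 := opnorm_covariance_gt0 Y0.
pose kappa := kappa0 * (Num.sqrt (dot u (SX *m u)) / Num.sqrt N%:R).
have k0 : 0 <= kappa by rewrite mulr_ge0 ?(ltW kappa0_gt0)// divr_ge0 ?sqrtr_ge0.
have coordE w j : ((M w)^T *m u) j 0 = dot u (M w *m delta_mx j 0).
  by rewrite dot_mulmx dot_deltar.
have h : kappa * Num.sqrt (\sum_j Num.sqrt (SY j j) ^+ 2) <= Ex P dev.
  apply: (@mean_norm_ge _ _ _ P n _ (fun w => (M w)^T *m u)) => //.
  - move=> j; apply: (eq_L1 (f := fun w => `|dot u (M w *m delta_mx j 0)|)).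
      by move=> w; rewrite coordE.
    by apply: L1_norm; exact: emp_dev_dot_L1.
  - move=> j; have := bilinear_lower_bound u (delta_mx j 0).
    rewrite diagE /kappa -/SX -/SY => h; rewrite (eq_Ex P (g := fun w => `|dot u (M w *m delta_mx j 0)|)).
      by apply: le_trans h; rewrite le_eqVlt; apply/orP; left; apply/eqP; ring.
    by move=> w; rewrite coordE.
  - by move=> w; rewrite (le_trans (vnorm_mulmx _ _))// u1 mulr1 opnorm_trmx.
apply: le_trans h; rewrite sum_diag trace_eff_rank//.
apply: lower_rank_arith; rewrite ?(ltW kappa0_gt0) ?(ltW a0) ?(ltW b0) ?N0' ?(ltW uS)//.
by rewrite (le_trans ler01)// eff_rank_ge1.
Qed.

Lemma lower_rank_left : kappa0 / 2 * (sigma * Num.sqrt (rX / N%:R)) <= Ex P dev.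
Proof.
have [v v1 vS] := covariance_large_direction Y2 Y0.
have a0 := opnorm_covariance_gt0 X0; have b0 := opnorm_covariance_gt0 Y0.
pose kappa := kappa0 * (Num.sqrt (dot v (SY *m v)) / Num.sqrt N%:R).
have k0 : 0 <= kappa by rewrite mulr_ge0 ?(ltW kappa0_gt0)// divr_ge0 ?sqrtr_ge0.
have coordE w j : (M w *m v) j 0 = dot (delta_mx j 0) (M w *m v).
  by rewrite dotC dot_deltar.
have h : kappa * Num.sqrt (\sum_j Num.sqrt (SX j j) ^+ 2) <= Ex P dev.
  apply: (@mean_norm_ge _ _ _ P m _ (fun w => M w *m v)) => //.
  - move=> j; apply: (eq_L1 (f := fun w => `|dot (delta_mx j 0) (M w *m v)|)).
      by move=> w; rewrite coordE.
    by apply: L1_norm; exact: emp_dev_dot_L1.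
  - move=> j; have := bilinear_lower_bound (delta_mx j 0) v.
    rewrite diagE /kappa -/SX -/SY => h; rewrite (eq_Ex P (g := fun w => `|dot (delta_mx j 0) (M w *m v)|)).
      by apply: le_trans h; rewrite le_eqVlt; apply/orP; left; apply/eqP; ring.
    by move=> w; rewrite coordE.
  - by move=> w; rewrite (le_trans (vnorm_mulmx _ _))// v1 mulr1.
apply: le_trans h; rewrite sum_diag trace_eff_rank// /sigma [opnorm SX * _]mulrC.
apply: lower_rank_arith; rewrite ?(ltW kappa0_gt0) ?(ltW a0) ?(ltW b0) ?N0' ?(ltW vS)//.
by rewrite (le_trans ler01)// eff_rank_ge1.
Qed.

(** As the inverse of 0 is 0, the zero vector is sent to itself, and [dot x (unit_part x) = vnorm x]
    holds without exception. *)
Let unit_part k (x : 'cV[R]_k) : 'cV[R]_k := (vnorm x)^-1 *: x.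

Let vnorm_unit_part k (x : 'cV[R]_k) : vnorm (unit_part x) <= 1.
Proof.
rewrite vnormZ normfV ger0_norm ?vnorm_ge0//.
have [->|x0] := eqVneq (vnorm x) 0; first by rewrite mulr0 ler01.
by rewrite mulVf.
Qed.

Let dot_unit_part k (x : 'cV[R]_k) : dot x (unit_part x) = vnorm x.
Proof.
rewrite dotZr -vnorm_sqr expr2; have [->|x0] := eqVneq (vnorm x) 0; first by rewrite !mulr0.
by rewrite mulKf.
Qed.

Let normX (z : pairs R m n) : R := vnorm z.1 * vnorm z.2.
Let cell k l (z : pairs R m n) : R := unit_part z.1 k 0 * unit_part z.2 l 0.
Let entry k l (z : pairs R m n) : R := z.1 k 0 * z.2 l 0 - SXY k l.

Let measurable_vnorm1 : measurable_fun setT (fun z : pairs R m n => vnorm z.1).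
Proof. by apply: measurable_vnorm => k; exact: measurable_coordl. Qed.

Let measurable_vnorm2 : measurable_fun setT (fun z : pairs R m n => vnorm z.2).
Proof. by apply: measurable_vnorm => k; exact: measurable_coordr. Qed.

Let measurable_inverse (f : pairs R m n -> R) : measurable_fun setT f ->
  (forall z, 0 <= f z) -> measurable_fun setT (fun z => (f z)^-1).
Proof.
move=> mf f0; rewrite (_ : (fun z => _) = fun z => (f z) `^ (-1)).
  have mp : measurable_fun setT (fun x : R => x `^ (-1)) by exact: measurable_powR.
  exact: (measurableT_comp mp mf).
by apply/funext => z; rewrite powR_inv1.
Qed.

Let measurable_cell k l : measurable_fun setT (cell k l).
Proof.
rewrite (_ : cell k l = fun z => (vnorm z.1)^-1 * z.1 k 0 * ((vnorm z.2)^-1 * z.2 l 0)).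
  apply: measurable_funM; apply: measurable_funM.
  - by apply: measurable_inverse => // z; exact: vnorm_ge0.
  - exact: measurable_coordl.
  - by apply: measurable_inverse => // z; exact: vnorm_ge0.
  - exact: measurable_coordr.
by apply/funext => z; rewrite /cell !mxE.
Qed.

Let cell_le1 k l z : `|cell k l z| <= 1.
Proof.
rewrite normrM mulr_ile1//; first exact: le_trans (coord_le_vnorm _ _) (vnorm_unit_part _).
exact: le_trans (coord_le_vnorm _ _) (vnorm_unit_part _).
Qed.

Let L1_normX : L1 P (normX \o pairing X Y).
Proof.
have lX : L1 P (fun w => vnorm (X w) ^+ 2).
  apply: (eq_L1 (f := fun w => \sum_k X w k 0 ^+ 2)).
    by move=> w; rewrite vnorm_sqr; apply: eq_bigr => k _; rewrite expr2.
  by apply: L1_sum => k _; exact: L2_coord_sqr.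
have lY : L1 P (fun w => vnorm (Y w) ^+ 2).
  apply: (eq_L1 (f := fun w => \sum_k Y w k 0 ^+ 2)).
    by move=> w; rewrite vnorm_sqr; apply: eq_bigr => k _; rewrite expr2.
  by apply: L1_sum => k _; exact: L2_coord_sqr.
by apply: (L1M (f := fun w => vnorm (X w)) (g := fun w => vnorm (Y w))) => //;
  apply: measurable_vnorm; exact: L2_coords.
Qed.

(** Each norm is bounded below by its absolute coordinates weighted with standard deviations. Every
    mixed mean returns its own weight over 32, so the double sum is the product of the traces over
    32. *)
Lemma mean_norm_product :
  Num.sqrt (\tr SX * \tr SY) / 32 <= Ex P (normX \o pairing X Y).
Proof.
pose sg k := Num.sqrt (SX k k); pose tu l := Num.sqrt (SY l l).
have sg0 k : 0 <= sg k by exact: sqrtr_ge0.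
have tu0 l : 0 <= tu l by exact: sqrtr_ge0.
have tX0 : 0 < \tr SX.
  by rewrite (lt_le_trans (opnorm_covariance_gt0 X0))// opnorm_covariance_le_trace.
have tY0 : 0 < \tr SY.
  by rewrite (lt_le_trans (opnorm_covariance_gt0 Y0))// opnorm_covariance_le_trace.
have st0 : 0 < Num.sqrt (\tr SX * \tr SY) by rewrite sqrtr_gt0 mulr_gt0.
have ipd k (Z : T -> 'cV[R]_k) j w : ip Z (delta_mx j 0) w = Z w j 0 by exact: dot_deltar.
have H k l : L1 P (fun w => `|X w k 0| * `|Y w l 0|) /\
    sg k * tu l / 32 <= Ex P (fun w => `|X w k 0| * `|Y w l 0|).
  have := gaussian_abs_product (gauss_ip (delta_mx k 0) (delta_mx l 0))
    (L2_ip_sqr _ X2) (L2_ip_sqr _ Y2) (ip_centered _ X2 cX) (ip_centered _ Y2 cY).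
  rewrite !Ex_ip_sqr// !diagE.
  rewrite (_ : (fun w => _ * _) = (fun w => `|X w k 0| * `|Y w l 0|))//.
  by apply/funext => w; rewrite !ipd.
pose F w := \sum_k \sum_l sg k * tu l * (`|X w k 0| * `|Y w l 0|).
have lF : L1 P F.
  by apply: L1_sum => k _; apply: L1_sum => l _; apply: L1Z; case: (H k l).
rewrite -(ler_pM2l st0) -ExZ//.
apply: (@le_trans _ _ (Ex P F)); last first.
  apply: Ex_le => //; first exact: L1Z.
  move=> w; rewrite /F /normX /=.
  have -> : \sum_k \sum_l sg k * tu l * (`|X w k 0| * `|Y w l 0|) =
      (\sum_k sg k * `|X w k 0|) * (\sum_l tu l * `|Y w l 0|).
    rewrite mulr_suml; apply: eq_bigr => k _; rewrite mulr_sumr.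
    by apply: eq_bigr => l _; ring.
  rewrite sqrtrM ?(ltW tX0)// mulrACA.
  apply: ler_pM; rewrite ?sumr_ge0//; try by move=> k _; rewrite mulr_ge0.
    by rewrite -[X in Num.sqrt X]sum_diag; exact: weighted_abs_le_vnorm.
  by rewrite -[X in Num.sqrt X]sum_diag; exact: weighted_abs_le_vnorm.
rewrite mulrA -expr2 sqr_sqrtr; last by rewrite mulr_ge0// ltW.
rewrite Ex_sum; last by move=> k _; apply: L1_sum => l _; apply: L1Z; case: (H k l).
rewrite -!sum_diag mulr_suml mulr_suml; apply: ler_sum => k _.
rewrite Ex_sum; last by move=> l _; apply: L1Z; case: (H k l).
rewrite mulr_sumr mulr_suml; apply: ler_sum => l _.
have [lkl ekl] := H k l; rewrite ExZ//.
rewrite (_ : _ / 32 = sg k * tu l * (sg k * tu l / 32)); last by rewrite /sg /tu; ring.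
by rewrite ler_wpM2l// mulr_ge0.
Qed.

(* Testing the deviation on the directions of the first sample pair isolates the
   term |X_1| |Y_1| / N; the other samples are independent of these directions. *)
Lemma lower_rank_product : sigma * Num.sqrt (rX * rY) / 32 - sigma <= N%:R * Ex P dev.
Proof.
pose i0 : 'I_N := Ordinal N0.
pose u w := unit_part (Xs i0 w); pose v w := unit_part (Ys i0 w).
have lc k l : L1 P (cell k l \o Phi i0).
  apply: (@L1_bounded _ _ _ _ _ 1) => [|w]; last exact: cell_le1.
  exact: (measurableT_comp (measurable_cell k l) (mPhi i0)).
have me k l : measurable_fun setT (entry k l).
  apply: measurable_funB => //; apply: measurable_funM.
    exact: measurable_coordl.
  exact: measurable_coordr.
have le k l : L1 P (entry k l \o pairing X Y).
  by apply: L1B; [exact: (L1_coordM k l X2 Y2)|exact: L1_cst].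
have ee k l : Ex P (entry k l \o pairing X Y) = 0.
  rewrite (_ : entry k l \o pairing X Y = fun w => X w k 0 * Y w l 0 - SXY k l)//.
  by rewrite ExB ?Ex_cst; [rewrite mxE subrr|exact: L1_coordM|exact: L1_cst].
have H i k l : i != i0 -> L1 P (fun w => entry k l (Phi i w) * cell k l (Phi i0 w)) /\
    Ex P (fun w => entry k l (Phi i w) * cell k l (Phi i0 w)) = 0.
  move=> ii0; have li := law_L1 i (me k l) (le k l).
  have [l1 e1] := indep_Ex ii0 (me k l) (measurable_cell k l) li (lc k l).
  by split => //; rewrite e1 (law_Ex i (me k l) (le k l)) ee mul0r.
(* The contribution of the subtracted expectation in the first sample's own term; it is bounded
   pointwise by [sigma]. *)
pose Q w := \sum_k \sum_l SXY k l * cell k l (Phi i0 w).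
have QE w : dot (u w) (SXY *m v w) = Q w.
  rewrite /dot /Q; apply: eq_bigr => k _; rewrite [(SXY *m _) k 0]mxE mulr_sumr.
  by apply: eq_bigr => l _; rewrite /cell /u /v /=; ring.
have lQ : L1 P Q.
  by apply: L1_sum => k _; apply: L1_sum => l _; exact: (L1Z _ (lc k l)).
have Qs : Ex P Q <= sigma.
  rewrite -(Ex_cst P sigma); apply: Ex_le => [//||w]; first exact: L1_cst.
  rewrite -QE (le_trans (cross_cov_dot_le _ _ X2 Y2))// ler_piMr ?sqrtr_ge0//.
  by rewrite mulr_ile1 ?vnorm_ge0// vnorm_unit_part.
have mn : measurable_fun setT normX by exact: measurable_funM.
have ln : L1 P (normX \o Phi i0) by exact: law_L1.
(* Expanded entrywise, so that each summand is a centred function of one sample times a function of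
   another and has mean 0. *)
pose G w := \sum_(i < N | i != i0) \sum_k \sum_l entry k l (Phi i w) * cell k l (Phi i0 w).
have lGi i : i != i0 -> L1 P (fun w => \sum_k \sum_l entry k l (Phi i w) * cell k l (Phi i0 w)).
  by move=> ii0; apply: L1_sum => k _; apply: L1_sum => l _; case: (H i k l ii0).
have lG : L1 P G by exact: L1_sum.
have eG : Ex P G = 0.
  rewrite Ex_sum// big1// => i ii0; rewrite Ex_sum; last first.
    by move=> k _; apply: L1_sum => l _; case: (H i k l ii0).
  rewrite big1// => k _; rewrite Ex_sum; last by move=> l _; case: (H i k l ii0).
  by rewrite big1// => l _; case: (H i k l ii0).
have E w : N%:R * dot (u w) (M w *m v w) = normX (Phi i0 w) - Q w + G w.
  rewrite emp_dev_dot// mulrA mulfV ?gt_eqF// mul1r (bigD1 i0)//= !ipE QE !dot_unit_part.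
  congr (_ + _); apply: eq_bigr => i _; rewrite !ipE -QE /dot mulr_suml -sumrB.
  apply: eq_bigr => k _; rewrite mulr_sumr [(SXY *m _) k 0]mxE mulr_sumr -sumrB.
  by apply: eq_bigr => l _; rewrite /entry /cell /u /v /=; ring.
have lE : L1 P (fun w => normX (Phi i0 w) - Q w + G w) by apply: L1D => //; exact: L1B.
have h : Ex P (fun w => normX (Phi i0 w) - Q w + G w) <= N%:R * Ex P dev.
  rewrite -ExZ//; apply: Ex_le => // [|w]; first exact: L1Z.
  rewrite -E ler_pM2l// (le_trans (dot_mulmx_le _ _ _))// ler_piMr ?opnorm_ge0//.
  by rewrite mulr_ile1 ?vnorm_ge0// vnorm_unit_part.
apply: le_trans h; rewrite ExD ?ExB//; last exact: L1B.
rewrite eG addr0 [X in _ <= X - _](law_Ex i0 mn L1_normX).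
apply: lerB => //; apply: le_trans mean_norm_product.
rewrite le_eqVlt; apply/orP; left; apply/eqP; congr (_ / _).
rewrite /sigma -sqrtrM; last by rewrite mulr_ge0 ?opnorm_ge0.
by rewrite !trace_eff_rank// -/rX -/rY -/SX -/SY; congr Num.sqrt; ring.
Qed.

Lemma gaussian_deviation_mean_ge :
  (34 / (kappa0 / 2) + 32)^-1 * sigma *
    (Num.sqrt ((rX + rY) / N%:R) + Num.sqrt (rX * rY) / N%:R) <= Ex P dev.
Proof.
apply: lower_combination.
- by rewrite divr_gt0 ?kappa0_gt0.
- exact: sqrtr_ge0.
- exact: eff_rank_ge1.
- exact: eff_rank_ge1.
- by rewrite ler1n.
- exact: lower_rank_right.
- exact: lower_rank_left.
- exact: lower_rank_product.
Qed.

End gaussian_lower_bound.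

Theorem theorem1 :
  exists C c : Rdefinitions.R, 0 < C /\ 0 < c /\
  forall (N dX dY : nat) (d : measure_display) (Omega : measurableType d)
    (P : probability Omega Rdefinitions.R)
    (X : Omega -> 'cV[Rdefinitions.R]_dX) (Y : Omega -> 'cV[Rdefinitions.R]_dY)
    (Xs : 'I_N -> Omega -> 'cV[Rdefinitions.R]_dX)
    (Ys : 'I_N -> Omega -> 'cV[Rdefinitions.R]_dY),
    (1 <= N)%N ->
    subgaussian P X -> subgaussian P Y ->
    centered P X -> centered P Y ->
    cross_cov P X X != 0 -> cross_cov P Y Y != 0 ->
    (forall i, measurable_coords (Xs i)) ->
    (forall i, measurable_coords (Ys i)) ->
    (forall i, same_law P (Xs i) X (Ys i) Y) ->
    indep_pairs P Xs Ys ->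
    let SX := cross_cov P X X in
    let SY := cross_cov P Y Y in
    let rX := eff_rank SX in
    let rY := eff_rank SY in
    let KX := subg_const P X in
    let KY := subg_const P Y in
    let s := Num.sqrt (opnorm SX * opnorm SY) in
    let dev := fun w => opnorm (emp_dev P Xs Ys X Y w) in
    let rate := Num.sqrt ((rX + rY) / N%:R) + Num.sqrt (rX * rY) / N%:R in
    (* (i) *)
    (forall u : Rdefinitions.R, 1 <= u ->
       ((1 - expR (- u))%:E <=
        P [set w | (dev w <= C * KX * KY * s *
             (Num.sqrt ((rX + rY + u) / N%:R) +
              Num.sqrt ((rX + u) * (rY + u)) / N%:R))%R])%E) /\
    (* (ii) *)
    (\int[P]_w (dev w)%:E <= (C * KX * KY * s * rate)%:E)%E /\
    (* (iii) *)
    (jointly_gaussian P X Y ->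
       ((c * s * rate)%:E <= \int[P]_w (dev w)%:E)%E /\
       (\int[P]_w (dev w)%:E <= (C * s * rate)%:E)%E).
Proof.
(* [240 * 100] serves the tail and the mean; the factor 4 covers [KX * KY] in the Gaussian case,
   where both constants are at most 2. *)
exists (240 * 100 * 4), (34 / (kappa0 / 2) + 32)^-1; split; first lra.
split.
  by rewrite invr_gt0 addr_gt0// divr_gt0// divr_gt0// kappa0_gt0.
move=> N dX dY d Omega P X Y Xs Ys N0 sX sY cX cY X0 Y0 mXs mYs law indep.
move=> SX SY rX rY KX KY s dev rate.
have [X2 _] := sX; have [Y2 _] := sY.
have N0' : 0 < N%:R :> Rdefinitions.R by rewrite ltr0n.
have KX0 : 0 <= KX by rewrite (le_trans ler01)// subg_const_ge1.
have KY0 : 0 <= KY by rewrite (le_trans ler01)// subg_const_ge1.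
have s0 : 0 <= s by exact: sqrtr_ge0.
have rate0 : 0 <= rate by rewrite addr_ge0 ?divr_ge0 ?sqrtr_ge0 ?ler0n.
have mdev : measurable_fun setT dev by exact: measurable_dev.
have mean := deviation_mean N0 mXs mYs law indep X0 Y0 sX sY.
rewrite -/SX -/SY -/rX -/rY -/KX -/KY -/s -/rate in mean.
have meas e : measurable [set w | dev w <= e].
  rewrite (_ : [set w | _] = setT `&` dev @^-1` `]-oo, e]); first exact: mdev.
  by rewrite setTI; apply/seteqP; split => w /=; rewrite in_itv.
split; [move=> u u1|split; [|move=> gauss]].
- apply: le_trans (deviation_tail N0 mXs mYs law indep X0 Y0 sX sY u1) _.
  apply: le_measure; rewrite ?inE; [exact: meas|exact: meas|].
  move=> w /= h; apply: le_trans h _; rewrite -/SX -/SY -/rX -/rY -/KX -/KY -/s.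
  rewrite -!mulrA; set r := KX * _.
  have r0 : 0 <= r.
    by rewrite /r !mulr_ge0// addr_ge0 ?divr_ge0 ?sqrtr_ge0 ?ler0n.
  lra.
- apply: le_trans mean _; rewrite lee_fin -!mulrA; set r := KX * _.
  have r0 : 0 <= r by rewrite /r !mulr_ge0.
  lra.
have dev0 w : 0 <= dev w by exact: opnorm_ge0.
have [ldev _] := L1_ge0 mdev dev0 mean.
split.
  by rewrite integral_Ex// lee_fin; exact: gaussian_deviation_mean_ge.
have [/(_ X0) KX2 /(_ Y0) KY2] := gaussian_subg_const X2 Y2 cX cY gauss.
apply: le_trans mean _; rewrite lee_fin -!mulrA.
have sr0 : 0 <= s * rate by rewrite mulr_ge0.
have KK : KX * (KY * (s * rate)) <= 2 * (2 * (s * rate)).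
  by apply: ler_pM; rewrite ?mulr_ge0//; exact: ler_wpM2r.
move: (s * rate) sr0 KK => r r0; move: (KX * _) => k kr.
lra.
Qed.
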